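(* Let $\tau\in\mathfrak M_{1,c}(X^+)$. Suppose that $\tau$ is mean stable on $Y=\mathbb P^2\setminus\{[1:0:0]\}$. Let $r:=\prod_{L\in\mathrm{Min}(\tau)}\dim_{\mathbb C}(\mathrm{LS}({\cal U}_{f,\tau}(L)))$ (which is finite). Let $K$ be a compact subset of $Y$ such that $G_\tau(K)\subset K$ and $\bigcup_{L\in\mathrm{Min}(\tau)}L\subset\mathrm{int}(K)$. Then there exist constants $\alpha=\alpha(K)\in(0,1)$, $\lambda=\lambda(K)\in(0,1)$ and $C=C(K)>0$ such that for each $\varphi\in C^\alpha(K)$ all of the following hold. (1) $\|M_\tau^{nr}(\varphi)-\pi_{\tau,K}(\varphi)\|_\alpha\le C\lambda^n\|\varphi-\pi_{\tau,K}(\varphi)\|_\alpha$ for each $n\in\mathbb N$. (2) $\|M_\tau^n(\varphi-\pi_{\tau,K}(\varphi))\|_\alpha\le C\lambda^n\|\varphi-\pi_{\tau,K}(\varphi)\|_\alpha$ for each $n\in\mathbb N$. (3) $\|M_\tau^n(\varphi-\pi_{\tau,K}(\varphi))\|_\alpha\le C\lambda^n\|\varphi\|_\alpha$ for each $n\in\mathbb N$. (4) $\|\pi_{\tau,K}(\varphi)\|_\alpha\le C\|\varphi\|_\alpha$.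
   Context: $X^+$ is the set of all maps $f(x,y)=(y+\alpha,p(y)-\delta x)$ on $\mathbb C^2$ with $\alpha\in\mathbb C$, $\delta\in\mathbb C\setminus\{0\}$, $p$ a polynomial, $\deg p\ge2$. In $X^+$, $f_j=(y+\alpha_j,p_j(y)-\delta_jx)\to f=(y+\alpha,p(y)-\delta x)$ iff $\alpha_j\to\alpha$, $\delta_j\to\delta$, $\deg p_j=\deg p$ for all large $j$, and the coefficients of $p_j$ converge to those of $p$. $\mathbb C^2\subset\mathbb P^2$ via $(x,y)\mapsto[x:y:1]$; each $f\in X^+$ extends to a holomorphic self-map of $Y=\mathbb P^2\setminus\{[1:0:0]\}$ and is regarded as such. $d$ is the Fubini--Study distance on $\mathbb P^2$. $\mathfrak M_{1,c}(X^+)$: Borel probability measures on $X^+$ with compact support. $G_\tau=\{\gamma_n\circ\cdots\circ\gamma_1:n\in\mathbb N,\gamma_j\in\mathrm{supp}\,\tau\}$; $G_\tau(K)=\bigcup_{g\in G_\tau}g(K)$. $\tau$ is mean stable on $Y$ if there exist $n,m\in\mathbb N$, nonempty open subsets $U_1,\dots,U_m$ of $Y$, a nonempty compact $Q\subset\bigcup_jU_j$ and $c\in(0,1)$ such that: (a) for each $(\gamma_1,\dots,\gamma_n)\in(\mathrm{supp}\,\tau)^n$, $\gamma_n\circ\cdots\circ\gamma_1(\bigcup_jU_j)\subset Q$, and for each $j$ and $x,y\in U_j$, $d(\gamma_n\circ\cdots\circ\gamma_1(x),\gamma_n\circ\cdots\circ\gamma_1(y))\le c\,d(x,y)$; (b)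 for each $z\in Y$ there is $f_z\in G_\tau$ with $f_z(z)\in\bigcup_jU_j$. A nonempty compact $L\subset Y$ is a minimal set of $\tau$ if $L=\overline{\{g(z):g\in G_\tau\}}$ for each $z\in L$; $\mathrm{Min}(\tau)$ is the set of these (finite under the hypotheses). For a compact $E\subset Y$ with $G_\tau(E)\subset E$: $C(E)$ is the space of continuous functions $E\to\mathbb C$ with supremum norm; $M_\tau:C(E)\to C(E)$, $M_\tau(\varphi)(z)=\int\varphi(g(z))\,d\tau(g)$; ${\cal U}_{f,\tau}(E)$ is the set of $\varphi\in C(E)$, $\varphi\ne0$, with $M_\tau\varphi=a\varphi$ for some $a\in\mathbb C$, $|a|=1$. $\mathrm{LS}(A)$: finite complex linear combinations of elements of $A$. ${\cal B}_{0,\tau,K}=\{\varphi\in C(K):M_\tau^n\varphi\to0\}$. Under the hypotheses, $C(K)=\mathrm{LS}({\cal U}_{f,\tau}(K))\oplus{\cal B}_{0,\tau,K}$ with $\mathrm{LS}({\cal U}_{f,\tau}(K))$ finite-dimensional, and $\pi_{\tau,K}:C(K)\to\mathrm{LS}({\cal U}_{f,\tau}(K))$ is the associated (continuous) projection. For $\alpha\in(0,1)$, $\|\varphi\|_\alpha=\sup_{z\in K}|\varphi(z)|+\sup_{x,y\in K,x\ne y}|\varphi(x)-\varphi(y)|/d(x,y)^\alpha$ and $C^\alpha(K)=\{\varphi\in C(K):\|\varphi\|_\alpha<\infty\}$. *)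

(* Defs.v *)
From HB Require Import structures.
Set Warnings "-notation-overridden,-ambiguous-paths".
Set Warnings "-notation-incompatible-prefix,-redundant-canonical-projection".
From mathcomp Require Import all_boot all_order all_algebra generic_quotient.
From mathcomp Require Import complex.
From mathcomp Require Import all_classical all_reals all_analysis.

Set Implicit Arguments.
Unset Strict Implicit.
Unset Printing Implicit Defensive.

Import Order.TTheory GRing.Theory Num.Theory.
Import numFieldNormedType.Exports.

Local Open Scope classical_set_scope.
Local Open Scope ring_scope.
Local Open Scope complex_scope.
Local Open Scope quotient_scope.

(* R[i] is a numClosedFieldType, but the library gives the concrete type R[i]
   no topology of its own: take the one of its modulus. *)
HB.instance Definition _ (R : realType) := NormedModule.copy R[i] R[i]^o.

(* The modulus as a real number; the norm of R[i] is valued in R[i] itself. *)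
Notation cmod := Normc.normc.

Section ProjectivePlane.
Variable R : realType.
Local Notation C := R[i].

Definition row3 (x y z : C) : 'rV[C]_3 := \row_i [:: x; y; z]`_i.

Definition nzvec : topologicalType := set_type [set v : 'rV[C]_3 | v != 0].

Definition collinear (u v : nzvec) : bool :=
  `[< exists a : C, a != 0 /\ val u = a *: val v >].

Lemma collinear_refl : reflexive collinear.
Proof.
by move=> u; apply/asboolP; exists 1; rewrite scale1r oner_eq0.
Qed.

Lemma collinear_sym : symmetric collinear.
Proof.
move=> u v; apply/asboolP/asboolP => -[a [a0 e]]; exists a^-1;
  by rewrite invr_eq0 a0 e scalerA mulVf // scale1r.
Qed.

Lemma collinear_trans : transitive collinear.
Proof.
move=> v u w /asboolP[a [a0 eu]] /asboolP[b [b0 ev]]; apply/asboolP.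
by exists (a * b); rewrite mulf_neq0 // eu ev scalerA.
Qed.

Canonical collinear_equiv :=
  EquivRel collinear collinear_refl collinear_sym collinear_trans.

Definition P2 := quotient_topology {eq_quot collinear}.

HB.instance Definition _ := Topological.on P2.
HB.instance Definition _ := Quotient.on P2.

Lemma P2_piP u v : \pi_P2 u = \pi_P2 v <-> collinear u v.
Proof.
by split=> [/(eqmodP collinear_equiv)|/(eqmodP collinear_equiv)].
Qed.

Lemma row3_100_neq0 : row3 1 0 0 != 0.
Proof.
by apply/eqP => /rowP/(_ ord0)/eqP; rewrite !mxE /= oner_eq0.
Qed.

Lemma row3_100_nzvec : row3 1 0 0 \in [set v : 'rV[C]_3 | v != 0].
Proof. by rewrite inE /= row3_100_neq0. Qed.

Definition nzvec0 : nzvec :=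
  exist (fun v => v \in [set v : 'rV[C]_3 | v != 0]) _ row3_100_nzvec.

(* [hpoint v] is the point with homogeneous coordinates v, a dummy if v = 0;
   [hcoord z] is some vector of homogeneous coordinates of z. *)
Definition hpoint (v : 'rV[C]_3) : P2 :=
  \pi_P2 (insubd nzvec0 v).

Definition hcoord (z : P2) : 'rV[C]_3 :=
  val (repr z : nzvec).

Lemma hcoord_neq0 z : hcoord z != 0.
Proof. by rewrite /hcoord; case: (repr _) => v /=; rewrite inE. Qed.

Lemma hpointP v w : v != 0 -> w != 0 ->
  hpoint v = hpoint w <-> exists a : C, a != 0 /\ v = a *: w.
Proof.
move=> v0 w0; rewrite /hpoint.
have vE u : u != 0 ->
    val (insubd nzvec0 u) = u.
  by move=> u0; rewrite val_insubd mem_set.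
split=> [/P2_piP/asboolP[a [a0]]|[a [a0 e]]].
  by rewrite !vE // => e; exists a.
by apply/P2_piP/asboolP; exists a; rewrite !vE.
Qed.

Lemma hcoordK z : hpoint (hcoord z) = z.
Proof.
rewrite /hpoint /hcoord; set u := repr _.
rewrite (_ : insubd _ _ = u) ?reprK//.
by apply: val_inj; rewrite val_insubd (valP u).
Qed.

Lemma hpointK v : v != 0 -> exists a : C, a != 0 /\ hcoord (hpoint v) = a *: v.
Proof. by move=> v0; apply/hpointP; rewrite ?hcoord_neq0 // hcoordK. Qed.

Definition hdot (v w : 'rV[C]_3) : C := \sum_i v 0 i * (w 0 i)^*.
Definition hnorm (v : 'rV[C]_3) : R := Num.sqrt (\sum_i cmod (v 0 i) ^+ 2).

Definition fs_angle (v w : 'rV[C]_3) : R :=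
  acos (cmod (hdot v w) / (hnorm v * hnorm w)).

Definition fsdist (z w : P2) : R := fs_angle (hcoord z) (hcoord w).

Lemma hnormZ a v : hnorm (a *: v) = cmod a * hnorm v.
Proof.
rewrite /hnorm; under eq_bigr do rewrite mxE Normc.normcM exprMn.
rewrite -mulr_sumr sqrtrM ?sqr_ge0 // sqrtr_sqr ger0_norm //.
by case: a => a b; exact: sqrtr_ge0.
Qed.

Lemma fs_angleZ a b v w : a != 0 -> b != 0 ->
  fs_angle (a *: v) (b *: w) = fs_angle v w.
Proof.
have cn0 (c : C) : c != 0 -> cmod c != 0.
  by apply: contra_neq => /Normc.eq0_normc.
move=> /cn0 a0 /cn0 b0; rewrite /fs_angle !hnormZ; congr acos.
have -> : hdot (a *: v) (b *: w) = a * b^* * hdot v w.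
  rewrite /hdot mulr_sumr; apply: eq_bigr => i _.
  by rewrite !mxE rmorphM /= mulrACA.
have -> : cmod (a * b^* * hdot v w) = cmod a * cmod b * cmod (hdot v w).
  rewrite !Normc.normcM; congr (_ * _ * _).
  by case: (b) => x y /=; rewrite sqrrN.
by rewrite [X in _ / X]mulrACA -mulf_div divff ?mul1r // mulf_neq0.
Qed.

Lemma fsdist_hpoint v w : v != 0 -> w != 0 ->
  fsdist (hpoint v) (hpoint w) = fs_angle v w.
Proof.
move=> /hpointK[a [a0 ea]] /hpointK[b [b0 eb]].
by rewrite /fsdist ea eb fs_angleZ.
Qed.

Definition Y : topologicalType :=
  set_type [set z : P2 | z <> hpoint (row3 1 0 0)].

Definition ydist (z w : Y) : R := fsdist (val z) (val w).

End ProjectivePlane.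

Lemma cvg_seq_initial (S : choiceType) (T : topologicalType) (f : S -> T)
    (u : nat -> initial_topology f) (l : initial_topology f) :
  u @ \oo --> l <-> f (u j) @[j --> \oo] --> f l.
Proof.
split=> h A.
  by move=> hA; exact: (h _ (@initial_continuous _ _ f l A hA)).
rewrite nbhsE => -[_ [[D oD <-] Dl] BA].
have hD := h D (open_nbhs_nbhs (conj oD Dl)).
exact: (@filterS _ \oo _ _ _ (fun j => BA (u j)) hD).
Qed.

Lemma cvg_seq_ptws (V : topologicalType) (u : nat -> {ptws nat -> V})
    (l : {ptws nat -> V}) :
  u @ \oo --> l <-> forall i, u j i @[j --> \oo] --> l i.
Proof.
rewrite cvg_sup; split=> h i; have := h i.
  by move/(@cvg_seq_initial _ _ (fun f : nat -> V => f i) u l).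
by move=> ?; apply/(@cvg_seq_initial _ _ (fun f : nat -> V => f i) u l).
Qed.

Section XPlus.
Variable R : realType.
Local Notation C := R[i].

(* The triples (alpha, delta, p); [xmap_inj] below shows that the map
   determines its triple. *)
Definition Xplus : Type :=
  {u : C * C * {poly C} | (u.1.2 != 0) && (2 < size u.2)%N}.

Definition xshift (g : Xplus) : C := (val g).1.1.
Definition xdelta (g : Xplus) : C := (val g).1.2.
Definition xpoly (g : Xplus) : {poly C} := (val g).2.

Lemma xdelta_neq0 g : xdelta g != 0.
Proof. by case/andP: (valP g). Qed.

Lemma size_xpoly g : (2 < size (xpoly g))%N.
Proof. by case/andP: (valP g). Qed.

Definition xmap (g : Xplus) (u : C * C) : C * C :=
  (u.2 + xshift g, (xpoly g).[u.2] - xdelta g * u.1).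

Lemma xmap_inj : injective xmap.
Proof.
move=> g h e; apply: val_inj.
have es : xshift g = xshift h.
  by have [+ _] := congr1 (@^~ (0, 0)) e; rewrite /= !add0r.
have ep : xpoly g = xpoly h.
  pose q := xpoly g - xpoly h.
  suff q0 : q = 0 by apply/eqP; rewrite -subr_eq0 -/q q0.
  apply/eqP; apply: contraT => q0.
  pose s : seq C := [seq k%:R | k <- iota 0 (size q)].
  have us : uniq s.
    by rewrite map_inj_uniq ?iota_uniq // => m n /eqP; rewrite eqr_nat => /eqP.
  have rs : all (root q) s.
    apply/allP => y _; rewrite /root hornerD hornerN.
    have [_ /=] := congr1 (@^~ (0, y)) e.
    by rewrite !mulr0 !subr0 => ->; rewrite subrr.
  by have := max_poly_roots q0 rs us; rewrite size_map size_iota ltnn.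
have ed : xdelta g = xdelta h.
  have [_ /=] := congr1 (@^~ (1, 0)) e.
  by rewrite ep !mulr1 => /addrI /oppr_inj.
move: es ep ed; rewrite /xshift /xpoly /xdelta.
by case: (val g) => [[? ?] ?]; case: (val h) => [[? ?] ?] /= -> -> ->.
Qed.

(* alpha, delta, deg p and the coefficients of p; the topology of X^+ is the
   initial one (nat is discrete), see [Xplus_cvgP]. *)
Definition xdata (g : Xplus) : C * C * (nat * {ptws nat -> C}) :=
  (xshift g, xdelta g, ((size (xpoly g)).-1, fun i => (xpoly g)`_i)).

HB.instance Definition _ := Choice.on Xplus.
HB.instance Definition _ :=
  Topological.copy Xplus (initial_topology xdata).

Lemma Xplus_point_subproof :
  ((1 : C) != 0) && (2 < size ('X^2 : {poly C}))%N.
Proof. by rewrite oner_eq0 size_polyXn. Qed.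

Definition Xplus_point : Xplus :=
  exist (fun u : C * C * {poly C} => (u.1.2 != 0) && (2 < size u.2)%N)
    (0, 1, 'X^2)%R Xplus_point_subproof.

HB.instance Definition _ := isPointed.Build Xplus Xplus_point.

Lemma Xplus_cvgP (g_ : nat -> Xplus) (g : Xplus) :
  g_ @ \oo --> g <->
  [/\ xshift (g_ j) @[j --> \oo] --> xshift g,
      xdelta (g_ j) @[j --> \oo] --> xdelta g,
      \forall j \near \oo, size (xpoly (g_ j)) = size (xpoly g) &
      forall i, (xpoly (g_ j))`_i @[j --> \oo] --> (xpoly g)`_i].
Proof.
rewrite (@cvg_seq_initial _ _ (@xdata)).
have cvgpair (T1 T2 : topologicalType) (u : nat -> T1) (v : nat -> T2)
    (a : T1) (b : T2) :
    (u j, v j) @[j --> \oo] --> (a, b) <->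
    (u j @[j --> \oo] --> a) /\ (v j @[j --> \oo] --> b).
  split=> [h|[hu hv]]; last exact: cvg_pair.
  split=> A hA; first exact: (h (fst @^-1` A) (cvg_fst hA)).
  exact: (h (snd @^-1` A) (cvg_snd hA)).
have szE f : size (xpoly f) = (size (xpoly f)).-1.+1.
  by rewrite prednK //; apply: leq_trans (size_xpoly f).
have szcvg : (size (xpoly (g_ j))).-1 @[j --> \oo] --> (size (xpoly g)).-1 <->
    \forall j \near \oo, size (xpoly (g_ j)) = size (xpoly g).
  split=> [h|h].
    have hn : \forall j \near \oo,
        (size (xpoly (g_ j))).-1 = (size (xpoly g)).-1.
      by apply: (h [set _]); rewrite nbhs_principalE; apply/principal_filterP.
    by apply: filterS hn => j e; rewrite szE [RHS]szE e.
  move=> A; rewrite nbhs_principalE => /principal_filterP Ag.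
  by apply: filterS h => j /= ->; exact: Ag.
rewrite /xdata !cvgpair szcvg.
have [pt1 pt2] :=
  @cvg_seq_ptws C (fun j i => (xpoly (g_ j))`_i) (fun i => (xpoly g)`_i).
split=> [[[h1 h2] [h3 h4]]|[h1 h2 h3 h4]].
  by split; [exact: h1|exact: h2|exact: h3|exact: pt1 h4].
by split; [split|split]; [exact: h1|exact: h2|exact: h3|exact: pt2 h4].
Qed.

(* [(y + alpha z) z^(D-1) : z^D p(y/z) - delta x z^(D-1) : z^D], D = deg p *)
Definition xext_vec (g : Xplus) (v : 'rV[C]_3) : 'rV[C]_3 :=
  let x := v 0 0 in let y := v 0 1 in let z := v 0 2%:R in
  let D := (size (xpoly g)).-1 in
  row3 ((y + xshift g * z) * z ^+ D.-1)
       (\sum_(i < D.+1) (xpoly g)`_i * y ^+ i * z ^+ (D - i)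
          - xdelta g * x * z ^+ D.-1)
       (z ^+ D).

Lemma row3E (x y z : C) :
  (row3 x y z 0 0 = x) * (row3 x y z 0 1 = y) * (row3 x y z 0 2%:R = z).
Proof. by rewrite !mxE. Qed.

Lemma row3_eta (v : 'rV[C]_3) : v = row3 (v 0 0) (v 0 1) (v 0 2%:R).
Proof.
apply/rowP => i; rewrite !mxE.
by case: i => -[|[|[|]]] //= h; congr (v _ _); apply: val_inj.
Qed.

Lemma hpoint_neq100 (v : 'rV[C]_3) : v != 0 ->
  hpoint v <> hpoint (row3 1 0 0) <-> (v 0 1 != 0) || (v 0 2%:R != 0).
Proof.
move=> v0; rewrite (hpointP v0 (row3_100_neq0 R)); split=> [h|/orP h [a [_ e]]].
  apply: contra_notT h; rewrite negb_or !negbK => /andP[/eqP v1 /eqP v2].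
  exists (v 0 0); split.
    apply: contraNneq v0 => v00; rewrite (row3_eta v) v00 v1 v2.
    by apply/eqP/rowP => -[[|[|[|]]] //= h]; rewrite !mxE.
  rewrite [LHS]row3_eta v1 v2.
  by apply/rowP => -[[|[|[|]]] //= h]; rewrite !mxE /= ?mulr1 ?mulr0.
by case: h; rewrite e !mxE /= mulr0 eqxx.
Qed.

Lemma nzcoord (v : 'rV[C]_3) : (v 0 1 != 0) || (v 0 2%:R != 0) -> v != 0.
Proof. by apply: contraTneq => ->; rewrite !mxE eqxx. Qed.

Lemma Y_coord (z : Y R) :
  (hcoord (val z) 0 1 != 0) || (hcoord (val z) 0 2%:R != 0).
Proof.
apply/hpoint_neq100; rewrite ?hcoord_neq0 // hcoordK.
exact: set_mem (valP z).
Qed.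

Lemma xext_vec_coord g (v : 'rV[C]_3) : (v 0 1 != 0) || (v 0 2%:R != 0) ->
  (xext_vec g v 0 1 != 0) || (xext_vec g v 0 2%:R != 0).
Proof.
rewrite /xext_vec !row3E; have := size_xpoly g.
have : lead_coef (xpoly g) != 0.
  by rewrite lead_coef_eq0 -size_poly_gt0; have := size_xpoly g; case: size.
rewrite lead_coefE; case: size => [|[|[|n]]] //= lc _.
have [->|z0 _] := eqVneq (v 0 2%:R) 0; last by rewrite expf_neq0 ?orbT.
rewrite orbF => y0; rewrite [0 ^+ n.+1]expr0n mulr0 subr0.
rewrite big_ord_recr big1 /= => [|i _]; last first.
  by rewrite subSn ?(leq_ord i) // expr0n mulr0.
rewrite add0r subnn expr0 mulr1.
by apply/orP; left; apply: mulf_neq0; [exact: lc|exact: expf_neq0].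
Qed.

Lemma xext_subproof g (z : Y R) :
  hpoint (xext_vec g (hcoord (val z)))
    \in [set z : P2 R | z <> hpoint (row3 1 0 0)].
Proof.
have h := xext_vec_coord g (Y_coord z).
by apply: mem_set; apply/hpoint_neq100; rewrite ?nzcoord.
Qed.

(* The holomorphic extension of g to Y. *)
Definition xext (g : Xplus) (z : Y R) : Y R :=
  exist (fun z => z \in [set z : P2 R | z <> hpoint (row3 1 0 0)])
    _ (xext_subproof g z).

Lemma affine_subproof (u : C * C) :
  hpoint (row3 u.1 u.2 1) \in [set z : P2 R | z <> hpoint (row3 1 0 0)].
Proof.
have h : (row3 u.1 u.2 1 0 1 != 0) || (row3 u.1 u.2 1 0 2%:R != 0).
  by rewrite !row3E oner_eq0 orbT.
by apply: mem_set; apply/hpoint_neq100; rewrite ?nzcoord.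
Qed.

Definition affine (u : C * C) : Y R :=
  exist (fun z => z \in [set z : P2 R | z <> hpoint (row3 1 0 0)])
    _ (affine_subproof u).

Lemma xext_vecZ g (a : C) (v : 'rV[C]_3) :
  xext_vec g (a *: v) = a ^+ (size (xpoly g)).-1 *: xext_vec g v.
Proof.
have := size_xpoly g; rewrite /xext_vec !mxE.
case: (size _) => [|[|[|n]]] // _ /=.
apply/rowP => i; rewrite !mxE; case: i => -[|[|[|]]] //= _.
- by rewrite exprMn (exprS a n.+1) [xshift g * _]mulrCA -mulrDr mulrACA.
- rewrite mulrBr mulr_sumr exprMn; congr (_ - _); last first.
    by rewrite (exprS a n.+1) [xdelta g * _]mulrCA mulrACA.
  apply: eq_bigr => -[i ile] _ /=; rewrite ltnS in ile.
  rewrite !exprMn -[in RHS](subnKC ile) exprD subnKC //.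
  by rewrite [_`_i * _]mulrCA mulrACA.
- by rewrite exprMn.
Qed.

Lemma xext_hpoint g (v : 'rV[C]_3) (z : Y R)
    (vY : (v 0 1 != 0) || (v 0 2%:R != 0)) :
  val z = hpoint v -> val (xext g z) = hpoint (xext_vec g v).
Proof.
move=> zv /=; have [a [a0 ->]] : exists a, a != 0 /\ hcoord (val z) = a *: v.
  by rewrite zv; apply: hpointK; exact: nzcoord.
have v0 := nzcoord (xext_vec_coord g vY).
apply/hpointP; rewrite // xext_vecZ ?scaler_eq0 ?negb_or ?expf_neq0 //.
by exists (a ^+ (size (xpoly g)).-1); rewrite expf_neq0.
Qed.

Lemma xext_affine g u : xext g (affine u) = affine (xmap g u).
Proof.
apply: val_inj; rewrite (@xext_hpoint g (row3 u.1 u.2 1)) //; last first.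
  by rewrite !row3E oner_eq0 orbT.
congr hpoint; rewrite /xext_vec !row3E !expr1n !mulr1 /=; congr row3.
congr (_ - _); rewrite horner_coef prednK; last first.
  by apply: leq_trans (size_xpoly g).
by apply: eq_bigr => i _; rewrite expr1n mulr1.
Qed.

End XPlus.

Section RandomIteration.
Variable R : realType.
Local Notation C := R[i].
Local Notation Y := (Y R).
Local Notation X := (Xplus R).

Definition borelXplus : measurableType _ :=
  g_sigma_algebraType (@open (Xplus R)).

Variable tau : probability borelXplus R.

Definition meas_support : set X :=
  [set g | forall U : set X, open U -> U g -> (0 < tau U)%E].

(* gamma_n \o ... \o gamma_1 for s = [:: gamma_1; ...; gamma_n] *)
Definition compose (s : seq X) (z : Y) : Y := foldl (fun w g => xext g w) z s.

Definition semigroup : set (Y -> Y) :=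
  [set h | exists s : seq X,
     [/\ (0 < size s)%N, forall g, g \in s -> meas_support g & h = compose s]].

Definition forward_invariant (E : set Y) : Prop :=
  forall h, semigroup h -> h @` E `<=` E.

Definition mean_stable : Prop :=
  exists (n m : nat) (U : 'I_m -> set Y) (Q : set Y) (c : R),
    [/\ (0 < n)%N /\ (0 < m)%N,
        forall j, open (U j) /\ U j !=set0,
        [/\ compact Q, Q !=set0 & Q `<=` \bigcup_j U j],
        0 < c < 1 &
        (forall s : n.-tuple X, (forall g, g \in s -> meas_support g) ->
           compose s @` (\bigcup_j U j) `<=` Q /\
           forall j x y, U j x -> U j y ->
             ydist (compose s x) (compose s y) <= c * ydist x y) /\
        (forall z, exists2 h, semigroup h & (\bigcup_j U j) (h z))].

Definition minimal_sets : set (set Y) :=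
  [set L | [/\ L !=set0, compact L &
     forall z, L z -> L = closure [set h z | h in semigroup]]].

(* A function on E is encoded by its extension by 0 to Y, so that equality of
   functions on E is equality. *)
Definition cfun (E : set Y) : set (Y -> C) :=
  [set phi | {within E, continuous phi} /\ forall z, ~ E z -> phi z = 0].

Definition cint (f : X -> C) : C :=
  Complex (\int[tau]_(g in meas_support) complex.Re (f g))
          (\int[tau]_(g in meas_support) complex.Im (f g)).

(* If E is forward invariant then xext g z lies in E for z in E and g in the
   support, which is the domain of integration in [cint]. *)
Definition trans_op (E : set Y) (phi : Y -> C) (z : Y) : C :=
  if z \in E then cint (fun g => phi (xext g z)) else 0.

Definition unitary_eigen (E : set Y) : set (Y -> C) :=
  [set phi | [/\ cfun E phi, phi <> (fun=> 0) &
     exists a : C, cmod a = 1 /\ trans_op E phi = (fun z => a * phi z)]].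

(* Supremum in [0, +oo], so that the supremum of the empty set is 0. *)
Definition esup0 (A : set (\bar R)) : \bar R := ereal_sup (0%E |` A).

Definition supnorm (E : set Y) (phi : Y -> C) : \bar R :=
  esup0 [set (cmod (phi z))%:E | z in E].

Definition vanishing (K : set Y) : set (Y -> C) :=
  [set phi | cfun K phi /\
     supnorm K (iter n (trans_op K) phi) @[n --> \oo] --> 0%E].

Definition holder_norm (a : R) (K : set Y) (phi : Y -> C) : \bar R :=
  (supnorm K phi +
   esup0 [set e | exists x y, [/\ K x, K y, x <> y &
     e = (cmod (phi x - phi y) / (ydist x y `^ a))%:E]])%E.

Definition holder (a : R) (K : set Y) : set (Y -> C) :=
  [set phi | cfun K phi /\ (holder_norm a K phi < +oo)%E].

End RandomIteration.

Section LinearSpan.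
Variables (R : realType) (T : Type).
Local Notation C := R[i].

Definition lcomb n (b : 'I_n -> T -> C) (a : 'I_n -> C) : T -> C :=
  fun z => \sum_i a i * b i z.

Definition cspan (A : set (T -> C)) : set (T -> C) :=
  [set psi | exists n (b : 'I_n -> T -> C) (a : 'I_n -> C),
     (forall i, A (b i)) /\ psi = lcomb b a].

Definition has_cdim (V : set (T -> C)) (n : nat) : Prop :=
  exists b : 'I_n -> T -> C,
    [/\ forall i, V (b i),
        forall a, lcomb b a = (fun=> 0) -> forall i, a i = 0 &
        forall psi, V psi -> exists a, psi = lcomb b a].

(* Junk value 0 if V is not finite-dimensional. *)
Definition cdim (V : set (T -> C)) : nat := xget 0%N [set n | has_cdim V n].

End LinearSpan.

(* psi is the component of phi in the first summand of
   C(K) = LS(U_{f,tau}(K)) (+) B_{0,tau,K}. *)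
Definition is_proj (R : realType) (tau : probability (borelXplus R) R)
    (K : set (Y R)) (phi psi : Y R -> R[i]) : Prop :=
  cspan (unitary_eigen tau K) psi /\ vanishing tau K (phi \- psi).

Definition unitary_proj (R : realType) (tau : probability (borelXplus R) R)
    (K : set (Y R)) (phi : Y R -> R[i]) : Y R -> R[i] :=
  xget (fun=> 0) (is_proj tau K phi).

Definition period (R : realType) (tau : probability (borelXplus R) R) : nat :=
  \big[muln/1%N]_(L \in minimal_sets tau) cdim (cspan (unitary_eigen tau L)).

(* Main.v *)
Require Import Defs.
Set Warnings "-notation-overridden,-notation-incompatible-prefix,-ambiguous-paths".
From mathcomp Require Import all_boot all_order all_algebra.
From mathcomp Require Import complex separable cyclotomic cyclic.
From mathcomp Require Import all_classical all_reals all_analysis.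
From mathcomp Require Import ring lra.
Import Order.TTheory GRing.Theory Num.Theory.
Import numFieldNormedType.Exports.
Local Open Scope classical_set_scope.
Local Open Scope ring_scope.

(** The averaging operator [M] has a spectral gap because random orbits are
    absorbed by finitely many minimal sets, near which all words of maps
    contract.

    Contraction. Mean stability says that words of a fixed length contract some
    open sets into a compact part [Q] of their union. Every minimal set meets
    [Q], so that words contract distances geometrically in a neighbourhood of
    each minimal set ([contraction_minimal]), and two minimal sets that come
    near each other in [Q] coincide ([minimal_finite]). The distance to the
    minimal sets, truncated, is a Lyapunov function: its average decays
    geometrically, since near a minimal set words contract and since from any
    other point some word leads near one ([barrier_decay]).

    Lasota-Yorke inequality. Words that have come near a minimal set contract.
    The others stretch distances by at most a constant factor per step; a small
    Hoelder exponent makes this factor harmless against their exponentially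
    small weight. So a power of [M] halves the Hoelder seminorm, up to a
    multiple of the sup norm ([lasota_yorke]).

    Convergence. On a minimal set let [N] be the length of a word that brings a
    point [x0] back near itself. From each point of the cyclic class of [x0]
    there is a positive chance to be near [x0] after a common multiple of [N]
    steps, and near [x0] averages of a Hoelder function are almost constant. By
    Doeblin's argument the oscillation on the class tends to 0
    ([piece_convergence]), and so the powers of [M] converge along the
    multiples of [N], first on one minimal set, then with a common [N] on all
    of them, and by absorption on [K] ([global_convergence]). The limit splits
    each function into an [N]-periodic one and a null one, one whose averages
    tend to 0. For null functions with given Hoelder bounds the sup norm decays
    uniformly; together with the Lasota-Yorke inequality this halves their
    Hoelder norm in a fixed time ([null_halving]), which is the geometric rate
    ([real_spectral]).

    Eigenfunctions. By Fourier analysis of a cyclic group the periodic functions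
    are spanned by the unitary eigenfunctions ([periodic_cspan]). By the maximum
    principle an eigenfunction on [K] for the eigenvalue [a] is multiplied by
    [a] along every step of the orbit of a maximum point of its modulus, so that
    [a] is an eigenvalue on some minimal set [L] ([eigen_transport]). On [L]
    eigenfunctions do not separate near points, and an orbit returns near
    itself, which makes eigenvalues roots of unity of bounded order
    ([eigen_torsion]). They form a finite group with one-dimensional
    eigenspaces, whose order is the dimension of the span; hence the [r]-th
    power of each unitary eigenvalue on [K] is 1 ([eigen_period]). So the
    periodic component is the projection of the statement, it is fixed by the
    [r]-th power of [M], and the four estimates follow from the decay of the
    null component.

    The geometric input is that the Fubini-Study distance is a metric for the
    topology of the plane and that the maps are Lipschitz on compact sets,
    uniformly over the support of the law ([xext_lip]); the measure-theoretic
    one is that the support has full measure ([supp_null]). *)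

Set Implicit Arguments.
Unset Strict Implicit.
Unset Printing Implicit Defensive.

(** * Hermitian geometry of coordinate vectors *)

Section Hermitian.
Variable R : realType.
Local Notation C := R[i].
Local Open Scope complex_scope.
Implicit Types (u v w : 'rV[C]_3) (a b c : C).

Lemma cmod_ge0 a : 0 <= cmod a.
Proof. by case: a => x y; exact: sqrtr_ge0. Qed.

Lemma cmodJ a : cmod (conjc a) = cmod a.
Proof. by case: a => x y /=; rewrite sqrrN. Qed.

Lemma cmod_sqrC a : (cmod a ^+ 2)%:C = a * conjc a.
Proof.
case: a => x y /=; rewrite sqr_sqrtr ?addr_ge0 ?sqr_ge0 //.
by apply/eqP; rewrite eq_complex /=; apply/andP; split; apply/eqP; ring.
Qed.

Lemma cmodR (x : R) : cmod x%:C = `|x|.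
Proof. by rewrite /= expr0n /= addr0 sqrtr_sqr. Qed.

Lemma cmod_eq0 a : (cmod a == 0) = (a == 0).
Proof.
apply/eqP/eqP => [/Normc.eq0_normc //|->]; exact: Normc.normc0.
Qed.

Lemma cmod_gt0 a : (0 < cmod a) = (a != 0).
Proof. by rewrite lt_def cmod_ge0 andbT cmod_eq0. Qed.

Lemma hdotDl u v w : hdot (u + v) w = hdot u w + hdot v w.
Proof. by rewrite /hdot -big_split; apply: eq_bigr => i _; rewrite !mxE mulrDl. Qed.

Lemma hdotZl a v w : hdot (a *: v) w = a * hdot v w.
Proof. by rewrite /hdot mulr_sumr; apply: eq_bigr => i _; rewrite !mxE mulrA. Qed.

Lemma hdotJ v w : hdot w v = conjc (hdot v w).
Proof.
rewrite /hdot rmorph_sum; apply: eq_bigr => i _.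
by rewrite rmorphM /= conjcK mulrC.
Qed.

Lemma hdotDr u v w : hdot w (u + v) = hdot w u + hdot w v.
Proof. by rewrite hdotJ hdotDl rmorphD /= -!hdotJ. Qed.

Lemma hdotZr a v w : hdot w (a *: v) = conjc a * hdot w v.
Proof. by rewrite hdotJ hdotZl rmorphM /= -hdotJ. Qed.

Lemma hnorm_ge0 v : 0 <= hnorm v.
Proof. exact: sqrtr_ge0. Qed.

Lemma hnorm_sqr v : hnorm v ^+ 2 = \sum_i cmod (v 0 i) ^+ 2.
Proof. by rewrite sqr_sqrtr // sumr_ge0 // => i _; exact: sqr_ge0. Qed.

Lemma hdotvv v : hdot v v = (hnorm v ^+ 2)%:C.
Proof.
rewrite hnorm_sqr /hdot rmorph_sum; apply: eq_bigr => i _.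
exact/esym/cmod_sqrC.
Qed.

Lemma hnorm_eq0 v : (hnorm v == 0) = (v == 0).
Proof.
apply/eqP/eqP => [|->]; last first.
  by rewrite -(scale0r 0) hnormZ Normc.normc0 mul0r.
move=> h; have /eqP := hnorm_sqr v.
rewrite h expr0n eq_sym psumr_eq0 => [/allP k|i _]; last exact: sqr_ge0.
apply/rowP => i; have := k i (mem_index_enum _); rewrite sqrf_eq0 cmod_eq0.
by move=> /eqP ->; rewrite mxE.
Qed.

Lemma hnorm_gt0 v : (0 < hnorm v) = (v != 0).
Proof. by rewrite lt_def hnorm_ge0 andbT hnorm_eq0. Qed.

Lemma hnorm_dist_sqr v w c : hnorm v = 1 -> hnorm w = 1 ->
  hnorm (v - c *: w) ^+ 2
  = 1 - cmod (hdot v w) ^+ 2 + cmod (c - hdot v w) ^+ 2.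
Proof.
move=> v1 w1; apply: (@complexI R).
rewrite -hdotvv -scaleNr !(hdotDl, hdotDr, hdotZl, hdotZr) !hdotvv v1 w1.
rewrite (hdotJ v w) !(rmorphD, rmorphN, rmorphB) /= !cmod_sqrC.
rewrite !(rmorphD, rmorphN, rmorphB) /= expr1n; ring.
Qed.

Lemma hdot_le1 v w : hnorm v = 1 -> hnorm w = 1 -> cmod (hdot v w) <= 1.
Proof.
move=> v1 w1; have := hnorm_dist_sqr (hdot v w) v1 w1.
rewrite subrr Normc.normc0 expr0n addr0 => e.
have : 0 <= 1 - cmod (hdot v w) ^+ 2 by rewrite -e sqr_ge0.
by rewrite subr_ge0 expr_le1 // cmod_ge0.
Qed.

Lemma hdot_eq1 v w : hnorm v = 1 -> hnorm w = 1 -> cmod (hdot v w) = 1 ->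
  v = hdot v w *: w.
Proof.
move=> v1 w1 e; have := hnorm_dist_sqr (hdot v w) v1 w1.
rewrite subrr Normc.normc0 expr0n addr0 e expr1n subrr => /eqP.
by rewrite sqrf_eq0 hnorm_eq0 subr_eq0 => /eqP.
Qed.

(** The angle between [v] and [w] measures how far [v] is from the line of
    [w]: its sine is the distance to that line. *)
Lemma hdot_sin_le v w c : hnorm v = 1 -> hnorm w = 1 ->
  1 - cmod (hdot v w) ^+ 2 <= hnorm (v - c *: w) ^+ 2.
Proof. by move=> v1 w1; rewrite hnorm_dist_sqr // lerDl sqr_ge0. Qed.

Definition normalize v : 'rV[C]_3 := (hnorm v)^-1%:C *: v.

Lemma hnorm_normalize v : v != 0 -> hnorm (normalize v) = 1.
Proof.
move=> v0; rewrite hnormZ cmodR ger0_norm ?invr_ge0 ?hnorm_ge0 //.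
by rewrite mulVf // hnorm_eq0.
Qed.

Lemma cauchy_schwarz v w : cmod (hdot v w) <= hnorm v * hnorm w.
Proof.
have [->|v0] := eqVneq v 0.
  by rewrite -(scale0r 0) hdotZl mul0r Normc.normc0 mulr_ge0 ?hnorm_ge0.
have [->|w0] := eqVneq w 0.
  by rewrite -(scale0r 0) hdotZr rmorph0 mul0r Normc.normc0 mulr_ge0 ?hnorm_ge0.
have := hdot_le1 (hnorm_normalize v0) (hnorm_normalize w0).
rewrite hdotZl hdotZr !Normc.normcM cmodJ !cmodR.
rewrite !ger0_norm ?invr_ge0 ?hnorm_ge0 // mulrA -invfM.
by rewrite ler_pdivrMl ?mulr1 // mulr_gt0 ?hnorm_gt0.
Qed.

Lemma hnorm_triangle v w : hnorm (v + w) <= hnorm v + hnorm w.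
Proof.
rewrite -(@ler_pXn2r _ 2) ?nnegrE ?addr_ge0 ?hnorm_ge0 //.
rewrite -lecR -hdotvv !(hdotDl, hdotDr) !hdotvv (hdotJ v w).
set h := hdot v w.
have -> : (hnorm v ^+ 2)%:C + h + (h^* + (hnorm w ^+ 2)%:C)
   = (hnorm v ^+ 2 + 2 * complex.Re h + hnorm w ^+ 2)%:C.
  case: h => x y; apply/eqP; rewrite eq_complex /=.
  by apply/andP; split; apply/eqP; ring.
rewrite lecR sqrrD lerD2r lerD2l -[leRHS]mulr_natl ler_wpM2l //.
apply: le_trans (cauchy_schwarz v w); rewrite -/h.
by case: h => x y /=; rewrite (le_trans (ler_norm _)) // -sqrtr_sqr ler_wsqrtr // lerDl sqr_ge0.
Qed.

Lemma hnorm_opp v : hnorm (- v) = hnorm v.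
Proof. by rewrite -scaleN1r hnormZ normcN Normc.normc1 mul1r. Qed.

(** Cauchy-Schwarz for the parts of [u] and [w] orthogonal to [v]. Read as an
    inequality between cosines and sines of the angles of lines, this is the
    triangle inequality of the projective plane. *)
Lemma hdot_three u v w : hnorm u = 1 -> hnorm v = 1 -> hnorm w = 1 ->
  cmod (hdot u v) * cmod (hdot v w)
    - Num.sqrt (1 - cmod (hdot u v) ^+ 2) * Num.sqrt (1 - cmod (hdot v w) ^+ 2)
  <= cmod (hdot u w).
Proof.
move=> u1 v1 w1.
have res x : hnorm x = 1 ->
    hnorm (x - hdot x v *: v) = Num.sqrt (1 - cmod (hdot x v) ^+ 2).
  move=> x1; have := hnorm_dist_sqr (hdot x v) x1 v1.
  rewrite subrr Normc.normc0 expr0n addr0 => <-.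
  by rewrite sqrtr_sqr ger0_norm ?hnorm_ge0.
have := cauchy_schwarz (u - hdot u v *: v) (w - hdot w v *: v).
rewrite !res // (hdotJ v w) cmodJ => cs.
have e : hdot u v * hdot v w = hdot u w
    - hdot (u - hdot u v *: v) (w - hdot w v *: v).
  rewrite -!scaleNr !(hdotDl, hdotDr, hdotZl, hdotZr) !hdotvv v1 expr1n.
  by rewrite rmorph1 (hdotJ v w) !rmorphN /= conjcK; ring.
rewrite lerBlDr -Normc.normcM e.
apply: le_trans (le_normcD _ _) _; rewrite normcN.
by rewrite lerD2l (hdotJ v w).
Qed.

End Hermitian.

(** * The Fubini-Study distance is a metric *)

Section FubiniStudy.
Variable R : realType.
Local Notation C := R[i].
Implicit Types (z w : P2 R) (v : 'rV[C]_3).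

Definition ucoord z : 'rV[C]_3 := normalize (hcoord z).

Lemma hnorm_ucoord z : hnorm (ucoord z) = 1.
Proof. by rewrite hnorm_normalize // hcoord_neq0. Qed.

Lemma invr_hnormC_neq0 v : v != 0 -> (hnorm v)^-1%:C%C != 0.
Proof.
move=> v0; rewrite -(rmorph0 (real_complex R)) (inj_eq (@complexI R)).
by rewrite invr_eq0 hnorm_eq0.
Qed.

Lemma normalize_neq0 v : v != 0 -> normalize v != 0.
Proof. by move=> v0; rewrite scaler_eq0 negb_or invr_hnormC_neq0. Qed.

Lemma ucoord_neq0 z : ucoord z != 0.
Proof. by rewrite normalize_neq0 // hcoord_neq0. Qed.

Lemma hpoint_normalize v : v != 0 -> hpoint (normalize v) = hpoint v.
Proof.
move=> v0; apply/hpointP; rewrite ?normalize_neq0 //.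
by exists (hnorm v)^-1%:C%C; rewrite invr_hnormC_neq0.
Qed.

Lemma ucoordK z : hpoint (ucoord z) = z.
Proof. by rewrite hpoint_normalize ?hcoord_neq0 // hcoordK. Qed.

Definition fscos z w : R := cmod (hdot (ucoord z) (ucoord w)).

Lemma fsdistE z w : fsdist z w = acos (fscos z w).
Proof.
rewrite -[in LHS](ucoordK z) -[in LHS](ucoordK w).
rewrite fsdist_hpoint ?ucoord_neq0 // /fs_angle.
by rewrite !hnorm_ucoord mulr1 divr1.
Qed.

Lemma fscos_itv z w : 0 <= fscos z w <= 1.
Proof. by rewrite cmod_ge0 hdot_le1 ?hnorm_ucoord. Qed.

Lemma fscos_itvN z w : -1 <= fscos z w <= 1.
Proof.
by have /andP[h ->] := fscos_itv z w; rewrite andbT (le_trans _ h) // lerN10.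
Qed.

Lemma cos_fsdist z w : cos (fsdist z w) = fscos z w.
Proof. by rewrite fsdistE acosK // in_itv /= fscos_itvN. Qed.

Lemma sin_fsdist z w : sin (fsdist z w) = Num.sqrt (1 - fscos z w ^+ 2).
Proof. by rewrite fsdistE sin_acos // fscos_itvN. Qed.

Lemma fsdist_ge0 z w : 0 <= fsdist z w.
Proof. by rewrite fsdistE acos_ge0 // fscos_itvN. Qed.

Lemma fsdist_lepi z w : fsdist z w <= pi.
Proof. by rewrite fsdistE acos_lepi // fscos_itvN. Qed.

Lemma ler_cosI (x y : R) : 0 <= x <= pi -> 0 <= y <= pi ->
  cos y <= cos x -> x <= y.
Proof.
move=> x0 y0 h; rewrite leNgt; apply/negP => yx.
by have := ltr_cos y0 x0; rewrite yx ltNge h.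
Qed.

Lemma fsdist_lepihalf z w : fsdist z w <= pi / 2.
Proof.
apply: ler_cosI; rewrite ?fsdist_ge0 ?fsdist_lepi //.
  by rewrite divr_ge0 ?pi_ge0 //= ler_pdivrMr // ler_peMr ?pi_ge0 // ler1n.
by rewrite cos_pihalf cos_fsdist; case/andP: (fscos_itv z w).
Qed.

Lemma fsdistC z w : fsdist z w = fsdist w z.
Proof. by rewrite !fsdistE /fscos hdotJ cmodJ. Qed.

Lemma fsdist_triangle z1 z2 z3 :
  fsdist z1 z3 <= fsdist z1 z2 + fsdist z2 z3.
Proof.
apply: ler_cosI; rewrite ?fsdist_ge0 ?fsdist_lepi //.
  rewrite addr_ge0 ?fsdist_ge0 //=.
  by rewrite [leRHS](splitr pi) lerD ?fsdist_lepihalf.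
rewrite cosD !cos_fsdist !sin_fsdist.
by apply: hdot_three; exact: hnorm_ucoord.
Qed.

Lemma fsdistxx z : fsdist z z = 0.
Proof.
rewrite fsdistE /fscos hdotvv hnorm_ucoord expr1n.
by rewrite cmodR normr1 acos1.
Qed.

Lemma fsdist_eq0 z w : fsdist z w = 0 -> z = w.
Proof.
move=> d0; have := cos_fsdist z w; rewrite d0 cos0 => /esym h.
have e := hdot_eq1 (hnorm_ucoord z) (hnorm_ucoord w) h.
rewrite -(ucoordK z) -(ucoordK w); apply/hpointP; rewrite ?ucoord_neq0 //.
exists (hdot (ucoord z) (ucoord w)); split=> //.
by rewrite -cmod_eq0 (_ : cmod _ = 1) ?oner_eq0.
Qed.

Lemma sin_MVT (x : R) : 0 <= x ->
  exists2 c, c \in `[0, x]%R & sin x - sin 0 = cos c * (x - 0).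
Proof.
move=> x0; apply: MVT_segment => //.
by apply: continuous_subspaceT => y; exact: continuous_sin.
Qed.

Lemma sin_le_id (x : R) : 0 <= x -> sin x <= x.
Proof.
move=> x0.
have [c _] := sin_MVT x0.
rewrite sin0 !subr0 => ->.
by rewrite ler_piMl // cos_le1.
Qed.

(** Jordan's inequality, with a constant that is easier to obtain than the
    optimal one. *)
Lemma le_4sin (x : R) : 0 <= x <= pi / 2 -> x <= 4 * sin x.
Proof.
move=> /andP[x0 xp].
have pile : pi <= 4 :> R by have := pihalf_lt2 R; lra.
have xpi : x <= pi by have := pi_ge0 R; lra.
have [h|h] := leP 2^-1 (cos x).
  have [c] := sin_MVT x0.
  rewrite in_itv /= sin0 !subr0 => /andP[c0 cx] ->.
  have : cos x <= cos c.
    rewrite leNgt; apply/negP; rewrite ltr_cos ?in_itv /= ?x0 ?c0 //.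
      by rewrite ltNge cx.
    by rewrite (le_trans cx).
  by move=> cc; nra.
have s0 : 0 <= sin x by rewrite sin_ge0_pi // x0.
have c0 : 0 <= cos x.
  by rewrite cos_ge0_pihalf // xp andbT; have := pi_ge0 R; lra.
have := cos2Dsin2 x.
have : x <= 2 by rewrite (le_trans xp) // ltW // pihalf_lt2.
have [//|s1] := leP 2^-1 (sin x); nra.
Qed.

Lemma fsdist_le_sin z w : fsdist z w <= 4 * sin (fsdist z w).
Proof. by rewrite le_4sin // fsdist_ge0 fsdist_lepihalf. Qed.

Lemma fscos_hpoint v1 v2 : v1 != 0 -> v2 != 0 ->
  fscos (hpoint v1) (hpoint v2) = cmod (hdot (normalize v1) (normalize v2)).
Proof.
move=> v10 v20; rewrite -cos_fsdist.
rewrite -(hpoint_normalize v10) -(hpoint_normalize v20).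
rewrite fsdist_hpoint ?normalize_neq0 // /fs_angle.
rewrite !hnorm_normalize // mulr1 divr1 acosK // in_itv /=.
rewrite hdot_le1 ?hnorm_normalize // andbT.
by rewrite (le_trans _ (cmod_ge0 _)) // lerN10.
Qed.

(** The sine of the distance is at most the distance of one unit vector to the
    line of the other one, and the distance is comparable to its sine. *)
Lemma fsdist_le_hnorm v1 v2 : v1 != 0 -> v2 != 0 ->
  fsdist (hpoint v1) (hpoint v2) <= 4 * (hnorm (v1 - v2) / hnorm v1).
Proof.
move=> v10 v20; apply: le_trans (fsdist_le_sin _ _) _.
rewrite ler_pM2l // sin_fsdist fscos_hpoint //.
pose c : C := (hnorm v2 / hnorm v1)%:C%C.
have -> : hnorm (v1 - v2) / hnorm v1
    = hnorm (normalize v1 - c *: normalize v2).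
  have e : normalize v1 - c *: normalize v2
      = (hnorm v1)^-1%:C%C *: (v1 - v2).
    rewrite scalerBr; congr (_ - _); rewrite scalerA -rmorphM.
    by rewrite mulrAC divff ?hnorm_eq0 // mul1r.
  by rewrite e hnormZ cmodR ger0_norm ?invr_ge0 ?hnorm_ge0 // mulrC.
rewrite -[leRHS]ger0_norm ?hnorm_ge0 // -sqrtr_sqr ler_wsqrtr //.
by apply: hdot_sin_le; rewrite hnorm_normalize.
Qed.

(** Rotating one of two unit vectors so that their product is real makes them
    as close as the points they represent. *)
Lemma aligned_coord z w : exists v1 v2 : 'rV[C]_3,
  [/\ hnorm v1 = 1, hnorm v2 = 1, hpoint v1 = z, hpoint v2 = w &
      hnorm (v1 - v2) <= 2 * fsdist z w].
Proof.
pose h := hdot (ucoord z) (ucoord w).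
pose c := if h == 0 then 1 else h / (cmod h)%:C%C.
have hC : h != 0 -> (cmod h)%:C%C != 0.
  by move=> h0; rewrite -(rmorph0 (real_complex R)) (inj_eq (@complexI R)) cmod_eq0.
have c1 : cmod c = 1.
  rewrite /c; case: eqVneq => [_|h0]; first by rewrite Normc.normc1.
  rewrite Normc.normcM Normc.normcV cmodR ger0_norm ?cmod_ge0 //.
  by rewrite divff // cmod_eq0.
have c0 : c != 0 by rewrite -cmod_eq0 c1 oner_eq0.
have u1 : hnorm (c *: ucoord w) = 1 by rewrite hnormZ c1 hnorm_ucoord mulr1.
exists (ucoord z), (c *: ucoord w); split=> //.
- exact: hnorm_ucoord.
- exact: ucoordK.
- rewrite -[RHS]ucoordK; apply/hpointP; rewrite ?ucoord_neq0 //.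
    by rewrite -hnorm_eq0 u1 oner_eq0.
  by exists c.
have ch : cmod (c - h) = 1 - cmod h.
  have -> : c - h = c * (1 - cmod h)%:C%C.
    rewrite rmorphB rmorph1 mulrBr mulr1; congr (_ - _).
    rewrite /c; case: eqVneq => [->|h0]; first by rewrite Normc.normc0 rmorph0 mulr0.
    by rewrite mulfVK // hC.
  rewrite Normc.normcM c1 mul1r cmodR ger0_norm // subr_ge0.
  by rewrite hdot_le1 ?hnorm_ucoord.
rewrite -(@ler_pXn2r _ 2) ?nnegrE ?hnorm_ge0 ?mulr_ge0 ?fsdist_ge0 //.
rewrite hnorm_dist_sqr ?hnorm_ucoord // -/h ch.
have h1 : 0 <= cmod h <= 1 := fscos_itv z w.
have sd : 1 - cmod h ^+ 2 <= fsdist z w ^+ 2.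
  have := sin_le_id (fsdist_ge0 z w); rewrite sin_fsdist => le.
  have h2 : 0 <= 1 - cmod h ^+ 2 by nra.
  rewrite -(sqr_sqrtr h2) ler_pXn2r ?nnegrE ?sqrtr_ge0 ?fsdist_ge0 //.
case/andP: h1 => h0 h1; move: sd; rewrite exprMn; nra.
Qed.

End FubiniStudy.

(** * The topologies of the plane and of the space of maps *)

Lemma nbhs_fst (T U : topologicalType) (x : T * U) (A : set T) :
  nbhs x.1 A -> nbhs x [set u | A u.1].
Proof. by case: x => a b h; exact: (cvg_fst h). Qed.

Lemma nbhs_snd (T U : topologicalType) (x : T * U) (A : set U) :
  nbhs x.2 A -> nbhs x [set u | A u.2].
Proof. by case: x => a b h; exact: (cvg_snd h). Qed.

Section Topology.
Variable R : realType.
Local Notation C := R[i].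

Lemma near_cmod (a : C) (e : R) : 0 < e -> \forall b \near a, cmod (b - a) < e.
Proof.
move=> e0.
have e0C : (0 : C) < e%:C%C by rewrite ltcR.
apply: filterS (nbhsx_ballx a (PosNum e0C)%:num _) => [b|]; last by [].
rewrite /ball /= -ltcR => /le_lt_trans; apply.
by rewrite distrC normc_def -[b - a]/(b - a); case: (b - a) => x y /=.
Qed.

Lemma near_coords (v : 'rV[C]_3) (e : R) : 0 < e ->
  \forall w \near v, hnorm (w - v) < e.
Proof.
move=> e0; have e40 : 0 < e / 4 by rewrite divr_gt0.
have h (i : 'I_3) : nbhs v [set w : 'rV[C]_3 | cmod (w 0 i - v 0 i) < e / 4].
  apply: (@coord_continuous C 1 3 0 i v [set a | cmod (a - v 0 i) < e / 4]).
  exact: near_cmod.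
have := @filter_forall _ _ (fun i => [set w : 'rV[C]_3 | cmod (w 0 i - v 0 i) < e / 4]) _ (nbhs_filter v) h.
apply: filterS => w hw.
rewrite -(@ltr_pXn2r _ 2) ?nnegrE ?hnorm_ge0 ?ltW // hnorm_sqr.
apply: le_lt_trans (_ : _ <= \sum_(i < 3) (e / 4) ^+ 2) _.
  apply: ler_sum => i _; rewrite !mxE.
  by rewrite ler_pXn2r ?nnegrE ?cmod_ge0 ?(ltW e40) //; exact: ltW (hw i).
by rewrite sumr_const card_ord -mulr_natr; nra.
Qed.

(** The balls of the metric are open for the quotient topology: their preimages
    in the space of coordinates are. *)
Lemma near_fsdist (z : P2 R) (e : R) : 0 < e ->
  \forall w \near z, fsdist z w < e.
Proof.
move=> e0; apply: open_nbhs_nbhs; split; last by rewrite /= fsdistxx.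
rewrite /open /= /quotient_open openE => v0 /= hv0.
pose v : 'rV[C]_3 := val v0.
have v0n : v != 0 by have := valP v0; rewrite inE.
have piE (w : nzvec R) : \pi_(P2 R)%qT w = hpoint (val w).
  rewrite /hpoint; congr (\pi_(P2 R)%qT _); apply: val_inj.
  by rewrite val_insubd (valP w).
pose r := (e - fsdist z (\pi_(P2 R)%qT v0)) / 4 * hnorm v.
have r0 : 0 < r by rewrite mulr_gt0 ?hnorm_gt0 // divr_gt0 // subr_gt0.
have vw : nbhs v0 [set w : nzvec R | hnorm (val w - v) < r].
  exact: (@initial_continuous _ _ (val : nzvec R -> 'rV[C]_3) v0 _ (near_coords v r0)).
apply: filterS vw => w /= hw.
have w0n : val w != 0 by have := valP w; rewrite inE.
apply: le_lt_trans (fsdist_triangle _ (\pi_(P2 R)%qT v0) _) _.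
rewrite -ltrBrDl; apply: le_lt_trans (_ : _ <= 4 * (hnorm (v - val w) / hnorm v)) _.
  by rewrite !piE fsdist_le_hnorm.
rewrite -ltr_pdivlMl // ltr_pdivrMr ?hnorm_gt0 // (mulrC 4^-1) -(hnorm_opp (v - val w)) opprB.
exact: hw.
Qed.

Lemma near_ydist (z : Y R) (e : R) : 0 < e ->
  \forall w \near z, ydist z w < e.
Proof.
by move=> /(near_fsdist (val z)); exact: (@initial_continuous _ _ _ z).
Qed.

(** The topology is the initial one for the data of a map, so that these depend
    continuously on the map. *)
Lemma near_xdata (g : Xplus R) (e : R) : 0 < e ->
  \forall h \near g,
    [/\ cmod (xshift h - xshift g) < e, cmod (xdelta h - xdelta g) < e,
        size (xpoly h) = size (xpoly g) &
        forall i, (i < size (xpoly g))%N ->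
          cmod ((xpoly h)`_i - (xpoly g)`_i) < e].
Proof.
move=> e0.
have cx := @initial_continuous _ _ (@xdata R) g.
have n1 : nbhs (xdata g) [set u | cmod (u.1.1 - xshift g) < e].
  apply: (@nbhs_fst _ _ _ [set u | cmod (u.1 - xshift g) < e]).
  apply: (@nbhs_fst _ _ _ [set u | cmod (u - xshift g) < e]).
  exact: near_cmod.
have n2 : nbhs (xdata g) [set u | cmod (u.1.2 - xdelta g) < e].
  apply: (@nbhs_fst _ _ _ [set u | cmod (u.2 - xdelta g) < e]).
  apply: (@nbhs_snd _ _ _ [set u | cmod (u - xdelta g) < e]).
  exact: near_cmod.
have n3 : nbhs (xdata g) [set u | u.2.1 = (size (xpoly g)).-1].
  apply: (@nbhs_snd _ _ _ [set u | u.1 = (size (xpoly g)).-1]).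
  apply: (@nbhs_fst _ _ _ [set u | u = (size (xpoly g)).-1]).
  by rewrite nbhs_principalE; apply/principal_filterP.
have n4 (i : nat) : nbhs (xdata g) [set u | cmod (u.2.2 i - (xpoly g)`_i) < e].
  apply: (@nbhs_snd _ _ _ [set u : nat * {ptws nat -> C} | cmod (u.2 i - (xpoly g)`_i) < e]).
  apply: (@nbhs_snd _ _ _ [set u : {ptws nat -> C} | cmod (u i - (xpoly g)`_i) < e]).
  exact: (@proj_continuous nat (fun=> C) i (fun j => (xpoly g)`_j) _
            (near_cmod _ e0)).
have c4 : \forall h \near g, forall i : 'I_(size (xpoly g)),
    cmod ((xpoly h)`_i - (xpoly g)`_i) < e.
  exact: (@filter_forall _ _ (fun i : 'I__ => [set h : Xplus R |
    cmod ((xpoly h)`_i - (xpoly g)`_i) < e]) _ (nbhs_filter g)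
    (fun i => cx _ (n4 i))).
have {}n1 : \forall h \near g, cmod (xshift h - xshift g) < e := cx _ n1.
have {}n2 : \forall h \near g, cmod (xdelta h - xdelta g) < e := cx _ n2.
have {}n3 : \forall h \near g, (size (xpoly h)).-1 = (size (xpoly g)).-1 :=
  cx _ n3.
near=> h; split.
- by near: h.
- by near: h.
- have e1 : (size (xpoly h)).-1 = (size (xpoly g)).-1 by near: h.
  rewrite -(prednK (ltn_trans _ (size_xpoly h))) //.
  by rewrite e1 prednK // (ltn_trans _ (size_xpoly g)).
- move=> i ig; have c : forall i : 'I_(size (xpoly g)),
    cmod ((xpoly h)`_i - (xpoly g)`_i) < e by near: h.
  exact: (c (Ordinal ig)).
Unshelve. all: by end_near. Qed.

End Topology.

(** * The homogeneous extension on unit vectors *)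

Section Extension.
Variable R : realType.
Local Notation C := R[i].
Implicit Types (v w : 'rV[C]_3) (g h : Xplus R) (z : Y R).

Lemma cmod_sum n (f : 'I_n -> C) : cmod (\sum_i f i) <= \sum_i cmod (f i).
Proof.
elim/big_ind2: _ => //; first by rewrite Normc.normc0.
by move=> a b c d ab cd; apply: le_trans (le_normcD _ _) (lerD ab cd).
Qed.

Lemma cmodB (a b : C) : cmod (a - b) <= cmod a + cmod b.
Proof. by apply: le_trans (le_normcD _ _) _; rewrite normcN. Qed.

Lemma cmod_coord_le v i : cmod (v 0 i) <= hnorm v.
Proof.
rewrite -(@ler_pXn2r _ 2) ?nnegrE ?hnorm_ge0 ?cmod_ge0 // hnorm_sqr.
by rewrite (bigD1 i) //= lerDl sumr_ge0 // => j _; exact: sqr_ge0.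
Qed.

Lemma hnorm_row3_le (a b c : C) : hnorm (row3 a b c) <= cmod a + cmod b + cmod c.
Proof.
rewrite -(@ler_pXn2r _ 2) ?nnegrE ?hnorm_ge0 ?addr_ge0 ?cmod_ge0 // hnorm_sqr.
rewrite !big_ord_recl big_ord0 !mxE /= addr0.
by have := cmod_ge0 a; have := cmod_ge0 b; have := cmod_ge0 c; nra.
Qed.

Lemma row3B (a b c a' b' c' : C) :
  row3 a b c - row3 a' b' c' = row3 (a - a') (b - b') (c - c').
Proof. by apply/rowP => -[[|[|[|]]] //= i]; rewrite !mxE. Qed.

Lemma cmod_mulB_le (a b a' b' : C) : cmod a <= 1 -> cmod b' <= 1 ->
  cmod (a * b - a' * b') <= cmod (a - a') + cmod (b - b').
Proof.
move=> a1 b1; have -> : a * b - a' * b' = (a - a') * b' + a * (b - b') by ring.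
apply: le_trans (le_normcD _ _) _; rewrite !Normc.normcM.
by apply: lerD; rewrite ?ler_piMr ?ler_piMl ?cmod_ge0.
Qed.

Lemma cmodX (a : C) n : cmod (a ^+ n) = cmod a ^+ n.
Proof.
elim: n => [|n IH]; first by rewrite !expr0 Normc.normc1.
by rewrite !exprS Normc.normcM IH.
Qed.

Lemma cmodX_le1 (a : C) n : cmod a <= 1 -> cmod (a ^+ n) <= 1.
Proof. by move=> a1; rewrite cmodX exprn_ile1 // cmod_ge0. Qed.

Lemma cmodXB_le (a b : C) n t : cmod a <= 1 -> cmod b <= 1 -> cmod (a - b) <= t ->
  cmod (a ^+ n - b ^+ n) <= n%:R * t.
Proof.
move=> a1 b1 ab; elim: n => [|n IH]; first by rewrite !expr0 subrr Normc.normc0 mul0r.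
rewrite !exprS; apply: le_trans (cmod_mulB_le _ _ a1 _) _; first exact: cmodX_le1.
by rewrite -natr1 mulrDl mul1r addrC lerD.
Qed.

Lemma monomial_lip (a b a' b' : C) i j t :
  cmod a <= 1 -> cmod b <= 1 -> cmod a' <= 1 -> cmod b' <= 1 ->
  cmod (a - a') <= t -> cmod (b - b') <= t ->
  cmod (a ^+ i * b ^+ j - a' ^+ i * b' ^+ j) <= (i + j)%:R * t.
Proof.
move=> a1 b1 a1' b1' aa bb.
apply: le_trans (cmod_mulB_le _ _ _ _) _; try exact: cmodX_le1.
by rewrite natrD mulrDl lerD // cmodXB_le.
Qed.

(** The coordinates of the extension are homogeneous polynomials of degree [D].
    On unit vectors a monomial of degree [D] is Lipschitz with constant
    [D]. *)
Lemma xext_vec_lip g v w (A : R) (D := (size (xpoly g)).-1) : hnorm v = 1 -> hnorm w = 1 ->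
  cmod (xshift g) <= A -> cmod (xdelta g) <= A ->
  (forall i, (i < size (xpoly g))%N -> cmod ((xpoly g)`_i) <= A) ->
  hnorm (xext_vec g v - xext_vec g w)
  <= (D%:R + A * D%:R + (D.+1%:R * (A * D%:R) + A * D%:R) + D%:R)
     * hnorm (v - w).
Proof.
move=> v1 w1 hA hB hp.
have Dge : D = D.-1.+1 by rewrite /D; have := size_xpoly g; case: size => [|[]].
rewrite /xext_vec; cbv zeta; rewrite -/D row3B; apply: le_trans (hnorm_row3_le _ _ _) _.
have c1 (u : 'rV[C]_3) (i : 'I_3) : hnorm u = 1 -> cmod (u 0 i) <= 1.
  by move=> u1; have := cmod_coord_le u i; rewrite u1.
have cB i : cmod (v 0 i - w 0 i) <= hnorm (v - w).
  by have := cmod_coord_le (v - w) i; rewrite !mxE.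
have A0 : 0 <= A by apply: le_trans (cmod_ge0 _) hA.
have mono (i j : 'I_3) (k l : nat) (B : C) : cmod B <= A -> (k + l)%N = D ->
    cmod (B * (v 0 i ^+ k * v 0 j ^+ l) - B * (w 0 i ^+ k * w 0 j ^+ l))
    <= A * D%:R * hnorm (v - w).
  move=> BA kl; rewrite -mulrBr Normc.normcM -mulrA.
  by rewrite ler_pM ?cmod_ge0 // -kl monomial_lip ?c1.
set t := hnorm (v - w) in cB mono *.
have distr (a b c d k : R) : (a + b + (c + d) + k) * t
    = a * t + b * t + (c * t + d * t) + k * t by ring.
rewrite distr.
apply: lerD; first apply: lerD.
- have -> : (v 0 1 + xshift g * v 0 2%:R) * v 0 2%:R ^+ D.-1
      - (w 0 1 + xshift g * w 0 2%:R) * w 0 2%:R ^+ D.-1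
    = (v 0 1 ^+ 1 * v 0 2%:R ^+ D.-1 - w 0 1 ^+ 1 * w 0 2%:R ^+ D.-1)
      + (xshift g * (v 0 2%:R ^+ 1 * v 0 2%:R ^+ D.-1)
         - xshift g * (w 0 2%:R ^+ 1 * w 0 2%:R ^+ D.-1)).
    by rewrite !expr1; ring.
  apply: le_trans (le_normcD _ _) (lerD _ _); last by rewrite mono // add1n -Dge.
  by have := monomial_lip 1 D.-1 (c1 _ 1 v1) (c1 _ 2%:R v1) (c1 _ 1 w1)
       (c1 _ 2%:R w1) (cB 1) (cB 2%:R); rewrite add1n -Dge.
- have -> (a b c d : C) : a - b - (c - d) = (a - c) - (b - d) by ring.
  apply: le_trans (cmodB _ _) (lerD _ _); last first.
    by have := mono 0 2%:R 1%N D.-1 (xdelta g) hB; rewrite !expr1 !mulrA add1n -Dge; exact.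
  rewrite -sumrB; apply: le_trans (cmod_sum _) _.
  apply: le_trans (_ : _ <= \sum_(i < D.+1) A * D%:R * t) _.
    apply: ler_sum => i _.
    rewrite -(mulrA _ _ (v 0 2%:R ^+ _)) -(mulrA _ _ (w 0 2%:R ^+ _)).
    rewrite mono ?subnKC //; last by rewrite -ltnS.
    by apply: hp; rewrite (leq_trans (ltn_ord i)) // prednK // (leq_trans _ (size_xpoly g)).
  by rewrite sumr_const card_ord -[leLHS]mulr_natl !mulrA.
- by rewrite cmodXB_le ?c1.
Qed.

Lemma xext_vec_near g (e : R) : 0 < e -> \forall h \near g,
  forall v, hnorm v = 1 -> hnorm (xext_vec h v - xext_vec g v) <= e.
Proof.
move=> e0; pose D := (size (xpoly g)).-1.
pose t := e / (1 + (D.+1%:R + 1)); have d0 : 0 < 1 + (D.+1%:R + 1) :> R.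
  by rewrite addr_gt0 // addr_gt0.
have t0 : 0 < t by rewrite divr_gt0.
apply: filterS (near_xdata g t0) => h [ha hb hs hp] v v1.
have c1 (i : 'I_3) : cmod (v 0 i) <= 1.
  by have := cmod_coord_le v i; rewrite v1.
have c1X i n : cmod (v 0 i ^+ n) <= 1 by rewrite cmodX_le1.
have bnd (B a b : C) : cmod B < t -> cmod a <= 1 -> cmod b <= 1 ->
    cmod (B * (a * b)) <= t.
  move=> Bt a1 b1; rewrite !Normc.normcM -[leRHS]mulr1.
  rewrite ler_pM ?mulr_ge0 ?cmod_ge0 ?(ltW Bt) // -[leRHS]mulr1.
  by rewrite ler_pM ?cmod_ge0.
rewrite /xext_vec; cbv zeta; rewrite hs -/D row3B; apply: le_trans (hnorm_row3_le _ _ _) _.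
rewrite subrr Normc.normc0 addr0 -[e](divfK (lt0r_neq0 d0)) -/t mulrDr mulr1.
apply: lerD.
  have -> : (v 0 1 + xshift h * v 0 2%:R) * v 0 2%:R ^+ D.-1
      - (v 0 1 + xshift g * v 0 2%:R) * v 0 2%:R ^+ D.-1
    = (xshift h - xshift g) * (v 0 2%:R * v 0 2%:R ^+ D.-1) by ring.
  exact: bnd.
have -> (a b c d : C) : a - b - (c - d) = (a - c) - (b - d) by ring.
rewrite mulrDr mulr1; apply: le_trans (cmodB _ _) (lerD _ _); last first.
  by rewrite -!mulrBl -mulrA; exact: bnd.
rewrite -sumrB; apply: le_trans (cmod_sum _) _.
apply: le_trans (_ : _ <= \sum_(i < D.+1) t) _; last first.
  by rewrite sumr_const card_ord -[leLHS]mulr_natr.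
apply: ler_sum => i _; rewrite -!mulrBl -mulrA bnd // hp //.
by rewrite (leq_trans (ltn_ord i)) // prednK // (leq_trans _ (size_xpoly g)).
Qed.

End Extension.

(** * Regularity of the maps of the plane *)

Section Lipschitz.
Variable R : realType.
Local Notation C := R[i].
Implicit Types (v : 'rV[C]_3) (g h : Xplus R) (z w : Y R).

Lemma ydist_ge0 (x y : Y R) : 0 <= ydist x y.
Proof. exact: fsdist_ge0. Qed.

Lemma ydistC (x y : Y R) : ydist x y = ydist y x.
Proof. exact: fsdistC. Qed.

Lemma ydist_triangle (x y z : Y R) : ydist x z <= ydist x y + ydist y z.
Proof. exact: fsdist_triangle. Qed.

Lemma ydistxx (x : Y R) : ydist x x = 0.
Proof. exact: fsdistxx. Qed.

Lemma ydist_eq0 (x y : Y R) : ydist x y = 0 -> x = y.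
Proof. by move=> /fsdist_eq0; exact: val_inj. Qed.

Lemma ydist_le2 (x y : Y R) : ydist x y <= 2.
Proof. by apply: le_trans (fsdist_lepihalf _ _) _; rewrite ltW // pihalf_lt2. Qed.

Lemma hnorm1_neq0 v : hnorm v = 1 -> v != 0.
Proof. by move=> v1; rewrite -hnorm_eq0 v1 oner_eq0. Qed.

Lemma xext_rep g z v : v != 0 -> hpoint v = val z ->
  xext_vec g v != 0 /\ val (xext g z) = hpoint (xext_vec g v).
Proof.
move=> v0 e; have vY : (v 0 1 != 0) || (v 0 2%:R != 0).
  by apply/hpoint_neq100 => //; rewrite e; exact: set_mem (valP z).
split; first exact/nzcoord/xext_vec_coord.
by apply: xext_hpoint => //; rewrite e.
Qed.

Lemma aligned_ydist z w : exists v1 v2 : 'rV[C]_3,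
  [/\ hnorm v1 = 1, hnorm v2 = 1, hpoint v1 = val z, hpoint v2 = val w &
      hnorm (v1 - v2) <= 2 * ydist z w].
Proof. exact: aligned_coord. Qed.

Lemma ydist_le_hnorm z w v1 v2 : v1 != 0 -> v2 != 0 ->
  val z = hpoint v1 -> val w = hpoint v2 ->
  ydist z w <= 4 * (hnorm (v1 - v2) / hnorm v1).
Proof. by move=> n1 n2; rewrite /ydist => -> ->; exact: fsdist_le_hnorm. Qed.

#[local] Opaque hnorm ydist xext_vec hpoint xext ucoord.

(** The factor by which an image has to be divided to become a unit vector. It
    does not vanish on the plane without [1 : 0 : 0], and its lower bounds on
    compact sets turn the regularity of the extension into that of the map. *)
Definition xext_size g z : R := hnorm (xext_vec g (ucoord (val z))).

Lemma xext_size_rep g z v : hnorm v = 1 -> hpoint v = val z ->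
  hnorm (xext_vec g v) = xext_size g z.
Proof.
move=> v1 e; have E : hpoint v = hpoint (ucoord (val z)) by rewrite ucoordK.
have [a [a0 va]] := iffLR (hpointP (hnorm1_neq0 v1) (ucoord_neq0 (val z))) E.
have a1 : cmod a = 1.
  by have := v1; rewrite va hnormZ hnorm_ucoord mulr1.
by rewrite /xext_size va xext_vecZ hnormZ cmodX a1 expr1n mul1r.
Qed.

Lemma xext_size_gt0 g z : 0 < xext_size g z.
Proof.
rewrite hnorm_gt0.
by have [] := @xext_rep g z _ (ucoord_neq0 (val z)) (ucoordK (val z)).
Qed.

Lemma xext_vec_locally_lip g : exists2 L : R, 0 < L & \forall h \near g,
  forall v w : 'rV[C]_3, hnorm v = 1 -> hnorm w = 1 ->
    hnorm (xext_vec h v - xext_vec h w) <= L * hnorm (v - w).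
Proof.
pose A := 1 + (cmod (xshift g) + cmod (xdelta g)
   + \sum_(i < size (xpoly g)) cmod ((xpoly g)`_i)).
pose D : R := (size (xpoly g)).-1%:R.
pose D1 : R := (size (xpoly g)).-1.+1%:R.
have s0 : 0 <= \sum_(i < size (xpoly g)) cmod ((xpoly g)`_i).
  by apply: sumr_ge0 => i _; exact: cmod_ge0.
have A0 : 0 <= A by rewrite !addr_ge0 ?cmod_ge0.
exists (1 + (D + A * D + (D1 * (A * D) + A * D) + D)).
  by rewrite ltr_pwDl // !addr_ge0 // ?mulr_ge0 // ?ler0n //.
have near1 (a b : C) (c : R) : cmod (a - b) < 1 -> cmod b <= c -> cmod a <= 1 + c.
  move=> ab bc; have := le_normcD (a - b) b; rewrite subrK => /le_trans; apply.
  by rewrite lerD // ltW.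
apply: filterS (near_xdata g ltr01) => h [ha hb hs hp] v w v1 w1.
have bA : cmod (xshift h) <= A.
  by apply: near1 ha _; rewrite -addrA lerDl addr_ge0 // cmod_ge0.
have bB : cmod (xdelta h) <= A.
  by apply: near1 hb _; rewrite addrAC lerDr addr_ge0 // cmod_ge0.
have bC i : (i < size (xpoly h))%N -> cmod ((xpoly h)`_i) <= A.
  rewrite hs => ig; apply: near1 (hp i ig) _.
  rewrite (bigD1 (Ordinal ig)) //= addrCA lerDl !addr_ge0 ?cmod_ge0 //.
  by apply: sumr_ge0 => j _; exact: cmod_ge0.
apply: le_trans (xext_vec_lip v1 w1 bA bB bC) _; rewrite hs -/D -/D1.
by rewrite ler_wpM2r ?hnorm_ge0 // lerDr.
Qed.

Lemma near_xext g z (e : R) : 0 < e ->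
  \forall h \near g, ydist (xext h z) (xext g z) < e.
Proof.
move=> e0; have c0 := xext_size_gt0 g z.
have t0 : 0 < e * xext_size g z / 8 by rewrite divr_gt0 // mulr_gt0.
apply: filterS (xext_vec_near g t0) => h /(_ _ (hnorm_ucoord (val z))) le.
rewrite ydistC.
have [h0 hE] := @xext_rep h z _ (ucoord_neq0 (val z)) (ucoordK (val z)).
have [g0 gE] := @xext_rep g z _ (ucoord_neq0 (val z)) (ucoordK (val z)).
apply: le_lt_trans (ydist_le_hnorm g0 h0 gE hE) _.
rewrite mulrA ltr_pdivrMr // -(hnorm_opp (xext_vec g _ - _)) opprB.
by move: le t0; rewrite -/(xext_size g z); lra.
Qed.

Lemma xext_size_lower_point g (K : set (Y R)) : compact K ->
  exists2 c : R, 0 < c & forall z, K z -> c <= xext_size g z.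
Proof.
move=> cK; have [L L0 /nbhs_singleton hL] := xext_vec_locally_lip g.
have : \forall c \near 0^'+, K `<=` (fun z => c <= xext_size g z).
  apply: (iffLR (compact_near_coveringP K)) => // z Kz.
  have m0 := xext_size_gt0 g z.
  have d0 : 0 < xext_size g z / (4 * L) by rewrite divr_gt0 // mulr_gt0.
  exists ([set w | ydist z w < xext_size g z / (4 * L)],
          [set c | c < xext_size g z / 2]).
    split; first exact: near_ydist.
    by apply: nbhs_right_lt; rewrite divr_gt0.
  move=> [w c] [/= zw cz].
  have [v1 [v2 [h1 h2 e1 e2 dv]]] := aligned_ydist z w.
  rewrite -(xext_size_rep g h2 e2); rewrite -(xext_size_rep g h1 e1) in m0 zw cz.
  have := hL _ _ h1 h2.
  have := hnorm_triangle (xext_vec g v1 - xext_vec g v2) (xext_vec g v2).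
  rewrite subrK => t1 t2.
  have t3 : hnorm (v1 - v2) <= 2 * (hnorm (xext_vec g v1) / (4 * L)).
    apply: le_trans dv _; apply: ler_wpM2l => //; exact: ltW zw.
  have t4 : L * hnorm (v1 - v2) <= hnorm (xext_vec g v1) / 2.
    apply: le_trans (ler_wpM2l (ltW L0) t3) _.
    by rewrite le_eqVlt; apply/orP; left; apply/eqP; field; rewrite lt0r_neq0.
  by move: t1 t2 t4 cz; clear; lra.
move=> h; have [c [c0 hc]] := filter_ex (filterI (nbhs_right_gt 0) h).
by exists c.
Qed.

Lemma xext_size_lower (S : set (Xplus R)) (K : set (Y R)) :
  compact S -> compact K ->
  exists2 c : R, 0 < c & forall g z, S g -> K z -> c <= xext_size g z.
Proof.
move=> cS cK.
have : \forall c \near 0^'+, S `<=` (fun g => forall z, K z -> c <= xext_size g z).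
  apply: (iffLR (compact_near_coveringP S)) => // g Sg.
  have [c0 c00 hc] := xext_size_lower_point g cK.
  have c2 : 0 < c0 / 2 by rewrite divr_gt0.
  exists ([set h | forall v, hnorm v = 1 ->
             hnorm (xext_vec h v - xext_vec g v) <= c0 / 2], [set c | c < c0 / 2]).
    by split; first exact: xext_vec_near; exact: nbhs_right_lt.
  move=> [h c] [/= hg cc] z Kz; have := hg _ (hnorm_ucoord (val z)).
  have := hnorm_triangle (xext_vec g (ucoord (val z)) - xext_vec h (ucoord (val z)))
     (xext_vec h (ucoord (val z))).
  rewrite subrK -(hnorm_opp (xext_vec g _ - _)) opprB -!/(xext_size _ _).
  by have := hc z Kz; lra.
move=> h; have [c [c0 hc]] := filter_ex (filterI (nbhs_right_gt 0) h).
exists c => // g z Sg Kz.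
exact: hc.
Qed.

(** Unit coordinates of two points are aligned, moved, and compared with the
    distance again; only the last step costs a factor, the inverse of a lower
    bound for [xext_size]. *)
Lemma xext_lip (S : set (Xplus R)) (K : set (Y R)) : compact S -> compact K ->
  exists2 L : R, 1 <= L & forall g x y, S g -> K x -> K y ->
    ydist (xext g x) (xext g y) <= L * ydist x y.
Proof.
move=> cS cK; have [c c0 hc] := xext_size_lower cS cK.
have : \forall L \near +oo, S `<=` (fun g => forall x y, K x -> K y ->
    c <= xext_size g x -> ydist (xext g x) (xext g y) <= L * ydist x y).
  apply: (iffLR (compact_near_coveringP S)) => // g Sg.
  have [L0 L00 hL] := xext_vec_locally_lip g.
  exists ([set h | forall v w : 'rV[C]_3, hnorm v = 1 -> hnorm w = 1 ->
    hnorm (xext_vec h v - xext_vec h w) <= L0 * hnorm (v - w)],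
    [set L | 8 * L0 / c < L]).
    by split; first exact: hL; exact: nbhs_pinfty_gt (num_real _).
  move=> [h L] [/= hh cL] x y Kx Ky cx.
  have [v1 [v2 [h1 h2 e1 e2 dv]]] := aligned_ydist x y.
  have [n1 E1] := @xext_rep h x _ (hnorm1_neq0 h1) e1.
  have [n2 E2] := @xext_rep h y _ (hnorm1_neq0 h2) e2.
  apply: le_trans (ydist_le_hnorm n1 n2 E1 E2) _.
  apply: le_trans (_ : _ <= 8 * L0 / c * ydist x y) _; last first.
    by apply: ler_wpM2r; rewrite ?ydist_ge0 //; exact: ltW.
  rewrite (xext_size_rep h h1 e1) mulrA ler_pdivrMr ?xext_size_gt0 //.
  have b : 4 * hnorm (xext_vec h v1 - xext_vec h v2) <= 8 * L0 * ydist x y.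
    have := hh _ _ h1 h2; have := ler_wpM2l (ltW L00) dv.
    by set p := hnorm _; set q := hnorm _; set r := ydist _ _; lra.
  apply: le_trans b _.
  have -> : 8 * L0 / c * ydist x y * xext_size h x
      = 8 * L0 * ydist x y * (xext_size h x / c) by ring.
  rewrite ler_peMr ?mulr_ge0 ?ydist_ge0 ?(ltW L00) //.
  by rewrite ler_pdivlMr // mul1r.
move=> h; have [L [L1 hL]] := filter_ex (filterI (nbhs_pinfty_gt (num_real 1)) h).
exists L; first exact: ltW.
by move=> g x y Sg Kx Ky; apply: hL => //; exact: hc.
Qed.

End Lipschitz.

(** * The support of a measure on the space of maps, and averages over it *)

Section SecondCountable.
Variable R : realType.
Local Notation C := R[i].
Implicit Types (g h : Xplus R) (e : R).

Definition xclose e g h : Prop :=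
  [/\ cmod (xshift h - xshift g) < e, cmod (xdelta h - xdelta g) < e,
      size (xpoly h) = size (xpoly g) &
      forall i, (i < size (xpoly g))%N -> cmod ((xpoly h)`_i - (xpoly g)`_i) < e].

Lemma cvg_cmod (u : nat -> C) (l : C) :
  (forall k, cmod (u k - l) < k.+1%:R^-1) -> u @ \oo --> l.
Proof.
move=> h; apply/cvgrPdist_lt => e e0.
have e0R : 0 < complex.Re e by move: e0; rewrite ltcE /= => /andP[].
have eE : e = (complex.Re e)%:C%C.
  by case: e e0 {e0R} => x y; rewrite ltcE /= => /andP[/eqP ->].
near=> k; rewrite distrC.
have -> : `|u k - l| = (cmod (u k - l))%:C%C.
  by rewrite normc_def; case: (u k - l).
rewrite eE ltcR; apply: lt_trans (h k) _.
rewrite invf_plt ?posrE //; near: k.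
by apply: filterS (near_infty_natSinv_lt (PosNum e0R)) => k /=; rewrite invf_plt ?posrE.
Unshelve. all: by end_near. Qed.

(** Convergence of sequences is known coefficientwise, and a neighbourhood that
    contained none of the sets [xclose] would be missed by a convergent
    sequence. *)
Lemma nbhs_xclose g (U : set (Xplus R)) : nbhs g U ->
  exists2 k : nat, True & forall h, xclose k.+1%:R^-1 g h -> U h.
Proof.
move=> gU; apply: contrapT => noK.
have /choice[h hP] : forall k : nat, exists h, xclose k.+1%:R^-1 g h /\ ~ U h.
  move=> k; apply: contrapT => nh; apply: noK; exists k => // h ch.
  by apply: contrapT => nU; apply: nh; exists h.
have : h @ \oo --> g.
  apply/Xplus_cvgP; split.
  - by apply: cvg_cmod => k; have [[]] := hP k.
  - by apply: cvg_cmod => k; have [[]] := hP k.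
  - by near=> k; have [[]] := hP k.
  - move=> i; have [ig|gi] := ltnP i (size (xpoly g)).
      by apply: cvg_cmod => k; have [[_ _ _ H] _] := hP k; exact: H.
    apply: cvg_cmod => k; have [[_ _ s _] _] := hP k.
    by rewrite !nth_default ?s // subrr Normc.normc0 invr_gt0.
move=> /(_ _ gU) hU; have [k Uk] := @filter_ex _ \oo _ (h @^-1` U) hU.
by have [_] := hP k.
Unshelve. all: by end_near. Qed.

Definition ratC (q : rat * rat) : C := Complex (ratr q.1) (ratr q.2).

Lemma ratC_dense (a : C) e : 0 < e -> exists q, cmod (a - ratC q) < e.
Proof.
case: a => x y e0; have e2 : 0 < e / 2 by rewrite divr_gt0.
have [|p] := @rat_in_itvoo R (x - e / 2) (x + e / 2); first by rewrite ltrD2l; lra.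
have [|q] := @rat_in_itvoo R (y - e / 2) (y + e / 2); first by rewrite ltrD2l; lra.
rewrite !in_itv /= => /andP[q1 q2] /andP[p1 p2]; exists (p, q) => /=.
rewrite -[ltRHS]gtr0_norm // -sqrtr_sqr ltr_sqrt ?exprn_gt0 //.
move: (ratr p) (ratr q) p1 p2 q1 q2 => s t; nra.
Qed.

(** The sets with rational centers form a countable base of the topology. *)
Definition xbox (i : nat * nat * (rat * rat) * (rat * rat) * seq (rat * rat)) :
    set (Xplus R) :=
  let: (k, n, a, b, s) := i in
  [set h | [/\ cmod (xshift h - ratC a) < k.+1%:R^-1,
     cmod (xdelta h - ratC b) < k.+1%:R^-1, size (xpoly h) = n &
     forall i : 'I_n, cmod ((xpoly h)`_i - ratC (nth (0, 0) s i)) < k.+1%:R^-1]].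

Lemma near_cmod_lt (a b : C) e : cmod (b - a) < e ->
  exists2 d : R, 0 < d & forall c, cmod (c - b) < d -> cmod (c - a) < e.
Proof.
move=> h; exists (e - cmod (b - a)); first by rewrite subr_gt0.
move=> c; rewrite ltrBrDr; apply: le_lt_trans.
by have := le_normcD (c - b) (b - a); rewrite addrA subrK.
Qed.

Lemma xbox_open i : open (xbox i).
Proof.
case: i => [[[[k n] a] b] s]; rewrite openE => h [ha hb hn hp].
have [d1 d10 n1] := near_cmod_lt ha.
have [d2 d20 n2] := near_cmod_lt hb.
have n3 : \forall h' \near h, forall i : 'I_n,
    cmod ((xpoly h')`_i - ratC (nth (0, 0) s i)) < k.+1%:R^-1.
  apply: (@filter_forall _ _ (fun i : 'I_n => [set h' : Xplus R |
    cmod ((xpoly h')`_i - ratC (nth (0, 0) s i)) < k.+1%:R^-1]) _ (nbhs_filter h)).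
  move=> i; have [d d0 nd] := near_cmod_lt (hp i).
  apply: filterS (near_xdata h d0) => h' [_ _ _ /(_ i)].
  by rewrite hn ltn_ord => /(_ isT) /nd.
near=> h'; split=> /=.
- apply: n1; near: h'.
  by apply: filterS (near_xdata h d10) => ? [].
- apply: n2; near: h'.
  by apply: filterS (near_xdata h d20) => ? [].
- near: h'.
  by apply: filterS (near_xdata h d20) => ? [_ _ ->].
- by near: h'.
Unshelve. all: by end_near. Qed.

Lemma xbox_base g (U : set (Xplus R)) : nbhs g U ->
  exists i, xbox i g /\ xbox i `<=` U.
Proof.
move=> /nbhs_xclose[k _ kU].
pose r : R := (k.+1.*2.-1).+1%:R^-1.
have rE : r + r = k.+1%:R^-1.
  by rewrite /r prednK ?double_gt0 // -muln2 natrM invfM -splitr.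
have r0 : 0 < r by rewrite invr_gt0.
have [a ha] := ratC_dense (xshift g) r0.
have [b hb] := ratC_dense (xdelta g) r0.
have /choice[s hs] : forall i : nat, exists q, cmod ((xpoly g)`_i - ratC q) < r.
  by move=> i; exact: ratC_dense.
pose n := size (xpoly g).
exists (k.+1.*2.-1, n, a, b, mkseq s n); split.
  by split=> // i; rewrite nth_mkseq.
have tri (x y z : C) : cmod (x - z) < r -> cmod (y - z) < r -> cmod (x - y) < k.+1%:R^-1.
  move=> xz yz; rewrite -rE; have := le_normcD (x - z) (z - y).
  rewrite addrA subrK => /le_lt_trans; apply; apply: ltrD => //.
  by rewrite -normcN opprB.
move=> h [h1 h2 h3 h4]; apply: kU; split=> //.
- exact: tri h1 ha.
- exact: tri h2 hb.
- move=> i ig; have := h4 (Ordinal ig); rewrite /= nth_mkseq // => h5.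
  exact: tri h5 (hs i).
Qed.

End SecondCountable.

(** The integrands: the average only sees the support, so that continuity
    there is enough. *)
Definition admissible (R : realType) (X : topologicalType) (S : set X)
    (f : X -> R) : Prop :=
  forall g, S g -> forall e : R, 0 < e ->
    \forall h \near g, S h -> `|f h - f g| < e.

Section Support.
Variables (R : realType) (tau : probability (borelXplus R) R).
Local Notation X := (Xplus R).
Local Notation supp := (meas_support tau).

Lemma open_measurable_X (U : set X) : open U -> measurable (U : set (borelXplus R)).
Proof. by move=> oU; apply: sub_sigma_algebra. Qed.

Lemma supp_closed : closed supp.
Proof.
rewrite -[X in closed X]setCK; apply: open_closedC; rewrite openE => g /= ng.
have [U [oU [Ug t0]]] : exists U : set X, open U /\ U g /\ ~ (0 < tau U)%E.
  apply: contrapT => h; apply: ng => U oU Ug.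
  by apply: contrapT => t0; apply: h; exists U.
apply: filterS (open_nbhs_nbhs (conj oU Ug)) => h Uh /(_ U oU Uh).
exact: t0.
Qed.

Lemma supp_measurable : measurable (supp : set (borelXplus R)).
Proof.
rewrite -[X in measurable X]setCK; apply: measurableC.
by apply: open_measurable_X; apply: closed_openC; exact: supp_closed.
Qed.

(** The complement of the support is covered by its null basic open sets, of
    which there are countably many. *)
Lemma supp_null : tau (~` supp) = 0%E.
Proof.
pose B (i : nat) : set (borelXplus R) :=
  if unpickle i is Some j then
    if tau (@xbox R j) == 0%E then @xbox R j else set0 else set0.
have mB i : measurable (B i).
  rewrite /B; case: unpickle => [j|//]; case: ifP => // _.
  by apply: open_measurable_X; exact: xbox_open.
have B0 i : tau (B i) = 0%E.
  by rewrite /B; case: unpickle => [j|]; [case: ifP => [/eqP//|_]|]; rewrite measure0.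
have mS : measurable (~` supp : set (borelXplus R)).
  by apply: measurableC; exact: supp_measurable.
have le := @measure_sigma_subadditive _ _ _ tau (~` supp) B mB mS.
apply/eqP; rewrite eq_le measure_ge0 andbT; apply: le_trans (le _) _; last first.
  by rewrite eseries0 // => i _ _; exact: B0.
move=> g /= ng.
have [U [oU [Ug t0]]] : exists U : set X, open U /\ U g /\ ~ (0 < tau U)%E.
  apply: contrapT => h; apply: ng => U oU Ug.
  by apply: contrapT => t0; apply: h; exists U.
have [j [jg jU]] := xbox_base (open_nbhs_nbhs (conj oU Ug)).
suff Bj : B (pickle j) = @xbox R j by exists (pickle j); [exact: I|rewrite Bj].
suff tj : tau (@xbox R j) == 0%E by rewrite /B pickleK tj.
rewrite eq_le measure_ge0 andbT leNgt; apply/negP => tj; apply: t0.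
apply: lt_le_trans tj _; apply: le_measure => //; rewrite inE.
  by apply: open_measurable_X; exact: xbox_open.
exact: open_measurable_X.
Qed.

Lemma supp_full : tau supp = 1%E.
Proof.
have := probability_setC tau (measurableC supp_measurable).
by rewrite setCK supp_null sube0.
Qed.

Lemma supp_meas_open (O : set X) g : open O -> supp g -> O g ->
  (0 < tau (supp `&` O))%E.
Proof.
move=> oO sg Og; apply: lt_le_trans (sg O oO Og) _.
have mO := open_measurable_X oO; have mS := supp_measurable.
have e : (O : set (borelXplus R)) `<=` (supp `&` O) `|` ~` supp.
  by move=> h Oh; have [?|?] := pselect (supp h); [left|right].
apply: le_trans (le_measure tau _ _ e) _; rewrite ?inE //.
  by apply: measurableU; [exact: measurableI|exact: measurableC].
apply: le_trans (measureU2 _ _ _) _.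
- exact: measurableI.
- exact: measurableC.
- by rewrite [X in (_ + X <= _)%E](_ : _ = 0%E) ?adde0 //; exact: supp_null.
Qed.

Hypothesis csupp : compact supp.
Implicit Types f : X -> R.

Definition mean (f : X -> R) : R := \int[tau]_(g in supp) f g.

Lemma admissible_measurable f : admissible supp f -> measurable_fun (supp : set (borelXplus R)) f.
Proof.
move=> af; apply: (measurability _ (measurable_realfun.RGenOpens.measurableE R)).
move=> _ [_ [a [b ->] <-]]; set U := `]a, b[%classic.
have oU : open U by exact: interval_open.
pose O : set X := interior [set h | supp h -> U (f h)].
have -> : supp `&` f @^-1` U = supp `&` O.
  apply/seteqP; split=> g [sg h]; split=> //.
    have /nbhs_ballP[e /= e0 eU] : nbhs (f g) U.
      by apply: open_nbhs_nbhs; split.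
    apply: filterS (af g sg e e0) => k hk sk; apply: eU.
    by rewrite /ball /= distrC; exact: hk.
  exact: (nbhs_singleton h).
apply: measurableI; first exact: supp_measurable.
by apply: open_measurable_X; exact: open_interior.
Qed.

Lemma admissible_bounded f : admissible supp f -> exists M : R, forall g, supp g -> `|f g| <= M.
Proof.
move=> af; have : \forall M \near +oo, supp `<=` (fun g => supp g -> `|f g| <= M).
  apply: (iffLR (compact_near_coveringP supp)) => // g sg.
  exists ([set h | supp h -> `|f h - f g| < 1], [set M | `|f g| + 1 < M]).
    by split; [exact: af|exact: nbhs_pinfty_gt (num_real _)].
  move=> [h M] [/= h1 h2 /h1 h3]; apply: ltW; apply: le_lt_trans h2.
  rewrite -[f h](subrK (f g)) addrC (le_trans (ler_normD _ _)) // lerD2l.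
  exact: ltW.
by move=> /filter_ex[M hM]; exists M => g sg; exact: hM.
Qed.

Lemma admissible_integrable f : admissible supp f -> tau.-integrable supp (EFin \o f).
Proof.
move=> af; apply: measurable_bounded_integrable.
- exact: supp_measurable.
- by rewrite [X in (X < _)%E](_ : _ = 1%E) ?ltry //; exact: supp_full.
- exact: admissible_measurable.
- have [M hM] := admissible_bounded af; exists M; split; first exact: num_real.
  by move=> M' MM' g sg /=; apply: le_trans (hM g sg) (ltW MM').
Qed.

Lemma mean_cst (c : R) : mean (fun=> c) = c.
Proof.
rewrite /mean Rintegral_cst; last exact: supp_measurable.
by rewrite [X in fine X](_ : _ = 1%E) ?mulr1 //; exact: supp_full.
Qed.

Lemma mean_lin (a : R) f f' : admissible supp f -> admissible supp f' ->
  mean (fun g => a * f g + f' g) = a * mean f + mean f'.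
Proof.
move=> /admissible_integrable i1 /admissible_integrable i2; have mS := supp_measurable.
have i3 : tau.-integrable supp (EFin \o (fun g => a * f g)).
  exact: (integrableZl mS a i1).
by rewrite /mean RintegralD // RintegralZl.
Qed.

Lemma mean_ge0 f : (forall g, supp g -> 0 <= f g) -> 0 <= mean f.
Proof. by move=> f0; rewrite /mean; apply: Rintegral_ge0. Qed.

Lemma mean_gt0 f g : admissible supp f -> (forall g, supp g -> 0 <= f g) ->
  supp g -> 0 < f g -> 0 < mean f.
Proof.
move=> af f0 sg fg; pose a := f g / 2; have a0 : 0 < a by rewrite divr_gt0.
pose O : set X := interior [set h | supp h -> a < f h].
have oO : open O by exact: open_interior.
have Og : O g.
  apply: filterS (af g sg a a0) => h /[apply]; rewrite ltr_norml.
  by rewrite {2}/a; move=> /andP[+ _]; rewrite /a; lra.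
have mS := supp_measurable; have mO := open_measurable_X oO.
have mSO : measurable (supp `&` O : set (borelXplus R)) by exact: measurableI.
have mSD : measurable (supp `\` O : set (borelXplus R)) by exact: measurableD.
have i1 := admissible_integrable af.
have i2 : tau.-integrable (supp `&` O) (EFin \o f).
  by apply: integrableS i1 => //; exact: subIsetl.
have -> : mean f = \int[tau]_(g in supp `&` O) f g + \int[tau]_(g in supp `\` O) f g.
  rewrite /mean -{1}(setUIDK supp O) Rintegral_setU // ?setUIDK //.
  by apply/disj_setPRL => h [_ nO] [_].
apply: ltr_pwDl; last by apply: Rintegral_ge0 => h [/f0].
have tO := supp_meas_open oO sg Og.
have fO : tau (supp `&` O) \is a fin_num by exact: fin_num_measure.
apply: lt_le_trans (_ : \int[tau]_(g in supp `&` O) a <= _).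
  rewrite Rintegral_cst //; apply: mulr_gt0 => //; apply: fine_gt0.
  by rewrite tO /= -ge0_fin_numE.
apply: le_Rintegral => //.
  apply: measurable_bounded_integrable => //.
    by rewrite -ge0_fin_numE.
  by exists `|a|; split; [exact: num_real|move=> M aM h _ /=; exact: ltW].
move=> h [sh /nbhs_singleton]; move=> /(_ sh); exact: ltW.
Qed.

End Support.

(** * Random iteration on a metric space: words and averages *)

(** What the dynamical part of the proof needs to know about the maps and their
    law: a bounded metric that is continuous, maps that depend continuously on
    their parameter and are Lipschitz on compact sets, and a strictly positive
    average over the support of the law. *)
Record system (R : realType) := System {
  space : topologicalType;
  maps : topologicalType;
  dist : space -> space -> R;
  act : maps -> space -> space;
  supp : set maps;
  avg : (maps -> R) -> R;
  dist_ge0 : forall x y, 0 <= dist x y;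
  distxx : forall x, dist x x = 0;
  dist_eq0 : forall x y, dist x y = 0 -> x = y;
  distC : forall x y, dist x y = dist y x;
  dist_tri : forall x y z, dist x z <= dist x y + dist y z;
  dist_le2 : forall x y, dist x y <= 2;
  near_dist : forall x (e : R), 0 < e -> \forall y \near x, dist x y < e;
  near_act : forall g x (e : R), 0 < e ->
    \forall h \near g, dist (act h x) (act g x) < e;
  act_lip : forall K, compact K -> exists2 L : R, 1 <= L &
    forall g x y, supp g -> K x -> K y ->
      dist (act g x) (act g y) <= L * dist x y;
  avg_cst : forall c, avg (fun=> c) = c;
  avg_lin : forall a f f', admissible supp f -> admissible supp f' ->
    avg (fun g => a * f g + f' g) = a * avg f + avg f';
  avg_ge0 : forall f, (forall g, supp g -> 0 <= f g) -> 0 <= avg f;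
  avg_gt0 : forall f g, admissible supp f -> (forall g, supp g -> 0 <= f g) ->
    supp g -> 0 < f g -> 0 < avg f }.

Section Words.
Variables (R : realType) (Z : system R).
Local Notation Y := (space Z).
Local Notation X := (maps Z).
Implicit Types (x y z : Y) (s t : seq X).

Definition word s : Prop := forall g, g \in s -> supp g.

Definition run s x : Y := foldl (fun w g => act g w) x s.

Lemma word_nil : word [::].
Proof. by []. Qed.

Lemma word_cons g s : word (g :: s) <-> supp g /\ word s.
Proof.
split=> [h|[h1 h2] g']; last by rewrite inE => /orP[/eqP->//|/h2].
by split=> [|g' g's]; apply: h; rewrite inE ?eqxx ?g's ?orbT.
Qed.

Lemma word_cat s t : word (s ++ t) <-> word s /\ word t.
Proof.
split=> [h|[h1 h2] g]; last by rewrite mem_cat => /orP[/h1|/h2].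
by split=> g gs; apply: h; rewrite mem_cat gs ?orbT.
Qed.

Lemma run_cat s t x : run (s ++ t) x = run t (run s x).
Proof. exact: foldl_cat. Qed.

Lemma word_nseq n g : supp g -> word (nseq n g).
Proof. by move=> sg h; rewrite mem_nseq => /andP[_ /eqP ->]. Qed.

Lemma supp_nonempty : exists g : X, supp g.
Proof.
apply: contrapT => no; suff : 0 <= -1 :> R by rewrite ler0N1.
rewrite -(avg_cst Z (-1)); apply: avg_ge0 => g sg.
by case: no; exists g.
Qed.

Lemma exists_word n : exists2 s : seq X, word s & size s = n.
Proof.
have [g sg] := supp_nonempty.
by exists (nseq n g); [exact: word_nseq|exact: size_nseq].
Qed.

Lemma dist_lt_tri (x y z : Y) (a b c : R) : a + b <= c ->
  dist x y < a -> dist y z < b -> dist x z < c.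
Proof.
move=> abc xy yz; apply: le_lt_trans (dist_tri x y z) _.
by apply: lt_le_trans abc; exact: ltrD.
Qed.

End Words.

Section Operator.
Variables (R : realType) (Z : system R).
Local Notation Y := (space Z).
Local Notation X := (maps Z).
Variable K : set Y.
Hypothesis cK : compact K.
Hypothesis iK : forall g x, supp g -> K x -> K (act g x).
Implicit Types (x y z : Y) (s t : seq X) (h f : Y -> R).

Lemma run_inv s x : word s -> K x -> K (run s x).
Proof.
elim: s x => [//|g s IH] x /word_cons[sg ws] Kx; apply: IH => //.
exact: iK.
Qed.

Definition uc h : Prop := forall e : R, 0 < e -> exists2 r : R, 0 < r &
  forall x y, K x -> K y -> dist x y < r -> `|h x - h y| < e.

Definition averaging h z : R := avg (fun g => h (act g z)).

Local Notation T := averaging.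

Lemma uc_cst (c : R) : uc (fun=> c).
Proof. by move=> e e0; exists 1 => // x y _ _ _; rewrite subrr normr0. Qed.

Lemma uc_lin (a : R) h f : uc h -> uc f -> uc (fun z => a * h z + f z).
Proof.
move=> uh uf e e0; have d0 : 0 < `|a| + 1 by rewrite ltr_wpDl.
have [|r1 r10 h1] := uh (e / 2 / (`|a| + 1)); first by rewrite !divr_gt0.
have [|r2 r20 h2] := uf (e / 2); first by rewrite divr_gt0.
exists (Num.min r1 r2); first by rewrite lt_min r10.
move=> x y Kx Ky; rewrite lt_min => /andP[xy1 xy2].
have -> : a * h x + f x - (a * h y + f y) = a * (h x - h y) + (f x - f y) by ring.
apply: le_lt_trans (ler_normD _ _) _; rewrite normrM.
have := h1 x y Kx Ky xy1; rewrite ltr_pdivlMr // => k1.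
have k2 := h2 x y Kx Ky xy2.
have := normr_ge0 a; have := normr_ge0 (h x - h y).
by move: k1 k2; set p := `|_|; set q := `|_|; set u := `|_|; nra.
Qed.

Lemma uc_lip h (L : R) :
  (forall x y, K x -> K y -> `|h x - h y| <= L * dist x y) -> uc h.
Proof.
move=> hL e e0; have d0 : 0 < `|L| + 1 by rewrite ltr_wpDl.
exists (e / (`|L| + 1)); first by rewrite divr_gt0.
move=> x y Kx Ky; rewrite ltr_pdivlMr // mulrC; apply: le_lt_trans.
apply: le_trans (hL x y Kx Ky) _; rewrite ler_wpM2r ?dist_ge0 //.
by rewrite (le_trans (ler_norm L)) // lerDl.
Qed.

Lemma uc_admissible h z : uc h -> K z -> admissible (@supp _ Z) (fun g => h (act g z)).
Proof.
move=> uh Kz g sg e e0; have [r r0 hr] := uh e e0.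
apply: filterS (near_act g z r0) => g' dg sg'.
by apply: hr => //; exact: iK.
Qed.

Lemma avg_le (a b : X -> R) : admissible (@supp _ Z) a -> admissible (@supp _ Z) b ->
  (forall g, supp g -> a g <= b g) -> avg a <= avg b.
Proof.
move=> aa ab le; have := @avg_ge0 _ Z (fun g => -1 * a g + b g).
rewrite avg_lin // mulN1r addrC subr_ge0; apply=> g sg.
by rewrite mulN1r addrC subr_ge0 le.
Qed.

Lemma admissible_lin (a : R) (f f' : X -> R) :
  admissible (@supp _ Z) f -> admissible (@supp _ Z) f' ->
  admissible (@supp _ Z) (fun g => a * f g + f' g).
Proof.
move=> af af' g sg e e0; have d0 : 0 < `|a| + 1 by rewrite ltr_wpDl.
have h1 := af g sg (e / 2 / (`|a| + 1)) _.
have h2 := af' g sg (e / 2) _.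
have /h1{}h1 : 0 < e / 2 / (`|a| + 1) by rewrite !divr_gt0.
have /h2{}h2 : 0 < e / 2 by rewrite divr_gt0.
apply: filterS2 h1 h2 => k k1 k2 sk.
have -> : a * f k + f' k - (a * f g + f' g) = a * (f k - f g) + (f' k - f' g) by ring.
apply: le_lt_trans (ler_normD _ _) _; rewrite normrM.
have := k1 sk; rewrite ltr_pdivlMr // => k3.
have := k2 sk; have := normr_ge0 a; have := normr_ge0 (f k - f g).
by move: k3; set p := `|_|; set q := `|_|; set u := `|_|; nra.
Qed.

Lemma avg_dist_le (a b c : X -> R) : admissible (@supp _ Z) a -> admissible (@supp _ Z) b ->
  admissible (@supp _ Z) c -> (forall g, supp g -> `|a g - b g| <= c g) ->
  `|avg a - avg b| <= avg c.
Proof.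
move=> aa ab ac le; rewrite ler_norml.
have h1 : avg b <= 1 * avg c + avg a.
  rewrite -avg_lin //; apply: avg_le => // [|g sg]; first exact: admissible_lin.
  by have := le g sg; rewrite ler_norml mul1r => /andP[]; lra.
have h2 : avg a <= 1 * avg c + avg b.
  rewrite -avg_lin //; apply: avg_le => // [|g sg]; first exact: admissible_lin.
  by have := le g sg; rewrite ler_norml mul1r => /andP[]; lra.
by apply/andP; split; lra.
Qed.

Lemma T_uc h : uc h -> uc (T h).
Proof.
move=> uh e e0; have [L L1 hL] := act_lip cK.
have e2 : 0 < e / 2 by rewrite divr_gt0.
have [r r0 hr] := uh (e / 2) e2; have L0 : 0 < L by exact: lt_le_trans L1.
exists (r / L); first by rewrite divr_gt0.
move=> x y Kx Ky xy; apply: (@le_lt_trans _ _ (e / 2)); last first.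
  by rewrite ltr_pdivrMr // ltr_pMr // ltr1n.
rewrite -[leRHS](avg_cst Z); apply: avg_dist_le.
- exact: uc_admissible.
- exact: uc_admissible.
- by move=> g sg e' e'0; apply: nearW => k _; rewrite subrr normr0.
move=> g sg; apply: ltW; apply: hr; [exact: iK|exact: iK|].
by apply: le_lt_trans (hL g x y sg Kx Ky) _; rewrite mulrC -ltr_pdivlMr.
Qed.

Lemma iter_T_uc k h : uc h -> uc (iter k T h).
Proof. by move=> uh; elim: k => //= k; exact: T_uc. Qed.

Lemma T_lin (a : R) h f z : uc h -> uc f -> K z ->
  T (fun y => a * h y + f y) z = a * T h z + T f z.
Proof. by move=> uh uf Kz; rewrite /averaging -avg_lin //; exact: uc_admissible. Qed.

(** The iterates of [T] average over words, so that what holds along every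
    word holds for them. *)
Lemma iter_T_le k h f x : uc h -> uc f -> K x ->
  (forall s, word s -> size s = k -> h (run s x) <= f (run s x)) ->
  iter k T h x <= iter k T f x.
Proof.
move=> uh uf; elim: k x => [|k IH] x Kx le; first exact: (le [::] (@word_nil _ Z)).
rewrite !iterS; apply: avg_le; try exact: uc_admissible (iter_T_uc _ _) _.
move=> g sg; apply: IH => [|s ws ss]; first exact: iK.
by apply: (le (g :: s)); [apply/word_cons|rewrite /= ss].
Qed.

(** A coupling argument: the same random word drives both points. *)
Lemma iter_T_dist k h1 h2 f x y : uc h1 -> uc h2 -> uc f -> K x -> K y ->
  (forall s, word s -> size s = k ->
     `|h1 (run s x) - h2 (run s y)| <= f (run s x)) ->
  `|iter k T h1 x - iter k T h2 y| <= iter k T f x.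
Proof.
move=> uh1 uh2 uf; elim: k x y => [|k IH] x y Kx Ky le.
  exact: (le [::] (@word_nil _ Z)).
rewrite !iterS; apply: avg_dist_le; try exact: uc_admissible (iter_T_uc _ _) _.
move=> g sg; apply: IH => [||s ws ss]; [exact: iK|exact: iK|].
by apply: (le (g :: s)); [apply/word_cons|rewrite /= ss].
Qed.

Lemma iter_T_gt0 k h x s : uc h -> K x ->
  (forall t, word t -> size t = k -> 0 <= h (run t x)) ->
  word s -> size s = k -> 0 < h (run s x) -> 0 < iter k T h x.
Proof.
move=> uh; elim: k x s => [|k IH] x s Kx ge ws ss hs.
  by move: ss hs => /size0nil ->.
case: s ws ss hs => // g s /word_cons[sg ws] [ss] hs.
rewrite iterS; apply: (@avg_gt0 _ Z _ g) => //.
- exact: uc_admissible (iter_T_uc _ _) _.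
- move=> g' sg'; rewrite -[leLHS](_ : iter k T (fun=> 0) (act g' x) = 0).
    apply: iter_T_le => //; [exact: uc_cst|exact: iK|].
    by move=> t wt st; apply: (ge (g' :: t)); [apply/word_cons|rewrite /= st].
  elim: k {IH ge ss hs} (act g' x) => //= k IH z; rewrite /T.
  by rewrite (_ : (fun g => _) = fun=> 0) ?avg_cst //; apply/funext => g''; exact: IH.
- apply: (IH _ s) => //; first exact: iK.
  by move=> t wt st; apply: (ge (g :: t)); [apply/word_cons|rewrite /= st].
Qed.

Lemma iter_T_cst k (c : R) x : iter k T (fun=> c) x = c.
Proof.
elim: k x => //= k IH x; rewrite /averaging (_ : (fun g => _) = fun=> c) ?avg_cst //.
by apply/funext => g; exact: IH.
Qed.

Lemma iter_T_ext k h f x : uc h -> uc f -> K x ->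
  (forall z, K z -> h z = f z) -> iter k T h x = iter k T f x.
Proof.
move=> uh uf Kx e; apply/eqP; rewrite eq_le; apply/andP.
by split; apply: iter_T_le => // s ws _; rewrite e //; exact: run_inv.
Qed.

Lemma iter_T_lin k (a : R) h f z : uc h -> uc f -> K z ->
  iter k T (fun y => a * h y + f y) z = a * iter k T h z + iter k T f z.
Proof.
move=> uh uf; elim: k z => [//|k IH] z Kz; rewrite !iterS.
rewrite -T_lin //; try exact: iter_T_uc.
have := @iter_T_ext 1 _ _ z _ _ Kz IH; apply.
  by apply: iter_T_uc; exact: uc_lin.
by apply: uc_lin; exact: iter_T_uc.
Qed.

End Operator.

(** * Compactness and contraction along words *)

Section Compactness.
Variables (R : realType) (Z : system R).
Local Notation Y := (space Z).
Implicit Types (x y z : Y) (A B : set Y).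

Lemma dist_gt0 x y : x <> y -> 0 < dist x y.
Proof.
by move=> xy; rewrite lt_def dist_ge0 andbT; apply/eqP => /dist_eq0.
Qed.

Lemma near_dist_gt x z (e : R) : e < dist x z -> \forall y \near z, e < dist x y.
Proof.
rewrite -subr_gt0 => e0; apply: filterS (near_dist z e0) => y.
rewrite ltrBrDl -ltrBrDr => /lt_le_trans; apply.
by rewrite lerBlDr (distC z y); exact: dist_tri.
Qed.

Lemma space_hausdorff : hausdorff_space Y.
Proof.
move=> x y xy; apply: contrapT => /dist_gt0 d0.
have d2 : 0 < dist x y / 2 by rewrite divr_gt0.
have [z [/= xz yz]] := xy _ _ (near_dist x d2) (near_dist y d2).
have := dist_tri x z y; rewrite (distC z y) => /le_lt_trans/(_ (ltrD xz yz)).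
by rewrite -splitr ltxx.
Qed.

(** Compactness in the form in which it is used: a property of points and
    small radii that holds locally, holds uniformly. *)
Lemma compact_uniform (A : set Y) (P : R -> Y -> Prop) : compact A ->
  (forall x, A x -> exists2 r : R, 0 < r & forall y r', A y -> dist x y < r ->
     0 < r' -> r' < r -> P r' y) ->
  exists2 r : R, 0 < r & forall y, A y -> P r y.
Proof.
move=> cA loc.
have : \forall r \near 0^'+, A `<=` (fun y => A y -> P r y).
  apply: (iffLR (compact_near_coveringP A)) => // x Ax.
  have [r r0 hr] := loc x Ax.
  exists ([set y | dist x y < r], [set r' | 0 < r' /\ r' < r]).
    split; first exact: near_dist.
    by apply: filterI; [exact: nbhs_right_gt|exact: nbhs_right_lt].
  by move=> [y r'] [/= xy [r'0 r'r]] Ay; exact: hr.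
move=> h; have [r [r0 hr]] := filter_ex (filterI (nbhs_right_gt 0) h).
by exists r => // y Ay; exact: hr.
Qed.

Lemma compact_uniform_nat (A : set Y) (P : nat -> Y -> Prop) : compact A ->
  (forall x, A x -> exists2 r : R, 0 < r & exists k0, forall y k, A y ->
     dist x y < r -> (k0 <= k)%N -> P k y) ->
  exists k0, forall k y, (k0 <= k)%N -> A y -> P k y.
Proof.
move=> cA loc.
have [k0 _ h] : \forall k \near \oo, A `<=` (fun y => A y -> P k y).
  apply: (iffLR (compact_near_coveringP A)) => // x Ax.
  have [r r0 [k0 hr]] := loc x Ax.
  exists ([set y | dist x y < r], [set k | (k0 <= k)%N]).
    by split; [exact: near_dist|exists k0].
  by move=> [y k] [/= xy kk] Ay; exact: hr.
by exists k0 => k y kk Ay; exact: (h k kk).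
Qed.

Lemma open_ball_sub A (U : set Y) x : compact A -> open U -> U x ->
  exists2 r : R, 0 < r & forall y, A y -> dist x y < r -> U y.
Proof.
move=> cA oU Ux.
have : \forall r \near 0^'+, A `<=` (fun y => dist x y < r -> U y).
  apply: (iffLR (compact_near_coveringP A)) => // y Ay.
  have [Uy|nUy] := pselect (U y).
    exists (U, setT); last by move=> [z r] [].
    by split; [exact: open_nbhs_nbhs|exact: filterT].
  have d0 : 0 < dist x y / 2.
    by rewrite divr_gt0 // dist_gt0 // => xy; apply: nUy; rewrite -xy.
  exists ([set z | dist x y / 2 < dist x z], [set r | r < dist x y / 2]).
    split; last exact: nbhs_right_lt.
    by apply: near_dist_gt; lra.
  by move=> [z r] [/= h1 h2] h3; have := lt_trans h1 (lt_trans h3 h2); rewrite ltxx.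
move=> h; have [r [r0 hr]] := filter_ex (filterI (nbhs_right_gt 0) h).
by exists r.
Qed.

Lemma lebesgue_number (I : Type) (U : I -> set Y) (A Q : set Y) :
  compact A -> compact Q -> Q `<=` A -> (forall j, open (U j)) ->
  Q `<=` \bigcup_j U j ->
  exists2 r : R, 0 < r & forall q y, Q q -> A y -> dist q y < r ->
    exists j, U j q /\ U j y.
Proof.
move=> cA cQ QA oU QU; pose P r q := forall y, A y -> dist q y < r ->
    exists j, U j q /\ U j y.
have [q Qq|r r0 h] := @compact_uniform Q P cQ; last by exists r => // q y /h; exact.
have [j _ Uq] := QU q Qq; have [r r0 hr] := open_ball_sub cA (oU j) Uq.
have r2 : 0 < r / 2 by rewrite divr_gt0.
have r2r : r / 2 < r by rewrite ltr_pdivrMr // ltr_pMr // ltr1n.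
exists (r / 2) => // y r' Qy qy r'0 r'r z Az yz; exists j.
split; first by apply: hr; [exact: QA|exact: lt_trans r2r].
apply: hr => //; apply: (@dist_lt_tri _ _ q y z _ _ _ _ qy yz).
by rewrite [leRHS]splitr lerD2l ltW.
Qed.

Lemma closure_dist (A : set Y) x (e : R) : closure A x -> 0 < e ->
  exists2 y, A y & dist x y < e.
Proof. by move=> cx e0; have [y [Ay xy]] := cx _ (near_dist x e0); exists y. Qed.

Lemma dist_closure (A B : set Y) x : compact B -> A `<=` B ->
  B x -> (forall e : R, 0 < e -> exists2 y, A y & dist x y < e) -> closure A x.
Proof.
move=> cB AB Bx h U; rewrite nbhsE => -[V [oV Vx] VU].
have [r r0 hr] := open_ball_sub cB oV Vx.
by have [y Ay xy] := h r r0; exists y; split=> //; apply/VU/hr => //; exact: AB.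
Qed.

Lemma uc_bounded (K : set Y) (h : Y -> R) : compact K -> uc K h ->
  exists2 M : R, 0 <= M & forall z, K z -> `|h z| <= M.
Proof.
move=> cK uh; have [r0 r00 hr0] := uh 1 ltr01.
have [x Kx|M M0 hM] := @compact_uniform K (fun r z => `|h z| <= r^-1) cK.
  exists (Num.min r0 (`|h x| + 1)^-1); first by rewrite lt_min r00 invr_gt0 ltr_wpDl.
  move=> y r' Ky; rewrite lt_min => /andP[xy _] r'0; rewrite lt_min => /andP[_ r'x].
  apply: ltW; apply: (@lt_trans _ _ (`|h x| + 1)).
    rewrite -[h y](subrK (h x)) addrC; apply: le_lt_trans (ler_normD _ _) _.
    by rewrite ltrD2l distrC; exact: hr0.
  by rewrite -[ltLHS]invrK ltf_pV2 // posrE ?invr_gt0 ?ltr_wpDl.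
by exists M^-1 => //; rewrite invr_ge0 ltW.
Qed.

Lemma uc_gt0 (K A : set Y) (h : Y -> R) : compact A -> A `<=` K -> uc K h ->
  (forall z, A z -> 0 < h z) -> exists2 e : R, 0 < e & forall z, A z -> e <= h z.
Proof.
move=> cA AK uh h0; apply: compact_uniform => // x Ax.
have hx2 : 0 < h x / 2 by rewrite divr_gt0 // h0.
have [r r00 hr] := uh _ hx2.
exists (Num.min r (h x / 2)); first by rewrite lt_min r00.
move=> y r' Ay; rewrite lt_min => /andP[xy _] r'0; rewrite lt_min => /andP[_ r'x].
by have := hr x y (AK x Ax) (AK y Ay) xy; rewrite ltr_norml => /andP[]; lra.
Qed.

End Compactness.

Section Contraction.
Variables (R : realType) (Z : system R).
Local Notation Y := (space Z).
Local Notation X := (maps Z).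
Variables (n : nat) (I : Type) (U : I -> set Y) (Q : set Y) (c : R).
Hypotheses (n0 : (0 < n)%N) (oU : forall j, open (U j)).
Hypotheses (cQ : compact Q) (QU : Q `<=` \bigcup_j U j) (c01 : 0 < c < 1).
Hypothesis UQ : forall s : seq X, word s -> size s = n ->
  forall z, (\bigcup_j U j) z -> Q (run s z).
Hypothesis Uc : forall s : seq X, word s -> size s = n ->
  forall j x y, U j x -> U j y -> dist (run s x) (run s y) <= c * dist x y.

Variable K : set Y.
Hypothesis cK : compact K.
Hypothesis iK : forall g x, supp g -> K x -> K (act g x).
Implicit Types (x y z : Y) (s t : seq X).

(** Unlike [Q], the set of these points is forward invariant. *)
Definition trapped z : Prop :=
  K z /\ exists2 j, (j < n)%N & forall s, word s -> size s = j -> Q (run s z).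

Lemma trapped_inv g z : supp g -> trapped z -> trapped (act g z).
Proof.
move=> sg [Kz [j jn hj]]; split; first exact: iK.
case: j jn hj => [|j] jn hj.
  exists n.-1; first by rewrite prednK.
  move=> s ws ss; apply: (UQ (s := g :: s)).
  - exact/word_cons.
  - by rewrite /= ss prednK.
  - by apply: QU; exact: (hj [::]).
exists j; first exact: ltnW.
by move=> s ws ss; apply: (hj (g :: s)); [exact/word_cons|rewrite /= ss].
Qed.

Lemma trapped_run s z : word s -> trapped z -> trapped (run s z).
Proof.
elim: s z => [//|g s IH] z /word_cons[sg ws] tz; apply: IH => //.
exact: trapped_inv.
Qed.

Lemma trapped_Q z : K z -> Q z -> trapped z.
Proof. by move=> Kz Qz; split=> //; exists 0%N => // s _ /size0nil ->. Qed.

Variable L : R.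
Hypothesis L1 : 1 <= L.
Hypothesis hL : forall g x y, supp g -> K x -> K y ->
  dist (act g x) (act g y) <= L * dist x y.

Lemma run_lip s x y : word s -> K x -> K y ->
  dist (run s x) (run s y) <= L ^+ size s * dist x y.
Proof.
elim: s x y => [|g s IH] x y; first by rewrite expr0 mul1r.
move=> /word_cons[sg ws] Kx Ky; apply: le_trans (IH _ _ ws _ _) _.
- exact: iK.
- exact: iK.
by rewrite /= exprSr -mulrA ler_wpM2l ?hL // exprn_ge0 // (le_trans ler01).
Qed.

Lemma run_lip_le k s x y : word s -> (size s <= k)%N -> K x -> K y ->
  dist (run s x) (run s y) <= L ^+ k * dist x y.
Proof.
move=> ws sk Kx Ky; apply: le_trans (run_lip ws Kx Ky) _.
by rewrite ler_wpM2r ?dist_ge0 // ler_weXn2l.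
Qed.

(** Every [n] letters the two points are back in [Q] and closer to each other
    than a Lebesgue number of the covering, hence in one of the sets [U j]. *)
Lemma Q_contraction (r : R) :
  (forall x y, Q x -> K x -> Q y -> K y -> dist x y < r ->
     exists j, U j x /\ U j y) ->
  forall s x y, word s -> Q x -> K x -> Q y -> K y -> dist x y < r ->
  dist (run s x) (run s y) <= L ^+ n * c ^+ (size s %/ n) * dist x y.
Proof.
case/andP: c01 => c0 c1 hr s; have [k] := ubnP (size s).
elim: k s => // k IH s; rewrite ltnS => sk x y ws Qx Kx Qy Ky xy.
have [sn|ns] := ltnP (size s) n.
  by rewrite divn_small // expr0 mulr1; apply: run_lip_le => //; exact: ltnW.
have : word (take n s ++ drop n s) by rewrite cat_take_drop.
move=> /word_cat[w1 w2]; rewrite -{1 2}(cat_take_drop n s) !run_cat.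
have st : size (take n s) = n by rewrite size_take_min; exact/minn_idPl.
have [j [Ux Uy]] := hr x y Qx Kx Qy Ky xy.
have d1 := Uc w1 st Ux Uy.
have d2 : dist (run (take n s) x) (run (take n s) y) < r.
  by apply: le_lt_trans d1 (le_lt_trans _ xy); rewrite ler_piMl ?dist_ge0 // ltW.
have sd : (size (drop n s) < k)%N.
  by rewrite size_drop (leq_trans _ sk) // ltn_subrL n0 (leq_trans n0 ns).
apply: le_trans (IH _ sd _ _ w2 _ _ _ _ d2) _.
- by apply: UQ => //; apply: QU.
- exact: run_inv.
- by apply: UQ => //; apply: QU.
- exact: run_inv.
rewrite size_drop -[in leRHS](subnK ns) divnDr // divnn n0 addn1 exprSr.
rewrite -!mulrA ler_wpM2l ?exprn_ge0 ?(le_trans ler01) //.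
by rewrite ler_wpM2l // exprn_ge0 // ltW.
Qed.

(** Within [2 * n] letters, which cost a bounded factor, points near a trapped
    one are carried into [Q]; there [Q_contraction] applies. *)
Lemma contraction : exists e C : R, exists M : nat,
  [/\ 0 < e, 1 <= C, (0 < M)%N & forall x0 x y, trapped x0 -> K x -> K y ->
    dist x0 x < e -> dist x0 y < e -> forall q s, word s -> (q * M <= size s)%N ->
    dist (run s x) (run s y) <= C * 2^-1 ^+ q * dist x y].
Proof.
case/andP: (c01) => c0 c1; have L0 : 0 < L by exact: lt_le_trans L1.
have Lk k : 1 <= L ^+ k by exact: exprn_ege1.
have cKQ : compact (K `|` Q) by exact: compactU.
have QKQ : Q `<=` K `|` Q by move=> q; right.
have [r r0 hr] := lebesgue_number cKQ cQ QKQ oU QU.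
have [p p2 cp] : exists2 p, (1 < p)%N & c ^+ p <= 2^-1.
  have /cvgrPdist_lt : c ^+ k @[k --> \oo] --> 0.
    by apply: cvg_expr; rewrite ger0_norm // ltW.
  move=> /(_ 2^-1) [|p0 _ hp]; first by rewrite invr_gt0.
  exists p0.+2 => //; have := hp p0.+2; rewrite /= sub0r normrN => h.
  by apply: le_trans (ler_norm _) (ltW (h _)); rewrite !leqW.
pose e := r / (2 * L ^+ (n + n)).
have e0 : 0 < e by rewrite divr_gt0 // mulr_gt0 // exprn_gt0.
have eE : L ^+ (n + n) * e = r / 2.
  have P0 : L ^+ (n + n) != 0 by rewrite lt0r_neq0 // exprn_gt0.
  by rewrite /e; move: (L ^+ (n + n)) P0 => P P0; field.
pose M := (n * p)%N; pose C := L ^+ (n + (n + n)) / c ^+ 2.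
have C1 : L ^+ (n + n) <= C.
  rewrite /C ler_pdivlMr ?exprn_gt0 // mulrC (exprD L n (n + n)) ler_pM ?exprn_ge0 ?(ltW c0) ?(ltW L0) //.
  by apply: le_trans (Lk n); rewrite exprn_ile1 // ltW.
exists e, C, M; split=> //; first exact: le_trans C1.
  by rewrite muln_gt0 n0 ltnW.
move=> x0 x y [Kx0 [j jn hj]] Kx Ky x0x x0y q s ws qs.
have dxy : dist x y < 2 * e.
  apply: (@dist_lt_tri _ _ x x0 y e e); rewrite // ?(distC x x0) //.
  by rewrite mulrDl mul1r.
have [sj|js] := ltnP (size s) (j + n).
  have q0 : q = 0%N.
    case: q qs => // q; rewrite mulSn => /(leq_trans (leq_addr _ _)) Ms.
    have := leq_ltn_trans (leq_trans (leq_mul (leqnn n) p2) Ms) sj.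
    by rewrite muln2 -addnn ltn_add2r ltnNge (ltnW jn).
  rewrite q0 expr0 mulr1; apply: le_trans (run_lip_le ws (k := n + n) _ Kx Ky) _.
    by rewrite (leq_trans (ltnW sj)) // leq_add2r ltnW.
  by rewrite ler_wpM2r ?dist_ge0.
have : word (take (j + n) s ++ drop (j + n) s) by rewrite cat_take_drop.
move=> /word_cat[w12 w3].
have st : size (take (j + n) s) = (j + n)%N by rewrite size_take_min; exact/minn_idPl.
have toQ z : K z -> dist x0 z < e -> Q (run (take (j + n) s) z).
  move=> Kz x0z; have : word (take j s ++ take n (drop j s)).
    by rewrite -takeD.
  rewrite takeD run_cat => /word_cat[w1 w2].
  have s1 : size (take j s) = j.
    by rewrite size_take_min; apply/minn_idPl; exact: leq_trans (leq_addr _ _) js.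
  have s2 : size (take n (drop j s)) = n.
    by rewrite size_take_min size_drop; apply/minn_idPl; rewrite leq_subRL ?(leq_trans (leq_addr n j) js).
  apply: UQ => //.
  have AK : (K `|` Q) (run (take j s) z) by left; exact: run_inv.
  have dr : dist (run (take j s) x0) (run (take j s) z) < r.
    apply: le_lt_trans (run_lip_le w1 (k := n + n) _ Kx0 Kz) _.
      by rewrite s1 (leq_trans (ltnW jn)) // leq_addr.
    apply: (@lt_le_trans _ _ (L ^+ (n + n) * e)).
      by rewrite ltr_pM2l // exprn_gt0.
    by rewrite eE; lra.
  by have [i [_ Ui]] := hr _ _ (hj _ w1 s1) AK dr; exists i.
have Qx := toQ x Kx x0x; have Qy := toQ y Ky x0y.
have Kx' := run_inv iK w12 Kx; have Ky' := run_inv iK w12 Ky.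
have d1 : dist (run (take (j + n) s) x) (run (take (j + n) s) y)
    <= L ^+ (n + n) * dist x y.
  by apply: run_lip_le => //; rewrite st leq_add2r ltnW.
have d2 : dist (run (take (j + n) s) x) (run (take (j + n) s) y) < r.
  apply: le_lt_trans d1 _; apply: (@lt_le_trans _ _ (L ^+ (n + n) * (2 * e))).
    by rewrite ltr_pM2l // exprn_gt0.
  by rewrite mulrCA eE; lra.
rewrite -{1 2}(cat_take_drop (j + n) s) !run_cat.
have hr' u v : Q u -> K u -> Q v -> K v -> dist u v < r -> exists i, U i u /\ U i v.
  by move=> Qu _ Qv Kv uv; apply: hr => //; left.
apply: le_trans (Q_contraction hr' w3 Qx Kx' Qy Ky' d2) _.
have c2 : c ^+ (size (drop (j + n) s) %/ n) <= 2^-1 ^+ q / c ^+ 2.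
  rewrite ler_pdivlMr ?exprn_gt0 // -exprD.
  apply: (@le_trans _ _ (c ^+ (p * q))).
    rewrite ler_wiXn2l // ?ltW // size_drop.
    have h : (p * q * n <= size s)%N by rewrite (mulnC p) -mulnA (mulnC p).
    have : (p * q - 2 <= (size s - (j + n)) %/ n)%N.
      rewrite leq_divRL // mulnBl leq_sub // mul2n -addnn leq_add2r.
      exact: ltnW.
    by rewrite leq_subLR addnC.
  by rewrite exprM lerXn2r ?nnegrE ?exprn_ge0 ?invr_ge0 // ltW.
apply: le_trans (_ : _ <= L ^+ n * (2^-1 ^+ q / c ^+ 2) * (L ^+ (n + n) * dist x y)) _.
  by rewrite ler_pM ?mulr_ge0 ?exprn_ge0 ?dist_ge0 ?(ltW c0) ?(ltW L0) // ler_wpM2l ?exprn_ge0 ?(ltW L0).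
rewrite /C (exprD L n (n + n)) le_eqVlt; apply/orP; left; apply/eqP.
by move: (L ^+ n) (L ^+ (n + n)) (2^-1 ^+ q) ((c ^+ 2)^-1) => u v a b; ring.
Qed.

End Contraction.

(** * Minimal sets *)

Section MinimalSets.
Variables (R : realType) (Z : system R).
Local Notation Y := (space Z).
Local Notation X := (maps Z).
Implicit Types (x y z : Y) (s t : seq X) (K L : set Y).

Definition orbit z : set Y := [set y | exists s : seq X,
  [/\ word s, (0 < size s)%N & y = run s z]].

Definition minimal L : Prop :=
  [/\ L !=set0, compact L & forall z, L z -> L = closure (orbit z)].

Lemma minimal_run L s z : minimal L -> L z -> word s -> L (run s z).
Proof.
move=> [_ _ h] Lz ws; case: s ws => [//|g s] ws.
rewrite (h z Lz); apply: subset_closure.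
by exists (g :: s).
Qed.

(** The tail of an orbit in a minimal set is again an orbit in it, hence
    dense. *)
Lemma minimal_dense L z w (e : R) k : minimal L -> L z -> L w -> 0 < e ->
  exists s : seq X, [/\ word s, (k < size s)%N & dist w (run s z) < e].
Proof.
move=> mL Lz Lw e0; have [u wu su] := exists_word Z k.
have Lu := minimal_run mL Lz wu.
move: (mL) => [_ _ h]; move: Lw; rewrite (h _ Lu) => cw.
have [y [s [ws s0 ->]] yw] := closure_dist cw e0.
exists (u ++ s); split; first exact/word_cat.
  by rewrite size_cat su -addn1 leq_add2l.
by rewrite run_cat.
Qed.

Lemma minimal_closed L : minimal L -> closed L.
Proof. by move=> [_ cL _]; apply: compact_closed => //; exact: space_hausdorff. Qed.

Lemma minimal_eq L L' z : minimal L -> minimal L' -> L z -> L' z -> L = L'.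
Proof. by move=> [_ _ h] [_ _ h'] Lz Lz'; rewrite (h z Lz) (h' z Lz'). Qed.

Lemma minimal_inv L : minimal L -> forall g x, supp g -> L x -> L (act g x).
Proof.
by move=> mL g x sg Lx; apply: (minimal_run (s := [:: g])) => //; apply/word_cons.
Qed.

Lemma orbit_closure_inv K x : compact K ->
  (forall g y, supp g -> K y -> K (act g y)) -> K x ->
  forall g y, supp g -> closure (orbit x) y -> closure (orbit x) (act g y).
Proof.
move=> cK iK Kx g y sg cy.
have oK : orbit x `<=` K by move=> _ [s [ws _ ->]]; exact: run_inv.
have clK : closed K by apply: compact_closed => //; exact: space_hausdorff.
have Ky : K y by rewrite ((closure_id K).1 clK); exact: (closureS oK cy).
have [L L1 hL] := act_lip cK; have L0 : 0 < L by exact: lt_le_trans L1.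
apply: (dist_closure cK oK); first exact: iK.
move=> e e0; have [|_ [s [ws s0 ->]] ys] := closure_dist cy (e := e / L).
  by rewrite divr_gt0.
exists (run (rcons s g) x).
  exists (rcons s g); rewrite size_rcons; split=> //.
  by rewrite -cats1; apply/word_cat; split=> //; apply/word_cons.
rewrite -cats1 run_cat; apply: le_lt_trans (hL _ _ _ sg Ky _) _.
  exact: run_inv.
by rewrite mulrC -ltr_pdivlMr.
Qed.

(** Zorn's lemma is applied to the complements in [K] of the invariant compact
    subsets: the intersection of a chain of those is not empty. *)
Lemma exists_minimal K : compact K -> K !=set0 ->
  (forall g y, supp g -> K y -> K (act g y)) ->
  exists L, minimal L /\ L `<=` K.
Proof.
move=> cK [z0 Kz0] iK.
have clK : closed K by apply: compact_closed => //; exact: space_hausdorff.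
pose P (V : set Y) := [/\ K `\` V !=set0, closed (K `\` V) &
  forall g y, supp g -> (K `\` V) y -> (K `\` V) (act g y)].
have [|A [[[x [Kx nAx]] clA iA] maxA]] := @Zorn_bigcup _ P.
  move=> F FP tot.
  have E : K `\` \bigcup_(V in F) V = [set y | K y /\ forall V, F V -> (K `\` V) y].
    apply/seteqP; split=> y /= [Ky h]; split=> //.
      by move=> V FV; split=> // Vy; apply: h; exists V.
    by move=> [V FV Vy]; have [_] := h V FV.
  split; last 2 first.
  - rewrite E => y cy; split=> [|V FV].
      by rewrite ((closure_id K).1 clK); apply: closureS cy => ? [].
    have [_ cV _] := FP V FV; rewrite ((closure_id _).1 cV).
    by apply: closureS cy => u [_ /(_ V FV)].
  - rewrite E => g y sg [Ky h]; split=> [|V FV]; first exact: iK.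
    by have [_ _ iV] := FP V FV; apply: iV => //; exact: h.
  have [[V0 FV0]|F0] := pselect (F !=set0); last first.
    by exists z0; rewrite E; split=> // V FV; case: F0; exists V.
  pose G := filter_from F (fun V => K `\` V).
  have PG : ProperFilter G.
    apply: filter_from_proper; last by move=> V /FP[].
    apply: filter_from_filter; first by exists V0.
    move=> V W FV FW; have [VW|WV] := tot V W FV FW.
      by exists W => // y [Ky nW]; split; split=> // /VW.
    by exists V => // y [Ky nV]; split; split=> // /WV.
  have GK : G K by exists V0 => // y [].
  have [y [Ky cy]] := cK G PG GK.
  exists y; rewrite E; split=> // V FV; have [_ cV _] := FP V FV.
  rewrite ((closure_id _).1 cV) => B nB; apply: cy => //; by exists V.
exists (K `\` A); split; last by move=> y [].
split; [by exists x|exact: subclosed_compact (clA) cK _|].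
move=> z [Kz nAz].
have oA : orbit z `<=` K `\` A.
  by move=> _ [s [ws _ ->]]; exact: (run_inv iA).
have cA : closure (orbit z) `<=` K `\` A.
  by rewrite [X in _ `<=` X](closure_id _).1 //; exact: closureS.
apply/seteqP; split=> // y [Ky nAy]; apply: contrapT => ny.
apply: (maxA (A `|` ~` closure (orbit z))).
  split; first by move=> ?; left.
  by move=> /(_ y) h; apply: nAy; apply: h; right.
have E : K `\` (A `|` ~` closure (orbit z)) = closure (orbit z).
  apply/seteqP; split=> w.
    by move=> [Kw /not_orP[_ /contrapT]].
  by move=> cw; have [Kw nAw] := cA w cw; split=> // -[].
rewrite /P E; split; [|exact: closed_closure|exact: (orbit_closure_inv cK iK Kz)].
have [u wu su] := exists_word Z 1.
by exists (run u z); apply: subset_closure; exists u; rewrite su.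
Qed.

Lemma orbit_minimal K z : compact K ->
  (forall g y, supp g -> K y -> K (act g y)) -> K z ->
  exists L, [/\ minimal L, L `<=` K & L `<=` closure (orbit z)].
Proof.
move=> cK iK Kz; have oK : orbit z `<=` K by move=> _ [s [ws _ ->]]; exact: run_inv.
have clK : closed K by apply: compact_closed => //; exact: space_hausdorff.
have cO : closure (orbit z) `<=` K.
  by rewrite [X in _ `<=` X]((closure_id K).1 clK); exact: closureS.
have [u wu su] := exists_word Z 1.
have [||L [mL LO]] := exists_minimal (subclosed_compact (@closed_closure _ (orbit z)) cK cO).
- by exists (run u z); apply: subset_closure; exists u; rewrite su.
- exact: (orbit_closure_inv cK iK Kz).
by exists L; split=> //; exact: subset_trans cO.
Qed.

Lemma compact_meet (A B : set Y) : compact A -> compact B ->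
  (forall e : R, 0 < e -> exists x y, [/\ A x, B y & dist x y < e]) ->
  A `&` B !=set0.
Proof.
move=> cA cB h; apply: contrapT => AB.
have [x Ax|r r0 hr] := @compact_uniform _ Z A (fun r x => forall y, B y -> r <= dist x y) cA.
  have nBx : ~ B x by move=> Bx; apply: AB; exists x.
  have oB : open (~` B).
    by apply: closed_openC; apply: compact_closed => //; exact: space_hausdorff.
  have [r r0 hr] := open_ball_sub cB oB nBx.
  have r2 : 0 < r / 2 by rewrite divr_gt0.
  exists (r / 2) => // x' r' Ax' xx' r'0 r'r y By.
  rewrite leNgt; apply/negP => x'y; apply: (hr y By) => //.
  apply: (dist_lt_tri _ xx' x'y); lra.
by have [x [y [Ax By]]] := h r r0; rewrite ltNge hr.
Qed.

(** Lists of points, ordered by inclusion, form a filter; so by compactness the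
    lists that serve one point each can be merged into a single one. *)
Lemma compact_net (A : set Y) (r : R) : compact A -> 0 < r ->
  exists s : seq Y, forall x, A x -> exists2 y, y \in s & dist y x < r.
Proof.
move=> cA r0.
pose G (B : set (seq Y)) := exists s0 : seq Y, forall s : seq Y, {subset s0 <= s} -> B s.
have FG : Filter G.
  split; first by exists [::].
    move=> B C [s hs] [t ht]; exists (s ++ t) => u su.
    split; [apply: hs|apply: ht] => y ys; apply: su; rewrite mem_cat ys //.
    by rewrite orbT.
  by move=> B C BC [s hs]; exists s => u /hs; exact: BC.
pose P (u : seq Y) (x : Y) := exists2 y, y \in u & dist y x < r.
have nc : near_covering A by exact/compact_near_coveringP.
have [x Ax|s0 hs] := nc _ G P FG.
  exists ([set x' | dist x x' < r], [set u : seq Y | x \in u]).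
    split; first exact: near_dist.
    by exists [:: x] => u; apply; rewrite mem_head.
  by move=> [x' s] [/= xx' xs]; exists x.
by exists s0 => x Ax; exact: hs.
Qed.

End MinimalSets.

(** * Mean stability and the finiteness of the minimal sets *)

(** Mean stability, as data. *)
Record contracting (R : realType) (Z : system R) := Contracting {
  cn : nat;
  cI : Type;
  cU : cI -> set (space Z);
  cQ : set (space Z);
  cc : R;
  cn_gt0 : (0 < cn)%N;
  cU_open : forall j, open (cU j);
  cQ_compact : compact cQ;
  cQ_sub : cQ `<=` \bigcup_j cU j;
  cc_itv : 0 < cc < 1;
  cU_run : forall s : seq (maps Z), word s -> size s = cn ->
    forall z, (\bigcup_j cU j) z -> cQ (run s z);
  cU_contract : forall s : seq (maps Z), word s -> size s = cn ->
    forall j x y, cU j x -> cU j y -> dist (run s x) (run s y) <= cc * dist x y;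
  cU_reach : forall z, exists s : seq (maps Z),
    [/\ word s, (0 < size s)%N & (\bigcup_j cU j) (run s z)] }.

Section ContractingMinimal.
Variables (R : realType) (Z : system R) (st : contracting Z).
Local Notation Y := (space Z).
Local Notation X := (maps Z).
Implicit Types (x y z : Y) (s t : seq X) (K L : set Y).

Lemma minimal_meets_Q L : @minimal R Z L -> exists2 q, L q & cQ st q.
Proof.
move=> mL; have [[z Lz] _ _] := mL.
have [s [ws _ Us]] := cU_reach st z.
have [t wt et] := exists_word Z (cn st).
exists (run t (run s z)); last exact: cU_run.
by apply: minimal_run => //; exact: minimal_run.
Qed.

(** A minimal set contains a point of [cQ], which is trapped, and the orbit of
    this point is dense in it. *)
Lemma minimal_near_trapped K L w (e : R) : minimal L -> L `<=` K -> L w ->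
  (forall g x, supp g -> K x -> K (act g x)) -> 0 < e ->
  exists2 x, trapped (cn st) (cQ st) K x & dist w x < e.
Proof.
move=> mL LK Lw iK e0; have [q Lq Qq] := minimal_meets_Q mL.
have [s [ws _ ds]] := minimal_dense 0 mL Lq Lw e0; exists (run s q) => //.
apply: (trapped_run (@cQ_sub _ _ st) (@cU_run _ _ st) iK ws).
by apply: (trapped_Q (cn_gt0 st)) => //; exact: LK.
Qed.

Lemma contraction_minimal K : compact K ->
  (forall g x, supp g -> K x -> K (act g x)) ->
  exists e C : R, exists M : nat, [/\ 0 < e, 1 <= C, (0 < M)%N &
    forall L x0 x y, minimal L -> L `<=` K -> L x0 -> K x -> K y ->
    dist x0 x < e -> dist x0 y < e ->
    forall q s, word s -> (q * M <= size s)%N ->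
    dist (run s x) (run s y) <= C * 2^-1 ^+ q * dist x y].
Proof.
move=> cK iK; have [l l1 hl] := act_lip cK.
have [e [C [M [e0 C1 M0 h]]]] := contraction (cn_gt0 st) (@cU_open _ _ st)
  (@cQ_compact _ _ st) (@cQ_sub _ _ st) (cc_itv st) (@cU_run _ _ st)
  (@cU_contract _ _ st) cK iK l1 hl.
have e2 : 0 < e / 2 by rewrite divr_gt0.
exists (e / 2), C, M; split=> // L x0 x y mL LK Lx0 Kx Ky x0x x0y q s ws qs.
have [x1 t1 d1] := minimal_near_trapped mL LK Lx0 iK e2.
rewrite distC in d1.
apply: (h x1) => //.
- by apply: (dist_lt_tri _ d1 x0x); rewrite -splitr.
- by apply: (dist_lt_tri _ d1 x0y); rewrite -splitr.
Qed.

(** Two minimal sets that come close to each other inside [cQ] meet, because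
    words contract; so each of them owns a point of a finite net of [cQ]. *)
Lemma minimal_finite : finite_set (@minimal R Z).
Proof.
have /andP[c0 c1] := cc_itv st.
have [r r0 hr] := lebesgue_number (@cQ_compact _ _ st) (@cQ_compact _ _ st)
  (@subset_refl _ _) (@cU_open _ _ st) (@cQ_sub _ _ st).
have close L L' x y : minimal L -> minimal L' -> L x -> L' y ->
    cQ st x -> cQ st y -> dist x y < r -> L = L'.
  move=> mL mL' Lx Ly Qx Qy xy.
  have itr k : exists x' y', [/\ L x', L' y', cQ st x', cQ st y' &
      dist x' y' <= cc st ^+ k * dist x y].
    elim: k => [|k [x' [y' [Lx' Ly' Qx' Qy' d]]]].
      by exists x, y; rewrite expr0 mul1r.
    have d' : dist x' y' < r.
      apply: le_lt_trans (le_trans d _) xy.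
      by rewrite ler_piMl ?dist_ge0 // exprn_ile1 // ltW.
    have [j [Ux Uy]] := hr x' y' Qx' Qy' d'.
    have [s ws ss] := exists_word Z (cn st).
    exists (run s x'), (run s y'); split.
    - exact: minimal_run.
    - exact: minimal_run.
    - by apply: cU_run => //; exact: cQ_sub.
    - by apply: cU_run => //; exact: cQ_sub.
    apply: le_trans (cU_contract ws ss Ux Uy) _.
    by rewrite exprS -mulrA ler_pM2l.
  have [_ cL _] := mL; have [_ cL' _] := mL'.
  have [|w [Lw Lw']] := compact_meet cL cL'; last exact: minimal_eq mL mL' Lw Lw'.
  move=> e e0; have e2 : 0 < e / 2 by rewrite divr_gt0.
  have /cvgrPdist_lt/(_ (e / 2) e2) [k0 _ hk] : cc st ^+ k @[k --> \oo] --> 0.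
    by apply: cvg_expr; rewrite ger0_norm // ltW.
  have [x' [y' [Lx' Ly' _ _ d]]] := itr k0; exists x', y'; split=> //.
  have := hk k0 (leqnn k0); rewrite /= sub0r normrN ger0_norm ?exprn_ge0 ?(ltW c0) // => ck.
  apply: le_lt_trans d _; have := dist_le2 x y; have := dist_ge0 x y.
  have : 0 <= cc st ^+ k0 by rewrite exprn_ge0 // ltW.
  by move: (cc st ^+ k0) ck (dist x y) => u hu v; nra.
have r2 : 0 < r / 2 by rewrite divr_gt0.
have [u hu] := compact_net (@cQ_compact _ _ st) r2.
have [y0|/forallNP noY] := pselect (exists y : Y, True); last first.
  rewrite (_ : @minimal R Z = set0) //; apply/seteqP; split=> // L [[z _] _ _].
  by case: (noY z).
case: y0 => y0 _.
pose own i L := minimal L /\ exists2 x, L x & cQ st x /\ dist (nth y0 u i) x < r / 2.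
pose f i := xget set0 (own i).
apply: (@sub_finite_set _ _ (f @` `I_(size u))); last first.
  exact/finite_image/finite_II.
move=> L mL; have [q Lq Qq] := minimal_meets_Q mL.
have [y yu yq] := hu q Qq; exists (index y u); first by rewrite /= index_mem.
rewrite /f; case: xgetP => [L' _ [mL' [x Lx [Qx dx]]]|/(_ L) no]; last first.
  by case: no; split=> //; exists q; rewrite // nth_index.
apply: (close _ _ x q) => //; rewrite nth_index // in dx.
rewrite distC in dx; apply: (dist_lt_tri _ dx yq); by rewrite -splitr.
Qed.

End ContractingMinimal.

(** * Absorption by the minimal sets *)

Section Absorption.
Variables (R : realType) (Z : system R).
Local Notation Y := (space Z).
Local Notation X := (maps Z).
Local Notation T := (@averaging R Z).
Variable K : set Y.
Hypothesis cK : compact K.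
Hypothesis iK : forall g x, supp g -> K x -> K (act g x).
Implicit Types (x y z : Y) (s t : seq X).

(** All orbits in [K] are absorbed by this set, with an exponentially small
    probability of being late: see [barrier_decay_iter]. *)
Definition recurrent : set Y :=
  [set x | exists L, [/\ minimal L, L `<=` K & L x]].

Lemma recurrent_sub : recurrent `<=` K.
Proof. by move=> x [L [_ LK Lx]]; exact: LK. Qed.

Lemma recurrent_run s x : word s -> recurrent x -> recurrent (run s x).
Proof.
by move=> ws [L [mL LK Lx]]; exists L; split=> //; exact: minimal_run.
Qed.

Definition depth z : R := inf [set dist z x | x in recurrent].

Lemma depth_le z x : recurrent x -> depth z <= dist z x.
Proof.
move=> rx; apply: ge_inf; last by exists x.
by exists 0 => _ [y _ <-]; exact: dist_ge0.
Qed.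

Lemma recurrent_reach z (e : R) : K z -> 0 < e -> exists x s,
  [/\ recurrent x, word s & dist x (run s z) < e].
Proof.
move=> Kz e0; have [L [mL LK LO]] := orbit_minimal cK iK Kz; have [[x Lx] _ _] := mL.
have [_ [s [ws _ ->]] xs] := closure_dist (LO _ Lx) e0.
by exists x, s; split=> //; exists L.
Qed.

Hypothesis K0 : K !=set0.

Lemma recurrent_nonempty : recurrent !=set0.
Proof.
have [z Kz] := K0.
by have [x [s [rx _ _]]] := recurrent_reach Kz ltr01; exists x.
Qed.

Lemma depth_has_inf z : has_inf [set dist z x | x in recurrent].
Proof.
have [x rx] := recurrent_nonempty; split; first by exists (dist z x), x.
by exists 0 => _ [y _ <-]; exact: dist_ge0.
Qed.

Lemma depth_lt z (a : R) : depth z < a -> exists2 x, recurrent x & dist z x < a.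
Proof.
move=> da; have [_ [x rx <-] h] := inf_lt (depth_has_inf z).1 da.
by exists x.
Qed.

Lemma depth_ge0 z : 0 <= depth z.
Proof.
have [[d [x rx _]] _] := depth_has_inf z.
rewrite leNgt; apply/negP => /depth_lt [y _]; apply/negP.
by rewrite -leNgt dist_ge0.
Qed.

Lemma depth_lip x y : depth x - depth y <= dist x y.
Proof.
rewrite leNgt; apply/negP => h; have : depth y < depth x - dist x y by lra.
move=> /depth_lt [z rz]; have := depth_le x rz; have := dist_tri x y z; lra.
Qed.

Variables (e C : R) (M : nat).
Hypotheses (e0 : 0 < e) (C1 : 1 <= C).
Hypothesis hC : forall L x0 x y, minimal L -> L `<=` K -> L x0 -> K x -> K y ->
    dist x0 x < e -> dist x0 y < e ->
    forall q s, word s -> (q * M <= size s)%N ->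
    dist (run s x) (run s y) <= C * 2^-1 ^+ q * dist x y.

(** A Lyapunov function for the approach to the recurrent points; the
    truncation at 1 makes it comparable with probabilities. *)
Definition barrier z : R := Num.min 1 (depth z / e).

Lemma barrier_ge0 z : 0 <= barrier z.
Proof. by rewrite le_min ler01 divr_ge0 ?depth_ge0 // ltW. Qed.

Lemma barrier_le1 z : barrier z <= 1.
Proof. by rewrite ge_min lexx. Qed.

Lemma barrier_lt (a : R) z : a <= 1 -> barrier z < a -> depth z < a * e.
Proof.
by move=> a1; rewrite gt_min ltNge a1 /= ltr_pdivrMr.
Qed.

Lemma barrier_le z : barrier z <= depth z / e.
Proof. by rewrite ge_min lexx orbT. Qed.

Lemma barrier_near z : depth z < e -> barrier z = depth z / e.
Proof. by move=> ze; apply/min_idPr; rewrite ler_pdivrMr // mul1r ltW. Qed.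

Lemma barrier_far z : e <= depth z -> barrier z = 1.
Proof. by move=> ze; apply/min_idPl; rewrite ler_pdivlMr // mul1r. Qed.

Lemma barrier_uc : uc K barrier.
Proof.
apply: (@uc_lip _ _ _ _ e^-1) => x y _ _.
wlog : x y / barrier y <= barrier x.
  move=> H; have [/H//|/ltW/H] := leP (barrier y) (barrier x).
  by rewrite distrC distC.
move=> yx; rewrite ger0_norm ?subr_ge0 // mulrC.
have h : depth x / e <= depth y / e + dist x y / e.
  by rewrite -mulrDl ler_pM2r ?invr_gt0 //; have := depth_lip x y; lra.
have d0 : 0 <= dist x y / e by rewrite divr_ge0 ?dist_ge0 // ltW.
by rewrite /barrier !minEle; do 2 case: ifP => ?; lra.
Qed.

(** Images of recurrent points are recurrent, so that words which contract
    towards such a point reduce the depth. *)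
Lemma depth_contract z q s : K z -> depth z < e -> word s -> (q * M <= size s)%N ->
  depth (run s z) <= C * 2^-1 ^+ q * depth z.
Proof.
move=> Kz ze ws qs; rewrite leNgt; apply/negP => h.
pose k := C * 2^-1 ^+ q; have k0 : 0 < k.
  by rewrite mulr_gt0 ?exprn_gt0 ?invr_gt0 // (lt_le_trans ltr01).
have : depth z < Num.min e (depth (run s z) / k).
  by rewrite lt_min ze ltr_pdivlMr // mulrC.
move=> /depth_lt [x [L [mL LK Lx]]]; rewrite lt_min ltr_pdivlMr // => /andP[xe].
have Kx : K x by exact: LK.
have := hC mL LK Lx Kz Kx _ _ ws qs; rewrite distxx (distC x z) => /(_ xe e0) le.
have rx : recurrent (run s x) by exists L; split=> //; exact: minimal_run.
rewrite mulrC ltNge; apply/negP; rewrite negbK.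
exact: le_trans (depth_le _ rx) le.
Qed.

Lemma half_le (C' : R) : exists q, C' * 2^-1 ^+ q <= 2^-1.
Proof.
have [q hq] : exists q : nat, 2 * C' <= q%:R.
  by exists (Num.truncn (2 * C')).+1; exact/ltW/truncnS_gt.
exists q; have : q%:R <= 2 ^+ q :> R by rewrite -natrX ler_nat ltnW // ltn_expl.
have p0 : 0 < 2 ^+ q :> R by rewrite exprn_gt0.
by rewrite exprVn ler_pdivrMr //; lra.
Qed.

(** [barrier] dominates, up to a factor below 1, its average after some number
    of steps: near the recurrent points because words contract, elsewhere
    because some word leads to the recurrent points. *)
Lemma barrier_decay : exists k (rho : R), 0 < rho < 1 /\
  forall z, K z -> iter k T barrier z <= rho * barrier z.
Proof.
have C0 : 0 < C by exact: lt_le_trans C1.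
have [q1 hq1] := half_le C.
have near k z : K z -> (q1 * M <= k)%N -> depth z < e ->
    iter k T barrier z <= 2^-1 * barrier z.
  move=> Kz qk ze.
  rewrite -[leRHS](@iter_T_cst _ Z k _ z); apply: (iter_T_le cK iK) => //.
  - exact: barrier_uc.
  - exact: uc_cst.
  move=> s ws ss; apply: le_trans (barrier_le _) _; rewrite barrier_near // mulrA.
  rewrite ler_pM2r ?invr_gt0 //; have := depth_contract Kz ze ws; rewrite ss.
  by move=> /(_ _ qk) /le_trans; apply; rewrite ler_wpM2r ?depth_ge0.
have [k2 hk2] : exists k2, forall k z, (k2 <= k)%N -> K z -> iter k T barrier z < 1.
  apply: (compact_uniform_nat (P := fun k z => iter k T barrier z < 1) cK) => z Kz.
  have [l l1 hl] := act_lip cK; have l0 : 0 < l by exact: lt_le_trans l1.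
  have d0 : 0 < e / (2 * C) by rewrite divr_gt0 // mulr_gt0.
  have [x [s [rx ws xs]]] := recurrent_reach Kz d0.
  have Kx := recurrent_sub rx.
  exists (e / (2 * C) / l ^+ size s); first by rewrite divr_gt0 // exprn_gt0.
  exists (size s) => y k Ky zy sk.
  have xy : dist x (run s y) < e / C.
    apply: (dist_lt_tri (y := run s z) _ xs (_ : _ < e / (2 * C))).
      by rewrite le_eqVlt; apply/orP; left; apply/eqP; field; rewrite lt0r_neq0.
    apply: le_lt_trans (run_lip iK l1 hl ws Kz Ky) _.
    by rewrite mulrC -ltr_pdivlMr // exprn_gt0.
  have [t wt et] := exists_word Z (k - size s).
  have ty : depth (run (s ++ t) y) < e.
    have Ky' := run_inv iK ws Ky.
    have eC : e / C <= e by rewrite ler_pdivrMr // ler_peMr // ltW.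
    case: (rx) => L [mL LK Lx].
    have xx : dist x x < e by rewrite distxx.
    have := hC mL LK Lx Kx Ky' xx (lt_le_trans xy eC) wt (leq0n _ : (0 * M <= _)%N).
    rewrite expr0 mulr1 run_cat => h.
    apply: le_lt_trans (depth_le _ (recurrent_run wt rx)) _.
    rewrite distC; apply: le_lt_trans h _.
    by rewrite mulrC -ltr_pdivlMr.
  have : 0 < iter k T (fun z => -1 * barrier z + 1) y.
    apply: (iter_T_gt0 cK iK (s := s ++ t)) => //.
    - by apply: uc_lin; [exact: barrier_uc|exact: uc_cst].
    - by move=> u _ _; have := barrier_le1 (run u y); lra.
    - exact/word_cat.
    - by rewrite size_cat et subnKC.
    - rewrite barrier_near //; suff : depth (run (s ++ t) y) / e < 1 by lra.
      by rewrite ltr_pdivrMr // mul1r.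
  by rewrite (iter_T_lin cK iK) ?iter_T_cst //;
    [lra|exact: barrier_uc|exact: uc_cst].
pose k := maxn (q1 * M) k2; exists k.
have [||r r0 hr] := @uc_gt0 _ Z K K (fun z => -1 * iter k T barrier z + 1) cK (@subset_refl _ K).
- apply: uc_lin; last exact: uc_cst.
  by apply: iter_T_uc => //; exact: barrier_uc.
- by move=> z Kz; have := hk2 k z (leq_maxr _ _) Kz; lra.
exists (Num.max 2^-1 (1 - r)); split.
  by rewrite lt_max invr_gt0 ltr0n /= gt_max; apply/andP; split; lra.
move=> z Kz; have [ze|ez] := ltP (depth z) e.
  apply: le_trans (near k z Kz (leq_maxl _ _) ze) _.
  by rewrite ler_wpM2r ?barrier_ge0 // le_max lexx.
rewrite (barrier_far ez) mulr1 le_max; apply/orP; right.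
by have := hr z Kz; lra.
Qed.

Lemma barrier_decay_iter k (rho : R) : 0 < rho ->
  (forall z, K z -> iter k T barrier z <= rho * barrier z) ->
  forall j z, K z -> iter (j * k) T barrier z <= rho ^+ j.
Proof.
move=> rho0 h.
have H j z : K z -> iter (j * k) T barrier z <= rho ^+ j * barrier z.
  elim: j z => [|j IH] z Kz; first by rewrite mul1r.
  rewrite mulSn iterD; apply: (@le_trans _ _ (iter k T (fun y => rho ^+ j * barrier y + 0) z)).
    apply: (iter_T_le cK iK) => //.
    - by apply: iter_T_uc => //; exact: barrier_uc.
    - by apply: uc_lin; [exact: barrier_uc|exact: uc_cst].
    - by move=> s ws _; rewrite addr0; apply: IH; exact: run_inv.
  rewrite (iter_T_lin cK iK) ?iter_T_cst //; [|exact: barrier_uc|exact: uc_cst].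
  by rewrite addr0 exprSr -mulrA ler_wpM2l ?exprn_ge0 ?(ltW rho0) // h.
move=> j z Kz; apply: le_trans (H j z Kz) _.
by rewrite ler_piMr ?barrier_le1 // exprn_ge0 // ltW.
Qed.

End Absorption.

(** * The Lasota-Yorke inequality *)

Section Hoelder.
Variables (R : realType) (Z : system R).
Local Notation Y := (space Z).
Local Notation X := (maps Z).
Local Notation T := (@averaging R Z).
Variable K : set Y.
Hypothesis cK : compact K.
Hypothesis iK : forall g x, supp g -> K x -> K (act g x).
Implicit Types (x y z : Y) (s t : seq X) (phi : Y -> R).

(** Exponents are taken among the inverses of the positive integers, for which
    powers and roots of constants are explicit. *)
Definition expo (j : nat) : R := j.+1%:R^-1.

Lemma expo_gt0 j : 0 < expo j.
Proof. by rewrite invr_gt0. Qed.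

Lemma expo_root j (x : R) : 0 <= x -> (x ^+ j.+1) `^ expo j = x.
Proof.
by move=> x0; rewrite -powR_mulrn // -powRrM divff ?powRr1 // pnatr_eq0.
Qed.

Lemma expo_le j (x y : R) : 0 <= x -> x <= y -> x `^ expo j <= y `^ expo j.
Proof.
move=> x0 xy; apply: ge0_ler_powR; rewrite ?nnegrE //; first exact/ltW/expo_gt0.
exact: le_trans xy.
Qed.

Lemma expo_lt j (x y : R) : 0 <= x -> x < y -> x `^ expo j < y `^ expo j.
Proof.
move=> x0 xy; apply: gt0_ltr_powR; rewrite ?nnegrE ?expo_gt0 //.
exact: le_trans (ltW xy).
Qed.

(** The bounds for the sup norm and for the Hoelder seminorm are kept apart,
    because averaging improves only the second one. *)
Definition hbound (j : nat) (a b : R) phi : Prop :=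
  (forall x, K x -> `|phi x| <= a) /\
  (forall x y, K x -> K y -> `|phi x - phi y| <= b * dist x y `^ expo j).

Lemma hbound_uc j a b phi : hbound j a b phi -> uc K phi.
Proof.
move=> [_ h] e e0; have d0 : 0 < `|b| + 1 by rewrite ltr_wpDl.
have r0 : 0 < e / (`|b| + 1) by rewrite divr_gt0.
exists ((e / (`|b| + 1)) ^+ j.+1); first by rewrite exprn_gt0.
move=> x y Kx Ky /(expo_lt j (dist_ge0 x y)); rewrite expo_root ?(ltW r0) //.
rewrite ltr_pdivlMr // => lt; apply: le_lt_trans (h x y Kx Ky) (le_lt_trans _ lt).
by rewrite mulrC ler_wpM2l ?powR_ge0 // (le_trans (ler_norm b)) // lerDl.
Qed.

Lemma iter_T_bound k (a : R) phi x : uc K phi -> (forall z, K z -> `|phi z| <= a) ->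
  K x -> `|iter k T phi x| <= a.
Proof.
move=> uphi h Kx; rewrite -[X in `|X|]subr0 -(@iter_T_cst _ Z k 0 x).
rewrite -[leRHS](@iter_T_cst _ Z k a x).
apply: (iter_T_dist cK iK) => //; try exact: uc_cst.
by move=> s ws _; rewrite subr0; apply: h; exact: run_inv.
Qed.

Lemma iter_T_holder k j (l a b : R) phi x y : 1 <= l -> 0 <= b ->
  (forall g x y, supp g -> K x -> K y -> dist (act g x) (act g y) <= l * dist x y) ->
  hbound j a b phi -> K x -> K y ->
  `|iter k T phi x - iter k T phi y| <= b * (l ^+ k * dist x y) `^ expo j.
Proof.
move=> l1 b0 hl hphi Kx Ky; rewrite -[leRHS](@iter_T_cst _ Z k _ x).
have uphi := hbound_uc hphi.
apply: (iter_T_dist cK iK) => //; try exact: uc_cst.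
move=> s ws ss; have [_ h] := hphi.
apply: le_trans (h _ _ (run_inv iK ws Kx) (run_inv iK ws Ky)) _.
rewrite ler_wpM2l // expo_le ?dist_ge0 // -ss.
exact: (run_lip iK l1 hl ws Kx Ky).
Qed.

End Hoelder.

Section LasotaYorke.
Variables (R : realType) (Z : system R) (st : contracting Z).
Local Notation Y := (space Z).
Local Notation X := (maps Z).
Local Notation T := (@averaging R Z).
Variable K : set Y.
Hypothesis cK : compact K.
Hypothesis iK : forall g x, supp g -> K x -> K (act g x).
Hypothesis K0 : K !=set0.
Implicit Types (x y z : Y) (s t : seq X) (phi : Y -> R).

(** Words that have come close to the recurrent points contract. The others
    stretch distances by a bounded factor per step, which a small exponent turns
    into a factor close to 1, while their weight decays geometrically. Hence the
    iterates of [T] contract the Hoelder seminorm, up to the sup norm. *)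
Lemma lasota_yorke : exists j k (B : R), [/\ (0 < j)%N, (0 < k)%N, 0 <= B &
  forall a b phi, 0 <= a -> 0 <= b -> hbound K j a b phi ->
  hbound K j a (2^-1 * b + B * a) (iter k T phi)].
Proof.
have [e [C [M [e0 C1 M0 hC]]]] := contraction_minimal st cK iK.
have [l l1 hl] := act_lip cK; have l0 : 0 < l by exact: lt_le_trans l1.
have [k0 [rho [/andP[rho0 rho1] hrho]]] := barrier_decay cK iK K0 e0 C1 hC.
have hb := barrier_decay_iter cK iK K0 e0 rho0 hrho.
pose A := l ^+ (4 * M); have A1 : 1 <= A by exact: exprn_ege1.
have A0 : 0 < A by exact: lt_le_trans A1.
have [m hm] : exists m, 16 * A * rho ^+ m <= 1.
  have /cvgrPdist_lt/(_ (16 * A)^-1) : rho ^+ k @[k --> \oo] --> 0.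
    by apply: cvg_expr; rewrite ger0_norm // ltW.
  rewrite invr_gt0 mulr_gt0 // => /(_ isT) [m _ /(_ m (leqnn m))].
  rewrite /= sub0r normrN ger0_norm ?exprn_ge0 ?(ltW rho0) // => h.
  by exists m; rewrite mulrC -ler_pdivlMr ?mulr_gt0 // div1r ltW.
pose k1 := (m * k0)%N.
have [j [j0 lj Cj]] : exists j, [/\ (0 < j)%N, l ^+ k1 <= 2 ^+ j.+1 & C <= 2 ^+ j.+1].
  have pow (x : R) : exists j0, forall j, (j0 <= j)%N -> x <= 2 ^+ j.
    exists (Num.truncn x).+1 => j jj; apply: le_trans (ltW (truncnS_gt x)) _.
    by rewrite -natrX ler_nat (leq_trans jj) // ltnW // ltn_expl.
  have [j1 h1] := pow (l ^+ k1); have [j2 h2] := pow C.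
  exists (j1 + j2).+1; split=> //; [apply: h1|apply: h2].
    by rewrite !leqW ?leq_addr.
  by rewrite !leqW ?leq_addl.
have l2 : (l ^+ k1) `^ expo R j <= 2.
  by rewrite -[leRHS](expo_root j) ?ler0n // expo_le // exprn_ge0 // ltW.
have C2 : C `^ expo R j <= 2.
  by rewrite -[leRHS](expo_root j) ?ler0n // expo_le // (le_trans ler01).
pose k2 := (4 * j.+1 * M)%N.
have lA : (l ^+ k2) `^ expo R j = A.
  by rewrite /k2 mulnAC exprM expo_root // exprn_ge0 // ltW.
pose d1 := e / (2 * l ^+ k1); have d10 : 0 < d1 by rewrite divr_gt0 // mulr_gt0 // exprn_gt0.
exists j, (k1 + k2)%N, (2 / d1 `^ expo R j); split.
- exact: j0.
- by rewrite addn_gt0 !muln_gt0 M0 orbT.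
- by rewrite divr_ge0 ?powR_ge0.
move=> a b phi a0 b0 hphi; have uphi := hbound_uc hphi.
have [ha hh] := hphi; split=> [x Kx|x y Kx Ky]; first exact: (iter_T_bound cK iK).
have [xy|xy] := ltP (dist x y) d1; last first.
  apply: (@le_trans _ _ (a + a)).
    apply: le_trans (ler_normB _ _) (lerD _ _); exact: (iter_T_bound cK iK).
  have p0 : 0 < d1 `^ expo R j by rewrite powR_gt0.
  have pq : d1 `^ expo R j <= dist x y `^ expo R j by rewrite expo_le // ltW.
  move: (d1 `^ _) (dist x y `^ _) p0 pq => p q p0 pq.
  have -> : a + a = 2 / p * a * p by field; exact: lt0r_neq0.
  have q0 : 0 <= q by rewrite (le_trans (ltW p0)).
  apply: (@le_trans _ _ (2 / p * a * q)).
    by rewrite ler_wpM2l // mulr_ge0 // divr_ge0 // ltW.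
  by rewrite ler_wpM2r // lerDr mulr_ge0 // invr_ge0.
set D := dist x y `^ expo R j; have D0 : 0 <= D := powR_ge0 _ _.
(* [g] bounds the difference at the end of a word that starts with [k1]
   letters and is then continued by [k2] letters. *)
pose g z := b * D * 4 * A * barrier K e z + b * D * 4^-1.
have uphi2 : uc K (iter k2 T phi) by exact: iter_T_uc.
have ubar : uc K (barrier K e) by exact: (barrier_uc cK iK K0).
have ug : uc K g by apply: uc_lin => //; exact: uc_cst.
have pw (u v : R) : 0 <= u -> 0 <= v ->
    (u * v) `^ expo R j = u `^ expo R j * v `^ expo R j.
  by move=> u0 v0; rewrite powRM.
have main : `|iter k1 T (iter k2 T phi) x - iter k1 T (iter k2 T phi) y| <= iter k1 T g x.
  apply: (iter_T_dist cK iK) => // s ws ss.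
  have Kx' := run_inv iK ws Kx; have Ky' := run_inv iK ws Ky.
  set x' := run s x in Kx' *; set y' := run s y in Ky' *.
  have d' : dist x' y' <= l ^+ k1 * dist x y by rewrite -ss; exact: (run_lip iK l1 hl).
  have d'e : dist x' y' < e / 2.
    apply: le_lt_trans d' _; rewrite mulrC -ltr_pdivlMr ?exprn_gt0 //.
    by rewrite -mulrA -invfM.
  have dD : dist x' y' `^ expo R j <= 2 * D.
    apply: le_trans (expo_le j (dist_ge0 _ _) d') _.
    by rewrite pw ?exprn_ge0 ?dist_ge0 ?(ltW l0) // ler_wpM2r.
  have [bx|bx] := ltP (barrier K e x') 2^-1.
    have := barrier_lt e0 _ bx; rewrite invf_le1 ?ler1n // => /(_ isT) dx.
    have [x0 [L [mL LK Lx0]] xx0] := depth_lt cK iK K0 dx.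
    apply: (@le_trans _ _ (b * D * 4^-1)); last first.
      by rewrite lerDr !mulr_ge0 ?barrier_ge0 // ltW.
    rewrite -[leRHS](@iter_T_cst _ Z k2 _ x').
    apply: (iter_T_dist cK iK) => //; first exact: uc_cst.
    move=> t wt et; apply: le_trans (hh _ _ (run_inv iK wt Kx') (run_inv iK wt Ky')) _.
    rewrite -mulrA ler_wpM2l // [D * _]mulrC.
    have x0x : dist x0 x' < e by rewrite distC; lra.
    have x0y : dist x0 y' < e.
      by rewrite distC in xx0; apply: (dist_lt_tri _ xx0 d'e); lra.
    have qs : (4 * j.+1 * M <= size t)%N by rewrite et.
    have le := hC _ _ _ _ mL LK Lx0 Kx' Ky' x0x x0y _ _ wt qs.
    apply: le_trans (expo_le j (dist_ge0 _ _) le) _.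
    rewrite pw ?dist_ge0 ?mulr_ge0 ?exprn_ge0 ?invr_ge0 ?(le_trans ler01 C1) //.
    rewrite pw ?exprn_ge0 ?invr_ge0 ?(le_trans ler01 C1) //.
    rewrite (mulnC 4) mulnC exprM expo_root ?exprn_ge0 ?invr_ge0 //.
    have := powR_ge0 C (expo R j); move: (C `^ _) C2 (dist x' y' `^ _) dD => u hu v hv.
    have -> : 2^-1 ^+ 4 = 16^-1 :> R by rewrite exprVn -natrX.
    by move=> u0; nra.
  apply: (@le_trans _ _ (b * (A * (2 * D)))).
    apply: le_trans (iter_T_holder cK iK k2 l1 b0 hl hphi Kx' Ky') _.
    rewrite ler_wpM2l // pw ?dist_ge0 ?exprn_ge0 ?(ltW l0) // lA.
    by rewrite ler_wpM2l // ltW.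
  have bD : 0 <= b * D * A by rewrite !mulr_ge0 // ltW.
  have := mulr_ge0 b0 D0; rewrite /g; move: (barrier K e x') bx => w hw.
  have -> : b * (A * (2 * D)) = 2 * (b * D * A) by ring.
  have -> : b * D * 4 * A * w = 4 * (b * D * A * w) by ring.
  have : b * D * A * 2^-1 <= b * D * A * w by rewrite ler_wpM2l.
  by lra.
rewrite iterD; apply: le_trans main _; rewrite /g (iter_T_lin cK iK) //; last exact: uc_cst.
rewrite iter_T_cst.
have bD : 0 <= b * D by rewrite mulr_ge0.
have hx := hb m x Kx; rewrite -/k1 in hx.
have B0 : 0 <= 2 / d1 `^ expo R j * a * D.
  by rewrite !mulr_ge0 // invr_ge0 powR_ge0.
have : b * D * 4 * A * iter k1 T (barrier K e) x <= b * D * 4^-1.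
  apply: (@le_trans _ _ (b * D * 4 * A * rho ^+ m)).
    by rewrite ler_wpM2l // !mulr_ge0 // ltW.
  rewrite -!mulrA ler_wpM2l // ler_wpM2l //; move: hm; rewrite -mulrA.
  by move: (A * rho ^+ m) => w; lra.
by rewrite mulrDl; move: B0 bD; lra.
Qed.

End LasotaYorke.

(** * Convergence along a period on a minimal set *)

Lemma finite_uniform (R : realType) (N : nat) (P : nat -> R -> Prop) :
  (forall i r r', P i r -> 0 < r' -> r' <= r -> P i r') ->
  (forall i, (i < N)%N -> exists2 r, 0 < r & P i r) ->
  exists2 r : R, 0 < r & forall i, (i < N)%N -> P i r.
Proof.
move=> mono; elim: N => [|N IH] h; first by exists 1.
have [|r r0 hr] := IH; first by move=> i iN; apply: h; exact: leqW.
have [r' r'0 hr'] := h N (ltnSn N).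
exists (Num.min r r'); first by rewrite lt_min r0.
move=> i; rewrite ltnS leq_eqVlt => /orP[/eqP ->|/hr Pi].
  by apply: mono hr' _ _; rewrite ?lt_min ?r0 // ge_min lexx orbT.
by apply: mono Pi _ _; rewrite ?lt_min ?r0 // ge_min lexx.
Qed.

Section Doeblin.
Variables (R : realType) (Z : system R).
Local Notation Y := (space Z).
Local Notation X := (maps Z).
Local Notation T := (@averaging R Z).
Variable K : set Y.
Hypothesis cK : compact K.
Hypothesis iK : forall g x, supp g -> K x -> K (act g x).
Implicit Types (x y z : Y) (s t : seq X) (phi f : Y -> R).
Variables (l : R).
Hypothesis l1 : 1 <= l.
Hypothesis hl : forall g x y, supp g -> K x -> K y ->
  dist (act g x) (act g y) <= l * dist x y.
Variables (e C : R) (M : nat).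
Hypotheses (e0 : 0 < e) (C1 : 1 <= C).
Hypothesis hC : forall L x0 x y, minimal L -> L `<=` K -> L x0 -> K x -> K y ->
    dist x0 x < e -> dist x0 y < e ->
    forall q s, word s -> (q * M <= size s)%N ->
    dist (run s x) (run s y) <= C * 2^-1 ^+ q * dist x y.

(** All words contract near a minimal set. *)
Lemma iter_T_close j (eta : R) : 0 < eta -> exists k0, forall a b phi L x0 x k,
  0 <= b -> hbound K j a b phi -> minimal L -> L `<=` K -> L x0 -> K x ->
  dist x0 x < e -> (k0 <= k)%N -> `|iter k T phi x - iter k T phi x0| <= eta * b.
Proof.
move=> eta0; have p0 : 0 < eta ^+ j.+1 by rewrite exprn_gt0.
have [q hq] := half_le (C / eta ^+ j.+1).
have hq2 : C * 2^-1 ^+ q * 2 <= eta ^+ j.+1.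
  move: hq; rewrite mulrAC ler_pdivrMr // => hq.
  by move: hq; set u := C * _; lra.
exists (q * M)%N => a b phi L x0 x k b0 hphi mL LK Lx0 Kx xx0 qk.
have uphi := hbound_uc hphi; have [_ hh] := hphi; have Kx0 := LK _ Lx0.
rewrite -[leRHS](@iter_T_cst _ Z k _ x).
apply: (iter_T_dist cK iK) => //; first exact: uc_cst.
move=> s ws ss; apply: le_trans (hh _ _ (run_inv iK ws Kx) (run_inv iK ws Kx0)) _.
rewrite mulrC ler_wpM2r // -[leRHS](expo_root j (ltW eta0)).
rewrite -ss in qk; have x00 : dist x0 x0 < e by rewrite distxx.
have le := hC mL LK Lx0 Kx Kx0 xx0 x00 ws qk.
apply: le_trans (expo_le j (dist_ge0 _ _) le) _; apply: expo_le.
  by rewrite !mulr_ge0 ?dist_ge0 ?exprn_ge0 ?invr_ge0 // (le_trans ler01).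
apply: le_trans hq2; rewrite ler_wpM2l ?dist_le2 //.
by rewrite !mulr_ge0 ?exprn_ge0 ?invr_ge0 // (le_trans ler01).
Qed.

Variables (L : set Y) (x0 : Y).
Hypotheses (mL : minimal L) (LK : L `<=` K) (Lx0 : L x0).

Let Kx0 : K x0. Proof. exact: LK. Qed.

(** A loop can be repeated, which gives returns to the ball around [x0] at all
    multiples of its length. *)
Definition loop s : Prop :=
  word s /\ forall y, K y -> dist x0 y < e -> dist x0 (run s y) < e.

Lemma loop_cat s t : loop s -> loop t -> loop (s ++ t).
Proof.
move=> [ws hs] [wt ht]; split; first exact/word_cat.
by move=> y Ky y0; rewrite run_cat; apply: ht; [exact: run_inv|exact: hs].
Qed.

Lemma loop_iter s i : loop s -> exists2 t, loop t & size t = (i * size s)%N.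
Proof.
move=> ls; elim: i => [|i [t lt et]]; first by exists [::].
by exists (s ++ t); [exact: loop_cat|rewrite size_cat et mulSn].
Qed.

(** A long word that brings [x0] back near itself contracts the whole ball
    around [x0] to a small one. *)
Lemma return_loop : exists k0, forall s, word s -> (k0 <= size s)%N ->
  dist x0 (run s x0) < e / 2 -> loop s.
Proof.
have [q hq] := half_le C; exists (q * M)%N => s ws qs ret.
split=> // y Ky y0; have x00 : dist x0 x0 < e by rewrite distxx.
have le := hC mL LK Lx0 Kx0 Ky x00 y0 ws qs.
apply: (dist_lt_tri (b := e / 2) _ ret); first by rewrite -splitr.
apply: le_lt_trans le _; apply: (@le_lt_trans _ _ (2^-1 * dist x0 y)).
  by rewrite ler_wpM2r ?dist_ge0.
by rewrite mulrC ltr_pM2r ?invr_gt0.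
Qed.

Section Cycle.
Variable N : nat.
Hypothesis N0 : (0 < N)%N.

(** The cyclic class of [x0], as in the theory of periodic Markov chains. *)
Definition piece : set Y := closure [set y | exists s : seq X,
  [/\ word s, (N %| size s)%N & y = run s x0]].

Lemma piece_sub : piece `<=` L.
Proof.
rewrite [X in _ `<=` X]((closure_id L).1 (minimal_closed mL)).
by apply: closureS => _ [s [ws _ ->]]; exact: minimal_run.
Qed.

Lemma piece_dist y : K y -> (forall r : R, 0 < r -> exists s,
  [/\ word s, (N %| size s)%N & dist y (run s x0) < r]) -> piece y.
Proof.
move=> Ky h; apply: (dist_closure cK) => //.
  by move=> _ [s [ws _ ->]]; exact: run_inv.
by move=> r /h[s [ws Ns ys]]; exists (run s x0) => //; exists s.
Qed.

Lemma piece_near y (r : R) : piece y -> 0 < r -> exists s,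
  [/\ word s, (N %| size s)%N & dist y (run s x0) < r].
Proof. by move=> py r0; have [_ [s [ws Ns ->]] d] := closure_dist py r0; exists s. Qed.

Lemma piece_compact : compact piece.
Proof.
apply: subclosed_compact cK _; first exact: closed_closure.
by move=> y /piece_sub; exact: LK.
Qed.

Lemma piece_x0 : piece x0.
Proof. by apply: subset_closure; exists [::]; rewrite dvdn0. Qed.

Let lgt0 k : 0 < l ^+ k. Proof. by rewrite exprn_gt0 // (lt_le_trans ltr01). Qed.

(** The points near which the orbit of [x0] passes at times congruent to [- i]
    modulo [N] enter the piece after [i] steps. *)
Lemma run_piece y s i : L y -> word s -> size s = i ->
  (forall r : R, 0 < r -> exists t,
     [/\ word t, (N %| size t + i)%N & dist y (run t x0) < r]) ->
  piece (run s y).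
Proof.
move=> Ly ws ss h; have Ky := LK Ly.
apply: piece_dist; first exact: run_inv.
move=> r r0; have [|t [wt Nt yt]] := h (r / l ^+ size s); first by rewrite divr_gt0.
exists (t ++ s); split; [exact/word_cat|by rewrite size_cat ss|].
rewrite run_cat.
apply: le_lt_trans (run_lip iK l1 hl ws Ky (run_inv iK wt Kx0)) _.
by rewrite mulrC -ltr_pdivlMr.
Qed.

Lemma piece_inv y s : piece y -> word s -> (N %| size s)%N -> piece (run s y).
Proof.
move=> py ws Ns; apply: run_piece ws erefl _; first exact: piece_sub.
move=> r r0; have [t [wt Nt yt]] := piece_near py r0.
by exists t; rewrite dvdn_add.
Qed.

Lemma piece_return y : piece y -> exists s, [/\ word s, (N %| size s)%N &
  dist x0 (run s y) < e].
Proof.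
move=> py; have [k0 ret] := return_loop.
have Ly := piece_sub py; have Ky := LK Ly.
have e4 : 0 < e / 4 by rewrite divr_gt0.
have [t [wt kt x0t]] := minimal_dense k0 mL Ly Lx0 e4.
have [|u [wu Nu yu]] := piece_near py (r := e / 4 / l ^+ size t).
  by rewrite divr_gt0.
have lp : loop (u ++ t).
  apply: ret; [exact/word_cat|by rewrite size_cat (leq_trans (ltnW kt)) // leq_addl|].
  rewrite run_cat; apply: (dist_lt_tri _ x0t (_ : _ < e / 4)); first by lra.
  apply: le_lt_trans (run_lip iK l1 hl wt Ky (run_inv iK wu Kx0)) _.
  by rewrite mulrC -ltr_pdivlMr.
(* after [t], the loop [u ++ t] is run [N.-1] times, which makes the length
   divisible by [N] *)
have [v [wv hv] ev] := loop_iter N.-1 lp.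
exists (t ++ v); split; first exact/word_cat.
  have -> : size (t ++ v) = (N * size t + N.-1 * size u)%N.
    rewrite size_cat ev size_cat mulnDr addnC -addnA -mulSnr prednK //.
    by rewrite addnC.
  by apply: dvdn_add; [exact: dvdn_mulr|exact: dvdn_mull].
rewrite run_cat; apply: hv; first exact: run_inv.
by apply: lt_le_trans x0t _; lra.
Qed.

Variable s0 : seq X.
Hypotheses (ls0 : loop s0) (es0 : size s0 = N).

(** A continuous substitute for the indicator function of the ball around
    [x0]. *)
Definition bump z : R := Num.max 0 (1 - dist x0 z / e).

Lemma bump_itv z : 0 <= bump z <= 1.
Proof.
rewrite le_max lexx ge_max ler01 /= lerBlDr lerDl.
by rewrite divr_ge0 ?dist_ge0 // ltW.
Qed.

Lemma bump_gt0 z : (0 < bump z) = (dist x0 z < e).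
Proof. by rewrite lt_max ltxx /= subr_gt0 ltr_pdivrMr // mul1r. Qed.

Lemma bump_uc : uc K bump.
Proof.
apply: (@uc_lip _ _ _ _ e^-1) => x y _ _.
wlog : x y / bump y <= bump x.
  move=> H; have [/H//|/ltW/H] := leP (bump y) (bump x).
  by rewrite distrC distC.
move=> yx; rewrite ger0_norm ?subr_ge0 // mulrC.
have h : dist x0 y / e <= dist x0 x / e + dist x y / e.
  by rewrite -mulrDl ler_pM2r ?invr_gt0 // dist_tri.
have d0 : 0 <= dist x y / e by rewrite divr_ge0 ?dist_ge0 // ltW.
by rewrite /bump !maxEle; do 2 case: ifP => ?; lra.
Qed.

(** Every point of the piece can return to the ball around [x0] at a time
    divisible by [N], and loops of length [N] keep it there until a time common
    to all points. *)
Lemma piece_mixing : exists m theta, [/\ 0 < theta :> R, theta <= 1 &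
  forall z, piece z -> theta <= iter (m * N) T bump z].
Proof.
have [m hm] : exists m, forall k z, (m <= k)%N -> piece z -> 0 < iter (k * N) T bump z.
  apply: (compact_uniform_nat (P := fun k z => 0 < iter (k * N) T bump z) piece_compact).
  move=> z pz; have Kz : K z by apply/LK/piece_sub.
  have [s [ws Ns zs]] := piece_return pz.
  pose r := (e - dist x0 (run s z)) / l ^+ size s.
  have r0 : 0 < r by rewrite divr_gt0 // subr_gt0.
  exists r => //; exists (size s %/ N)%N => y k py zy sk.
  have Ky : K y by apply/LK/piece_sub.
  have [t [wt ht] et] := loop_iter (k - size s %/ N) ls0.
  apply: (iter_T_gt0 cK iK (s := s ++ t) bump_uc Ky) => //.
  - by move=> u _ _; case/andP: (bump_itv (run u y)).
  - exact/word_cat.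
  - by rewrite size_cat et es0 -{1}(divnK Ns) -mulnDl subnKC.
  rewrite bump_gt0 run_cat; apply: ht; first exact: run_inv.
  apply: le_lt_trans (dist_tri _ (run s z) _) _; rewrite -ltrBrDl.
  apply: le_lt_trans (run_lip iK l1 hl ws Kz Ky) _.
  by rewrite mulrC -ltr_pdivlMr.
have [|||th th0 hth] := @uc_gt0 _ Z K piece (iter (m * N) T bump) piece_compact.
- by move=> z /piece_sub; exact: LK.
- by apply: iter_T_uc => //; exact: bump_uc.
- by move=> z; exact: hm.
exists m, (Num.min th 1); split; first by rewrite lt_min th0 ltr01.
  by rewrite ge_min lexx orbT.
by move=> z pz; rewrite ge_min hth.
Qed.

(** A bound for the oscillation on the piece, with an unspecified base
    value. *)
Definition band f (w : R) : Prop :=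
  exists lo, forall z, piece z -> lo <= f z <= lo + w.

Lemma band_word f (w : R) k lo : uc K f -> (N %| k)%N ->
  (forall z, piece z -> lo <= f z <= lo + w) ->
  forall z, piece z -> lo <= iter k T f z <= lo + w.
Proof.
move=> uf Nk h z pz; have Kz : K z by apply/LK/piece_sub.
have hw s : word s -> size s = k -> lo <= f (run s z) <= lo + w.
  by move=> ws ss; apply: h; apply: piece_inv => //; rewrite ss.
apply/andP; split.
  rewrite -[leLHS](@iter_T_cst _ Z k _ z).
  apply: (iter_T_le cK iK) => //; first exact: uc_cst.
  by move=> s ws ss; case/andP: (hw s ws ss).
rewrite -[leRHS](@iter_T_cst _ Z k _ z).
apply: (iter_T_le cK iK) => //; first exact: uc_cst.
by move=> s ws ss; case/andP: (hw s ws ss).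
Qed.

(** Doeblin's argument: a part [theta] of the average is taken near [x0], where
    [f] is almost constant. *)
Lemma band_step m (theta : R) f (w om : R) : 0 <= theta -> theta <= 1 ->
  (forall z, piece z -> theta <= iter (m * N) T bump z) -> uc K f ->
  band f w ->
  (forall z, piece z -> dist x0 z < e -> `|f z - f x0| <= om) ->
  0 <= om ->
  band (iter (m * N) T f) ((1 - theta) * w + 2 * om).
Proof.
move=> th0 th1 hth uf [lo hlo] hom om0.
have /andP[c1 c2] := hlo x0 piece_x0; set c := f x0 in hom c1 c2.
exists (lo - om + (c - lo) * theta) => z pz; have Kz : K z by apply/LK/piece_sub.
have bz := hth z pz; apply/andP; split.
  apply: (@le_trans _ _ (iter (m * N) T (fun y => (c - lo) * bump y + (lo - om)) z)).
    rewrite (iter_T_lin cK iK) ?iter_T_cst //; [|exact: bump_uc|exact: uc_cst].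
    by rewrite addrC lerD2r ler_wpM2l // subr_ge0.
  apply: (iter_T_le cK iK) => //.
    by apply: uc_lin; [exact: bump_uc|exact: uc_cst].
  move=> s ws ss; have ps : piece (run s z) by apply: piece_inv => //; rewrite ss dvdn_mull.
  have /andP[h1 h2] := hlo _ ps; have /andP[b0 b1] := bump_itv (run s z).
  have [near|far] := ltP (dist x0 (run s z)) e.
    have := hom _ ps near; rewrite ler_norml => /andP[]; nra.
  have : bump (run s z) <= 0 by rewrite leNgt bump_gt0 -leNgt.
  by nra.
apply: (@le_trans _ _ (iter (m * N) T (fun y => (- (lo + w - c)) * bump y + (lo + w + om)) z)).
  apply: (iter_T_le cK iK) => //.
    by apply: uc_lin; [exact: bump_uc|exact: uc_cst].
  move=> s ws ss; have ps : piece (run s z) by apply: piece_inv => //; rewrite ss dvdn_mull.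
  have /andP[h1 h2] := hlo _ ps; have /andP[b0 b1] := bump_itv (run s z).
  have [near|far] := ltP (dist x0 (run s z)) e.
    have := hom _ ps near; rewrite ler_norml => /andP[]; nra.
  have : bump (run s z) <= 0 by rewrite leNgt bump_gt0 -leNgt.
  by nra.
rewrite (iter_T_lin cK iK) ?iter_T_cst //; [|exact: bump_uc|exact: uc_cst].
by nra.
Qed.

(** The oscillation on the piece decays, and the piece is stable under words of
    length [n * N], so that later values stay in the band of the present
    ones. *)
Lemma piece_convergence j (eta : R) : 0 < eta -> exists k0, forall a b phi k n z,
  0 <= a -> 0 <= b -> hbound K j a b phi -> (k0 <= k)%N -> piece z ->
  `|iter (n * N + k) T phi z - iter k T phi z| <= eta * (a + b).
Proof.
move=> eta0; have [m [th [th0 th1 hth]]] := piece_mixing.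
have d0 : 0 < eta * th / 4 by rewrite divr_gt0 // mulr_gt0.
have [k1 hk1] := iter_T_close j d0.
have [i hi] : exists i, 2 * (1 - th) ^+ i <= eta / 2.
  have /cvgrPdist_lt/(_ (eta / 4)) : (1 - th) ^+ k @[k --> \oo] --> 0.
    by apply: cvg_expr; rewrite ger0_norm; lra.
  rewrite divr_gt0 // => /(_ isT) [i _ /(_ i (leqnn i))].
  rewrite /= sub0r normrN ger0_norm ?exprn_ge0 ?subr_ge0 // => h.
  by exists i; lra.
exists (k1 + i * (m * N))%N => a b phi k n z a0 b0 hphi kk pz.
have uphi := hbound_uc hphi; have [ha _] := hphi.
have uk k' : uc K (iter k' T phi) by exact: iter_T_uc.
have band_iter i' k' : (k1 <= k')%N ->
    band (iter (i' * (m * N) + k') T phi) ((1 - th) ^+ i' * (2 * a) + eta / 2 * b).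
  move=> kk'; elim: i' => [|i' IH].
    exists (- a) => y py; rewrite expr0 mul1r mul0n add0n.
    have := iter_T_bound cK iK k' uphi ha (LK (piece_sub py)).
    rewrite ler_norml => /andP[h1 h2]; have : 0 <= eta / 2 * b.
      by rewrite mulr_ge0 // divr_ge0 // ltW.
    by move=> h3; apply/andP; split; lra.
  rewrite mulSn -addnA iterD.
  have := @band_step m th (iter (i' * (m * N) + k') T phi) _ (eta * th / 4 * b)
    (ltW th0) th1 hth (uk _) IH _ _.
  have -> : (1 - th) * ((1 - th) ^+ i' * (2 * a) + eta / 2 * b) + 2 * (eta * th / 4 * b)
      = (1 - th) ^+ i'.+1 * (2 * a) + eta / 2 * b by rewrite exprS; field.
  apply; last by rewrite mulr_ge0 // ltW.
  move=> y py y0; apply: (hk1 a b phi L) => //; first exact/LK/piece_sub.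
  by rewrite (leq_trans kk') // leq_addl.
have ik : (i * (m * N) <= k)%N by rewrite (leq_trans _ kk) // leq_addl.
have := band_iter i (k - i * (m * N))%N; rewrite subnKC // leq_subRL //.
rewrite addnC => /(_ kk) [lo hlo].
have /andP[h1 h2] := hlo z pz.
have := band_word (uk k) (dvdn_mull n (dvdnn N)) hlo pz; rewrite -iterD => /andP[h3 h4].
have hw : (1 - th) ^+ i * (2 * a) + eta / 2 * b <= eta * (a + b).
  have : 2 * (1 - th) ^+ i * a <= eta / 2 * a by rewrite ler_wpM2r.
  have : 0 <= eta * a by rewrite mulr_ge0 // ltW.
  have : 0 <= eta * b by rewrite mulr_ge0 // ltW.
  by move: ((1 - th) ^+ i) => v; lra.
by rewrite ler_norml; apply/andP; split; lra.
Qed.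

(** Every point of [L] reaches the piece at a time common to all words. *)
Lemma minimal_convergence_cycle j (eta : R) : 0 < eta -> exists k0,
  forall a b phi k n z, 0 <= a -> 0 <= b -> hbound K j a b phi ->
  (k0 <= k)%N -> L z ->
  `|iter (n * N + k) T phi z - iter k T phi z| <= eta * (a + b).
Proof.
move=> eta0; have [k1 hk1] := piece_convergence j eta0.
exists (N + k1)%N => a b phi k n z a0 b0 hphi kk Lz; have Kz := LK Lz.
have uphi := hbound_uc hphi.
have uk k' : uc K (iter k' T phi) by exact: iter_T_uc.
have [i iN hi] : exists2 i, (i <= N)%N & forall r : R, 0 < r -> exists t : seq X,
    [/\ word t, (N %| size t + i)%N & dist z (run t x0) < r].
  apply: contrapT => no.
  have [||r r0 hr] := @finite_uniform R N.+1 (fun i r => forall t, word t ->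
      (N %| size t + i)%N -> ~ dist z (run t x0) < r).
  - move=> i r r' h _ r'r t wt Nt d; apply: (h t wt Nt).
    exact: lt_le_trans r'r.
  - move=> i; rewrite ltnS => iN; apply: contrapT => h; apply: no; exists i => // r r0.
    apply: contrapT => h2; apply: h; exists r => // t wt Nt d; apply: h2.
    by exists t.
  have [t [wt _ d]] := minimal_dense 0 mL Lx0 Lz r0.
  apply: (hr (N - size t %% N)%N _ t wt _ d); first by rewrite ltnS leq_subr.
  rewrite {1}(divn_eq (size t) N) -addnA subnKC; last by rewrite ltnW // ltn_pmod.
  by rewrite dvdn_add ?dvdnn // dvdn_mull.
have ik : (i <= k)%N by rewrite (leq_trans iN) // (leq_trans _ kk) // leq_addr.
have -> : iter (n * N + k) T phi = iter i T (iter (n * N + (k - i)) T phi).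
  by rewrite -iterD addnCA subnKC.
have -> : iter k T phi = iter i T (iter (k - i) T phi) by rewrite -iterD subnKC.
rewrite -[leRHS](@iter_T_cst _ Z i _ z).
apply: (iter_T_dist cK iK) => //; first exact: uc_cst.
move=> s ws ss; apply: hk1 => //; last exact: run_piece ss hi.
by rewrite leq_subRL // (leq_trans _ kk) // leq_add2r.
Qed.

End Cycle.

Lemma minimal_convergence : exists2 N, (0 < N)%N &
  forall j (eta : R), 0 < eta -> exists k0,
  forall a b phi k n z, 0 <= a -> 0 <= b -> hbound K j a b phi ->
  (k0 <= k)%N -> L z ->
  `|iter (n * N + k) T phi z - iter k T phi z| <= eta * (a + b).
Proof.
have [k0 ret] := return_loop; have e2 : 0 < e / 2 by rewrite divr_gt0.
have [s [ws ks d]] := minimal_dense k0 mL Lx0 Lx0 e2.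
have ls := ret s ws (ltnW ks) d.
exists (size s); first exact: leq_ltn_trans ks.
move=> j eta eta0; apply: (minimal_convergence_cycle _ ls) => //.
exact: leq_ltn_trans ks.
Qed.

End Doeblin.

(** * Convergence along a period on an invariant compact set *)

Section Global.
Variables (R : realType) (Z : system R) (st : contracting Z).
Local Notation Y := (space Z).
Local Notation X := (maps Z).
Local Notation T := (@averaging R Z).
Variable K : set Y.
Hypothesis cK : compact K.
Hypothesis iK : forall g x, supp g -> K x -> K (act g x).
Implicit Types (x y z : Y) (s t : seq X) (phi psi f : Y -> R).

(** A period common to all minimal sets in [K]; there are finitely many. *)
Lemma recurrent_convergence : exists2 N, (0 < N)%N &
  forall j (eta : R), 0 < eta -> exists k0,
  forall a b phi k n z, 0 <= a -> 0 <= b -> hbound K j a b phi ->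
  (k0 <= k)%N -> recurrent K z ->
  `|iter (n * N + k) T phi z - iter k T phi z| <= eta * (a + b).
Proof.
have [l l1 hl] := act_lip cK.
have [e [C [M [e0 C1 M0 hC]]]] := contraction_minimal st cK iK.
have /finite_seqP[ss hss] := minimal_finite st.
suff [N N0 hN] : exists2 N, (0 < N)%N & forall j (eta : R), 0 < eta -> exists k0,
    forall L a b phi k n z, L \in ss -> minimal L -> L `<=` K ->
    0 <= a -> 0 <= b -> hbound K j a b phi -> (k0 <= k)%N -> L z ->
    `|iter (n * N + k) T phi z - iter k T phi z| <= eta * (a + b).
  exists N => // j eta /(hN j)[k0 h]; exists k0.
  move=> a b phi k n z a0 b0 hphi kk [L [mL LK Lz]].
  by apply: (h L) => //; move: (mL); rewrite hss.
elim: ss {hss} => [|L ss [N N0 IH]].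
  by exists 1%N => // j eta _; exists 0%N.
have [[mL LK]|no] := pselect (minimal L /\ L `<=` K); last first.
  exists N => // j eta /(IH j)[k0 h]; exists k0 => L' a b phi k n z.
  rewrite inE => /orP[/eqP-> mL LK|]; first by case: no.
  exact: h.
have [[x0 Lx0] _ _] := mL.
have [N' N'0 h'] := minimal_convergence cK iK l1 hl e0 C1 hC mL LK Lx0.
exists (N * N')%N; first by rewrite muln_gt0 N0.
move=> j eta eta0; have [k1 h1] := IH j eta eta0; have [k2 h2] := h' j eta eta0.
exists (maxn k1 k2) => L' a b phi k n z; rewrite geq_max inE.
move=> /orP[/eqP->|ssL'] mL' LK' a0 b0 hphi /andP[kk1 kk2] Lz.
  by rewrite mulnA; exact: h2.
by rewrite (mulnC N) mulnA; apply: (h1 L').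
Qed.

(** A point near a minimal set behaves like the points of that set, and
    [barrier] bounds the weight of the words that have not come near one. *)
Lemma global_convergence : exists2 N, (0 < N)%N &
  forall j (eta : R), 0 < eta -> exists k0,
  forall a b phi k n z, 0 <= a -> 0 <= b -> hbound K j a b phi ->
  (k0 <= k)%N -> K z ->
  `|iter (n * N + k) T phi z - iter k T phi z| <= eta * (a + b).
Proof.
have [K0|K0] := pselect (K !=set0); last first.
  by exists 1%N => // j eta _; exists 0%N => a b phi k n z _ _ _ _ Kz; case: K0; exists z.
have [e [C [M [e0 C1 M0 hC]]]] := contraction_minimal st cK iK.
have [kb [rho [/andP[rho0 rho1] hrho]]] := barrier_decay cK iK K0 e0 C1 hC.
have hb := barrier_decay_iter cK iK K0 e0 rho0 hrho.
have [N N0 hN] := recurrent_convergence.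
exists N => // j eta eta0.
have e4 : 0 < eta / 4 by rewrite divr_gt0.
have e8 : 0 < eta / 8 by rewrite divr_gt0.
have [k1 h1] := hN j _ e4; have [k2 h2] := iter_T_close cK iK e0 C1 hC j e8.
have [i hi] : exists i, 2 * rho ^+ i <= eta / 2.
  have /cvgrPdist_lt/(_ (eta / 4) e4) : rho ^+ k @[k --> \oo] --> 0.
    by apply: cvg_expr; rewrite ger0_norm // ltW.
  move=> [i _ /(_ i (leqnn i))].
  rewrite /= sub0r normrN ger0_norm ?exprn_ge0 ?(ltW rho0) // => h.
  by exists i; lra.
exists (i * kb + maxn k1 k2)%N => a b phi k n z a0 b0 hphi kk Kz.
have uphi := hbound_uc hphi; have [ha _] := hphi.
have uk k' : uc K (iter k' T phi) by exact: iter_T_uc.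
have ubar : uc K (barrier K e) by exact: (barrier_uc cK iK K0).
have main k' y : (maxn k1 k2 <= k')%N -> K y ->
    `|iter (n * N + k') T phi y - iter k' T phi y|
      <= 2 * a * barrier K e y + eta / 2 * (a + b).
  rewrite geq_max => /andP[kk1 kk2] Ky.
  have be : 0 <= eta / 2 * (a + b) by rewrite mulr_ge0 ?addr_ge0 // divr_ge0 // ltW.
  have [ye|ey] := ltP (depth K y) e; last first.
    rewrite (barrier_far e0 ey) mulr1; apply: le_trans (ler_normB _ _) _.
    have := iter_T_bound cK iK (n * N + k') uphi ha Ky.
    by have := iter_T_bound cK iK k' uphi ha Ky; lra.
  have [x rx yx] := depth_lt cK iK K0 ye; rewrite distC in yx.
  have := h1 a b phi k' n x a0 b0 hphi kk1 rx; have [L [mL LK Lx]] := rx.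
  have := h2 a b phi L x y k' b0 hphi mL LK Lx Ky yx kk2.
  have := h2 a b phi L x y (n * N + k')%N b0 hphi mL LK Lx Ky yx _.
  rewrite (leq_trans kk2) ?leq_addl // => /(_ isT).
  have bar0 : 0 <= 2 * a * barrier K e y.
    by rewrite !mulr_ge0 // (barrier_ge0 cK iK K0 e0).
  have ea : 0 <= eta * a by rewrite mulr_ge0 // ltW.
  rewrite !ler_norml => /andP[p1 p2] /andP[q1 q2] /andP[r1 r2].
  by apply/andP; split; lra.
have ik : (i * kb <= k)%N by rewrite (leq_trans _ kk) // leq_addr.
have -> : iter (n * N + k) T phi = iter (i * kb) T (iter (n * N + (k - i * kb)) T phi).
  by rewrite -iterD addnCA subnKC.
have -> : iter k T phi = iter (i * kb) T (iter (k - i * kb) T phi).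
  by rewrite -iterD subnKC.
apply: le_trans (iter_T_dist cK iK (f := fun y => 2 * a * barrier K e y + eta / 2 * (a + b))
   _ _ _ Kz Kz _) _.
- exact: uk.
- exact: uk.
- by apply: uc_lin => //; exact: uc_cst.
- move=> s ws _; apply: main; last exact: run_inv.
  by rewrite leq_subRL.
rewrite (iter_T_lin cK iK) ?iter_T_cst //; last exact: uc_cst.
have h3 : 2 * a * iter (i * kb) T (barrier K e) z <= eta / 2 * a.
  apply: (@le_trans _ _ (2 * a * rho ^+ i)).
    by rewrite ler_wpM2l ?mulr_ge0 // hb.
  by rewrite mulrAC ler_wpM2r.
have : 0 <= eta * b by rewrite mulr_ge0 // ltW.
by lra.
Qed.

(** Uniformly continuous functions are uniform limits of Lipschitz functions,
    by infimal convolution. *)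
Lemma hbound_dense j phi (eta : R) : uc K phi -> 0 < eta ->
  exists a b psi, [/\ 0 <= a, 0 <= b, hbound K j a b psi &
    forall z, K z -> `|phi z - psi z| <= eta].
Proof.
move=> uphi eta0; have [B B0 hB] := uc_bounded cK uphi.
have [r r0 hr] := uphi eta eta0.
have [n n0 nr] : exists2 n, 0 <= n & 2 * B <= n * r.
  exists (2 * B / r); first by rewrite divr_ge0 ?mulr_ge0 // ltW.
  by rewrite divfK // lt0r_neq0.
pose S x := [set phi y + n * dist x y | y in K].
have lbS x y : K y -> - B <= phi y + n * dist x y.
  move=> Ky; have := hB y Ky; rewrite ler_norml => /andP[h _].
  have : 0 <= n * dist x y by rewrite mulr_ge0 // dist_ge0.
  by lra.
have iS x : K x -> has_inf (S x).
  move=> Kx; split; first by exists (phi x + n * dist x x), x.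
  by exists (- B) => _ [y Ky <-]; exact: lbS.
pose psi x := inf (S x).
have psi_le x y : K x -> K y -> psi x <= phi y + n * dist x y.
  by move=> Kx Ky; apply: ge_inf; [exact: (iS x Kx).2|exists y].
have psi_ge x (u : R) : K x -> (forall y, K y -> u <= phi y + n * dist x y) -> u <= psi x.
  move=> Kx h; apply: lb_le_inf; first exact: (iS x Kx).1.
  by move=> _ [y Ky <-]; exact: h.
have psi_phi x : K x -> psi x <= phi x.
  by move=> Kx; have := psi_le x x Kx Kx; rewrite distxx mulr0 addr0.
have psi_lip x y : K x -> K y -> psi x - psi y <= n * dist x y.
  move=> Kx Ky; rewrite lerBlDr -lerBlDl; apply: psi_ge => // z Kz.
  have := psi_le x z Kx Kz; have : n * dist x z <= n * (dist x y + dist y z).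
    by rewrite ler_wpM2l // dist_tri.
  by rewrite mulrDr; lra.
exists B, (2 * n), psi; split=> //; first by rewrite mulr_ge0.
  split=> [x Kx|x y Kx Ky].
    rewrite ler_norml psi_ge // => [|y Ky]; last exact: lbS.
    apply: le_trans (psi_phi x Kx) _.
    by have := hB x Kx; rewrite ler_norml => /andP[].
  apply: (@le_trans _ _ (n * dist x y)).
    rewrite ler_norml psi_lip // andbT.
    by have := psi_lip y x Ky Kx; rewrite distC; lra.
  rewrite (mulrC 2) -mulrA ler_wpM2l //.
  set d := dist x y; have d0 : 0 <= d := dist_ge0 _ _.
  have d2 : d <= 2 := dist_le2 _ _.
  have h0 : 0 <= d / 2 by rewrite divr_ge0.
  have h1 : (d / 2) ^+ j.+1 <= d.
    apply: (@le_trans _ _ (d / 2)); last lra.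
    by rewrite exprS ler_piMr // exprn_ile1 //; lra.
  by have := expo_le j (exprn_ge0 j.+1 h0) h1; rewrite expo_root //; lra.
move=> x Kx; rewrite ger0_norm ?subr_ge0 ?psi_phi //.
rewrite lerBlDr -lerBlDl; apply: psi_ge => // y Ky.
have [xy|xy] := ltP (dist x y) r.
  have := hr x y Kx Ky xy; rewrite ltr_norml => /andP[_ h].
  have : 0 <= n * dist x y by rewrite mulr_ge0 // dist_ge0.
  by lra.
have h1 : 2 * B <= n * dist x y.
  by apply: le_trans nr _; rewrite ler_wpM2l.
have := hB x Kx; have := hB y Ky; rewrite !ler_norml => /andP[p1 p2] /andP[q1 q2].
by lra.
Qed.

(** The kernel of the projection onto the periodic functions. *)
Definition null phi : Prop := forall eta : R, 0 < eta -> exists k0,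
  forall k z, (k0 <= k)%N -> K z -> `|iter k T phi z| <= eta.

Lemma null_step k phi : null phi -> null (iter k T phi).
Proof.
move=> h eta /h[k0 hk]; exists k0 => k' z kk Kz; rewrite -iterD.
by apply: hk => //; rewrite (leq_trans kk) // leq_addr.
Qed.

(** The convergence along the multiples of [N] is uniform over the functions
    with given bounds. It compares the present values of a null function with
    those in the far future, which are small. *)
Lemma null_decay N j : (forall (eta : R), 0 < eta -> exists k0,
  forall a b phi k n z, 0 <= a -> 0 <= b -> hbound K j a b phi ->
  (k0 <= k)%N -> K z ->
  `|iter (n * N + k) T phi z - iter k T phi z| <= eta * (a + b)) -> (0 < N)%N ->
  forall (eta : R), 0 < eta -> exists k0, forall a b phi k z, 0 <= a -> 0 <= b ->
  hbound K j a b phi -> null phi -> (k0 <= k)%N -> K z ->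
  `|iter k T phi z| <= eta * (a + b).
Proof.
move=> h N0 eta /h[k0 hk]; exists k0 => a b phi k z a0 b0 hphi nphi kk Kz.
rewrite leNgt; apply/negP; rewrite -subr_gt0.
set d := _ - _ => d0; have d2 : 0 < d / 2 by rewrite divr_gt0.
have [k1 hk1] := nphi _ d2.
have := hk a b phi k k1 z a0 b0 hphi kk Kz.
have := hk1 (k1 * N + k)%N z _ Kz.
rewrite (leq_trans (leq_pmulr k1 N0)) ?leq_addr // => /(_ isT).
move: d0 d2; rewrite /d; set u := iter _ _ _ _; set v := iter _ _ _ _ => d0 d2 hu huv.
by have := ler_normD (u - v) v; rewrite subrK distrC; lra.
Qed.

End Global.

(** * Geometric decay and the real spectral decomposition *)

Lemma lim_dist_le (R : realType) (v : nat -> R) (c eta : R) n : cvgn v ->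
  (forall m, (n <= m)%N -> `|v m - c| <= eta) -> `|limn v - c| <= eta.
Proof.
move=> cv h; rewrite leNgt; apply/negP; rewrite -subr_gt0 => d0.
have /cvgrPdist_lt/(_ _ d0) [m0 _ hm] := cv.
have := hm _ (leq_maxr n m0); have := h _ (leq_maxl n m0).
have := ler_normD (limn v - v (maxn n m0)) (v (maxn n m0) - c).
by rewrite addrA subrK /=; lra.
Qed.

Section Spectral.
Variables (R : realType) (Z : system R) (st : contracting Z).
Local Notation Y := (space Z).
Local Notation X := (maps Z).
Local Notation T := (@averaging R Z).
Variable K : set Y.
Hypothesis cK : compact K.
Hypothesis iK : forall g x, supp g -> K x -> K (act g x).
Implicit Types (x y z : Y) (s t : seq X) (phi psi f : Y -> R).

Lemma hbound_le j a b a' b' phi : a <= a' -> b <= b' ->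
  hbound K j a b phi -> hbound K j a' b' phi.
Proof.
move=> aa bb [h1 h2]; split=> [x Kx|x y Kx Ky]; first exact: le_trans (h1 x Kx) aa.
by apply: le_trans (h2 x y Kx Ky) _; rewrite ler_wpM2r // powR_ge0.
Qed.

Section Rates.
Variables (j kL N : nat) (B : R).
Hypotheses (kL0 : (0 < kL)%N) (B0 : 0 <= B) (N0 : (0 < N)%N).
Hypothesis ly : forall a b phi, 0 <= a -> 0 <= b -> hbound K j a b phi ->
  hbound K j a (2^-1 * b + B * a) (iter kL T phi).
Hypothesis conv : forall eta : R, 0 < eta -> exists k0,
  forall a b phi k n z, 0 <= a -> 0 <= b -> hbound K j a b phi ->
  (k0 <= k)%N -> K z ->
  `|iter (n * N + k) T phi z - iter k T phi z| <= eta * (a + b).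

Lemma lasota_yorke_iter i a b phi : 0 <= a -> 0 <= b -> hbound K j a b phi ->
  hbound K j a (2^-1 ^+ i * b + 2 * B * a) (iter (i * kL) T phi).
Proof.
move=> a0 b0 h; have Ba : 0 <= B * a by rewrite mulr_ge0.
elim: i => [|i IH].
  by apply: hbound_le h; rewrite // expr0 mul1r -mulrA lerDl mulr_ge0.
rewrite mulSn iterD.
have b' : 0 <= 2^-1 ^+ i * b + 2 * B * a.
  by rewrite addr_ge0 // ?mulr_ge0 ?exprn_ge0 ?invr_ge0.
apply: hbound_le (ly a0 b' IH) => //.
by rewrite exprS le_eqVlt; apply/orP; left; apply/eqP; field.
Qed.

(** The powers of the averaging operator are bounded in Hoelder norm, by the
    Lasota-Yorke inequality and the trivial bound for the remaining steps. *)
Lemma hoelder_bounded : exists2 C2 : R, 0 <= C2 & forall k a b phi,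
  0 <= a -> 0 <= b -> hbound K j a b phi ->
  hbound K j a (C2 * (a + b)) (iter k T phi).
Proof.
have [l l1 hl] := act_lip cK; have l0 : 0 < l by exact: lt_le_trans l1.
have p0 : 0 <= (l ^+ kL) `^ expo R j := powR_ge0 _ _.
exists ((l ^+ kL) `^ expo R j + 2 * B); first by rewrite addr_ge0 // mulr_ge0.
move=> k a b phi a0 b0 h; rewrite (divn_eq k kL) iterD.
have uphi := hbound_uc h; have [ha _] := h.
have h1 : hbound K j a ((l ^+ kL) `^ expo R j * b) (iter (k %% kL) T phi).
  split=> [x Kx|x y Kx Ky]; first exact: (iter_T_bound cK iK).
  apply: le_trans (iter_T_holder cK iK (k %% kL) l1 b0 hl h Kx Ky) _.
  rewrite powRM ?exprn_ge0 ?dist_ge0 ?(ltW l0) // mulrCA mulrA.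
  rewrite ler_wpM2r ?powR_ge0 // ler_wpM2r // expo_le ?exprn_ge0 ?(ltW l0) //.
  by rewrite ler_weXn2l // ltnW // ltn_pmod.
apply: hbound_le (lasota_yorke_iter (k %/ kL) a0 _ h1) => //; last by rewrite mulr_ge0.
have p1 : 2^-1 ^+ (k %/ kL) <= 1 :> R by rewrite exprn_ile1 ?invr_ge0 // invf_le1 ?ler1n.
move: p0; set p := _ `^ _ => p0.
have : 2^-1 ^+ (k %/ kL) * (p * b) <= p * b by rewrite ler_piMl // mulr_ge0.
have : 0 <= B * b by rewrite mulr_ge0.
have : 0 <= p * a by rewrite mulr_ge0.
by lra.
Qed.

(** A null function, however it spreads its bound between the sup norm and the
    Hoelder seminorm, loses half of it in a fixed time: first the sup norm
    becomes small, then the Lasota-Yorke inequality takes care of the seminorm. *)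
Lemma null_halving : exists2 k, (0 < k)%N & forall a b phi,
  0 <= a -> 0 <= b -> hbound K j a b phi -> null K phi ->
  exists a' b', [/\ 0 <= a', 0 <= b', a' + b' <= 2^-1 * (a + b) &
    hbound K j a' b' (iter k T phi)].
Proof.
have [C2 C20 hC2] := hoelder_bounded.
have [i hi] := half_le (2 * C2).
pose eta := (4 * (1 + 2 * B))^-1.
have d0 : 0 < 1 + 2 * B by rewrite ltr_pwDl // mulr_ge0.
have eta0 : 0 < eta by rewrite invr_gt0 mulr_gt0.
have [k0 hk0] := null_decay conv N0 eta0.
exists (i.+1 * kL + k0)%N; first by rewrite addn_gt0 muln_gt0 kL0.
move=> a b phi a0 b0 h nphi; have ab : 0 <= a + b by exact: addr_ge0.
have h1 : hbound K j (eta * (a + b)) (C2 * (a + b)) (iter k0 T phi).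
  have [_ h2] := hC2 k0 a b phi a0 b0 h; split=> // x Kx.
  exact: (hk0 a b phi).
have ea : 0 <= eta * (a + b) by rewrite mulr_ge0 // ltW.
have Ca : 0 <= C2 * (a + b) by rewrite mulr_ge0.
exists (eta * (a + b)), (2^-1 ^+ i.+1 * (C2 * (a + b)) + 2 * B * (eta * (a + b))).
split=> //.
- by apply: addr_ge0; apply: mulr_ge0 => //; rewrite ?exprn_ge0 ?invr_ge0 ?mulr_ge0.
- have e1 : eta * (1 + 2 * B) = 4^-1.
    by rewrite /eta invfM -mulrA mulVf ?mulr1 // lt0r_neq0.
  have h2 : 2^-1 ^+ i.+1 * C2 <= 4^-1.
    rewrite exprS; move: hi; set u := _ ^+ i; lra.
  have h3 : 2^-1 ^+ i.+1 * C2 * (a + b) <= 4^-1 * (a + b) by rewrite ler_wpM2r.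
  have -> : eta * (a + b) + (2^-1 ^+ i.+1 * (C2 * (a + b)) + 2 * B * (eta * (a + b)))
      = eta * (1 + 2 * B) * (a + b) + 2^-1 ^+ i.+1 * C2 * (a + b) by ring.
  by rewrite e1; lra.
- by rewrite iterD; apply: lasota_yorke_iter.
Qed.

Lemma null_rate : exists lam C3 : R, [/\ 0 < lam < 1, 0 < C3 &
  forall n a b phi, 0 <= a -> 0 <= b -> hbound K j a b phi -> null K phi ->
  exists a' b', [/\ 0 <= a', 0 <= b', a' + b' <= C3 * lam ^+ n * (a + b) &
    hbound K j a' b' (iter n T phi)]].
Proof.
have [C2 C20 hC2] := hoelder_bounded; have [k k0 hk] := null_halving.
have step q a b phi : 0 <= a -> 0 <= b -> hbound K j a b phi -> null K phi ->
    exists a' b', [/\ 0 <= a', 0 <= b', a' + b' <= 2^-1 ^+ q * (a + b) &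
      hbound K j a' b' (iter (q * k) T phi)].
  move=> a0 b0 h nphi; elim: q => [|q [a' [b' [a'0 b'0 ab h']]]].
    by exists a, b; rewrite expr0 mul1r.
  have [a2 [b2 [a20 b20 ab2 h2]]] := hk a' b' _ a'0 b'0 h' (null_step (q * k) nphi).
  exists a2, b2; split=> //; last by rewrite mulSn iterD.
  apply: le_trans ab2 _; rewrite exprS -mulrA ler_wpM2l //.
(* Bernoulli's inequality makes [lam ^+ k] at least one half. *)
pose lam : R := 1 - (2 * k%:R)^-1.
have k1 : 1 <= k%:R :> R by rewrite ler1n.
have kV : 0 < (2 * k%:R : R)^-1 <= 2^-1.
  have k2 : 0 < 2 * k%:R :> R by lra.
  apply/andP; split; first by rewrite invr_gt0.
  by rewrite lef_pV2 ?posrE //; lra.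
have lam01 : 0 < lam < 1 by rewrite /lam; apply/andP; split; lra.
have /andP[lam0 lam1] := lam01.
have lamk : 2^-1 <= lam ^+ k.
  have bern i : 1 - i%:R * (2 * k%:R)^-1 <= lam ^+ i.
    elim: i => [|i IH]; first by rewrite mul0r subr0 expr0.
    rewrite exprS; have i0 : 0 <= i%:R :> R by [].
    have := ler_wpM2l (ltW lam0) IH; apply: le_trans.
    by rewrite /lam -natr1; nra.
  apply: le_trans (bern k); rewrite invfM mulrCA divff ?lt0r_neq0 ?(lt_le_trans ltr01) //.
  by rewrite mulr1; lra.
exists lam, (2 * (1 + C2)); split=> //; first by rewrite mulr_gt0 // ltr_pwDl.
move=> n a b phi a0 b0 h nphi; have ab0 : 0 <= a + b by exact: addr_ge0.
have [a' [b' [a'0 b'0 ab h']]] := step (n %/ k)%N a b phi a0 b0 h nphi.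
exists a', (C2 * (a' + b')); split=> //.
- by rewrite mulr_ge0 // addr_ge0.
- have p : 2^-1 ^+ (n %/ k) <= 2 * lam ^+ n.
    apply: (@le_trans _ _ (lam ^+ (k * (n %/ k)))).
      by rewrite exprM lerXn2r ?nnegrE ?exprn_ge0 ?invr_ge0 // ltW.
    have -> : lam ^+ n = lam ^+ (k * (n %/ k)) * lam ^+ (n %% k).
      by rewrite -exprD mulnC -divn_eq.
    have h1 : 2^-1 <= lam ^+ (n %% k).
      by apply: le_trans lamk _; rewrite ler_wiXn2l ?(ltW lam0) ?(ltW lam1) // ltnW // ltn_pmod.
    have h2 : 0 <= lam ^+ (k * (n %/ k)) by rewrite exprn_ge0 // ltW.
    by nra.
  have h1 : a' + b' <= 2 * lam ^+ n * (a + b).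
    by apply: le_trans ab _; rewrite ler_wpM2r.
  have h2 : C2 * (a' + b') <= C2 * (2 * lam ^+ n * (a + b)) by rewrite ler_wpM2l.
  by move: (lam ^+ n) h1 h2 => v; lra.
- by rewrite [in iter n](divn_eq n k) addnC iterD; exact: hC2.
Qed.

Lemma uc_convergence phi (eta : R) : uc K phi -> 0 < eta -> exists k0,
  forall k n z, (k0 <= k)%N -> K z ->
  `|iter (n * N + k) T phi z - iter k T phi z| <= eta.
Proof.
move=> uphi eta0; have e4 : 0 < eta / 4 by rewrite divr_gt0.
have [a [b [psi [a0 b0 hpsi near]]]] := hbound_dense cK j uphi e4.
have upsi := hbound_uc hpsi; have ab : 0 <= a + b by exact: addr_ge0.
have d0 : 0 < eta / 4 / (a + b + 1) by rewrite divr_gt0 // ltr_wpDl.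
have [k0 hk] := conv d0; exists k0 => k n z kk Kz.
have := hk a b psi k n z a0 b0 hpsi kk Kz.
have : eta / 4 / (a + b + 1) * (a + b) <= eta / 4.
  by rewrite mulrAC ler_pdivrMr ?ltr_wpDl // ler_wpM2l ?(ltW e4) // lerDl.
have close k' : `|iter k' T phi z - iter k' T psi z| <= eta / 4.
  rewrite -[leRHS](@iter_T_cst _ Z k' _ z).
  apply: (iter_T_dist cK iK) => //; first exact: uc_cst.
  by move=> s ws _; apply: near; exact: run_inv.
have := close (n * N + k)%N; have := close k.
rewrite !ler_norml => /andP[p1 p2] /andP[q1 q2] r /andP[t1 t2].
by apply/andP; split; lra.
Qed.

(** The limit of the averages at the multiples of [N] splits off the part that
    recurs. *)
Lemma decomposition : exists2 C3 : R, 0 <= C3 & forall phi, uc K phi ->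
  exists psi, [/\ uc K psi, forall z, K z -> iter N T psi z = psi z,
    null K (fun z => -1 * psi z + phi z) &
    forall a b, 0 <= a -> 0 <= b -> hbound K j a b phi ->
      hbound K j a (C3 * (a + b)) psi].
Proof.
have [C2 C20 hC2] := hoelder_bounded; exists C2 => // phi uphi.
have uk k : uc K (iter k T phi) by exact: iter_T_uc.
pose u z n := iter (n * N) T phi z.
have cvu z : K z -> cvgn (u z).
  move=> Kz; apply: cauchy_cvg; apply: cauchy_exP => eta eta0.
  have e2 : 0 < eta / 2 by rewrite divr_gt0.
  have [k0 hk] := uc_convergence uphi e2; exists (u z k0), k0 => // n /= kn.
  rewrite /ball /= distrC /u -(subnK kn) mulnDl.
  have km : (k0 <= k0 * N)%N by rewrite leq_pmulr.
  have := hk _ (n - k0)%N z km Kz; move/le_lt_trans; apply.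
  by rewrite ltr_pdivrMr // ltr_pMr // ltr1n.
pose psi z := lim (u z @ \oo).
have close (eta : R) : 0 < eta -> exists k0, forall n z, (k0 <= n)%N -> K z ->
    `|u z n - psi z| <= eta.
  move=> eta0; have [k0 hk] := uc_convergence uphi eta0; exists k0 => n z kn Kz.
  rewrite distrC; apply: (@lim_dist_le _ (u z) _ _ n) => // [|m nm]; first exact: cvu.
  have km : (k0 <= n * N)%N by rewrite (leq_trans kn) // leq_pmulr.
  by have := hk _ (m - n)%N z km Kz; rewrite -mulnDl subnK.
have upsi : uc K psi.
  move=> eta eta0; have e4 : 0 < eta / 4 by rewrite divr_gt0.
  have [k0 hk] := close _ e4; have e2 : 0 < eta / 2 by rewrite divr_gt0.
  have [r r0 hr] := uk (k0 * N)%N _ e2; exists r => // x y Kx Ky xy.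
  have := hk k0 x (leqnn _) Kx; have := hk k0 y (leqnn _) Ky; have := hr x y Kx Ky xy.
  rewrite /u !ler_norml !ltr_norml => /andP[p1 p2] /andP[q1 q2] /andP[t1 t2].
  by apply/andP; split; lra.
have fixN z : K z -> iter N T psi z = psi z.
  move=> Kz; apply/eqP; rewrite -subr_eq0 -normr_le0 leNgt; apply/negP => d0.
  have d4 : 0 < `|iter N T psi z - psi z| / 4 by rewrite divr_gt0.
  have [k0 hk] := close _ d4.
  have h1 := hk k0.+1 z (leqnSn _) Kz.
  have h2 : `|iter N T psi z - u z k0.+1| <= `|iter N T psi z - psi z| / 4.
    rewrite /u mulSn iterD.
    rewrite -[leRHS](@iter_T_cst _ Z N _ z).
    apply: (iter_T_dist cK iK) => //; first exact: uc_cst.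
    by move=> s ws _; rewrite distrC; apply: hk => //; exact: run_inv.
  have := ler_normD (iter N T psi z - u z k0.+1) (u z k0.+1 - psi z).
  rewrite addrA subrK.
  by move: h1 h2 d0; set p := `|_ - _|; set q := `|_|; set w := `|_|; lra.
exists psi; split=> //.
  move=> eta eta0; have [k0 hk] := close _ eta0; exists (k0 * N)%N => k z kk Kz.
  have ud : uc K (fun z => -1 * psi z + phi z) by exact: uc_lin.
  have h z' : K z' -> `|iter (k0 * N) T (fun z => -1 * psi z + phi z) z'| <= eta.
    move=> Kz'; rewrite (iter_T_lin cK iK) // mulN1r addrC.
    have -> : iter (k0 * N) T psi z' = psi z'; last exact: hk.
    elim: (k0) => // i IH; rewrite mulSnr iterD -[RHS]IH.
    by apply: (iter_T_ext cK iK) => //; exact: iter_T_uc.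
  rewrite -(subnK kk) iterD.
  by apply: (iter_T_bound cK iK) => //; exact: iter_T_uc.
move=> a b a0 b0 h; have [ha _] := h; split=> [z Kz|x y Kx Ky].
  rewrite -[psi z]subr0; apply: (@lim_dist_le _ (u z) _ _ 0) => [|m _]; first exact: cvu.
  by rewrite subr0; exact: (iter_T_bound cK iK).
rewrite leNgt; apply/negP; rewrite -subr_gt0 => d0.
set d := _ - _ in d0; have d4 : 0 < d / 4 by rewrite divr_gt0.
have [k0 hk] := close _ d4; have := hk k0 x (leqnn _) Kx; have := hk k0 y (leqnn _) Ky.
have [_ /(_ x y Kx Ky)] := hC2 (k0 * N)%N a b phi a0 b0 h; rewrite -/(u x k0) -/(u y k0).
have := ler_normD (psi x - u x k0) (u x k0 - u y k0 + (u y k0 - psi y)).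
have := ler_normD (u x k0 - u y k0) (u y k0 - psi y).
have -> : psi x - u x k0 + (u x k0 - u y k0 + (u y k0 - psi y)) = psi x - psi y by ring.
by move: d0 d4; rewrite /d (distrC (psi x) (u x k0)); lra.
Qed.

End Rates.

(** The averaging operator acts with finite order on a complement of the null
    functions, and with a spectral gap on these. *)
Theorem real_spectral : exists (N j : nat) (lam C : R),
  [/\ [/\ (0 < N)%N, (0 < j)%N, 0 < lam < 1 & 0 < C],
  forall phi, uc K phi ->
    exists psi, [/\ uc K psi, forall z, K z -> iter N T psi z = psi z,
    null K (fun z => -1 * psi z + phi z) &
    forall a b, 0 <= a -> 0 <= b -> hbound K j a b phi ->
      hbound K j a (C * (a + b)) psi] &
  forall n a b phi, 0 <= a -> 0 <= b -> hbound K j a b phi -> null K phi ->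
    exists a' b', [/\ 0 <= a', 0 <= b', a' + b' <= C * lam ^+ n * (a + b) &
    hbound K j a' b' (iter n T phi)]].
Proof.
have [K0|K0] := pselect (K !=set0); last first.
  have nK z : ~ K z by move=> Kz; apply: K0; exists z.
  exists 1%N, 1%N, 2^-1, 1; split; first by split=> //; apply/andP; split; lra.
    move=> phi uphi; exists phi; split=> //; [by move=> z /nK| |].
      by move=> eta _; exists 0%N => k z _ /nK.
    by move=> a b _ _ _; split=> [z /nK|x y /nK].
  move=> n a b phi a0 b0 _ _; exists 0, 0; split=> //; last by split=> [z /nK|x y /nK].
  by rewrite addr0 !mulr_ge0 ?exprn_ge0 ?invr_ge0 ?addr_ge0.
have [j [kL [B [j0 kL0 B0 ly]]]] := lasota_yorke st cK iK K0.
have [N N0 conv] := global_convergence st cK iK.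
have [C2 C20 dec] := decomposition kL0 B0 N0 ly (conv j).
have [lam [C3 [lam01 C30 rate]]] := null_rate kL0 B0 N0 ly (conv j).
exists N, j, lam, (C2 + C3); split; first by split=> //; rewrite ltr_wpDl.
  move=> phi /dec[psi [upsi per nl hb]]; exists psi; split=> // a b a0 b0 h.
  apply: hbound_le (hb a b a0 b0 h) => //.
  by rewrite ler_wpM2r ?addr_ge0 // lerDl ltW.
move=> n a b phi a0 b0 h nl; have [a' [b' [a'0 b'0 ab h']]] := rate n a b phi a0 b0 h nl.
exists a', b'; split=> //; apply: le_trans ab _.
have /andP[/ltW lam0 _] := lam01.
by rewrite ler_wpM2r ?addr_ge0 // ler_wpM2r ?exprn_ge0 // lerDr.
Qed.

End Spectral.

(** * Linear spans and roots of unity *)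

Section Span.
Variables (R : realType) (T : Type).
Local Notation C := R[i].
Implicit Types (V A : set (T -> C)).

(** The coefficients of a free family in terms of a spanning one form a matrix
    with a right inverse, whose rank bounds both sizes. *)
Lemma has_cdim_unique V n m : has_cdim V n -> has_cdim V m -> n = m.
Proof.
suff le k l : has_cdim V k -> has_cdim V l -> (k <= l)%N.
  by move=> hn hm; apply/eqP; rewrite eqn_leq !le.
move=> [b [Vb fb sb]] [b' [Vb' _ sb']].
have [A hA] := boolp.choice (fun i => sb' _ (Vb i)).
have [B hB] := boolp.choice (fun i => sb _ (Vb' i)).
have e : (\matrix_(i, j) A i j) *m (\matrix_(i, j) B i j) = 1%:M :> 'M[C]_k.
  apply/matrixP => i j; apply/eqP; rewrite -subr_eq0; apply/eqP.
  pose a j := ((\matrix_(i, j) A i j) *m (\matrix_(i, j) B i j) - 1%:M) i j : C.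
  have := fb a _ j; rewrite /a !mxE; apply.
  apply/funext => z; rewrite /lcomb.
  under eq_bigr do rewrite !mxE mulrBl.
  rewrite sumrB [X in _ - X](bigD1 i) //= [X in _ - (_ + X)]big1 ?addr0 => [|j' /negPf jj]; last first.
    by rewrite eq_sym jj mul0r.
  rewrite eqxx mul1r; apply/eqP; rewrite subr_eq0; apply/eqP.
  under eq_bigr do rewrite mulr_suml.
  rewrite exchange_big /= hA /lcomb; apply: eq_bigr => h _.
  rewrite hB /lcomb mulr_sumr; apply: eq_bigr => j' _.
  by rewrite !mxE mulrA.
by rewrite -[k](mxrank1 C) -e (leq_trans (mxrankM_maxl _ _)) ?rank_leq_col.
Qed.

Lemma cdimE V n : has_cdim V n -> cdim V = n.
Proof.
move=> h; apply: (has_cdim_unique _ h); rewrite /cdim.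
by apply: (@xgetPex _ 0%N [set m | has_cdim V m]); exists n.
Qed.

Lemma cspan_sum A n (f : 'I_n -> T -> C) :
  (forall i, f i = (fun=> 0) \/ A (f i)) -> cspan A (fun z => \sum_i f i z).
Proof.
move=> h; have [[b0 Ab0]|no] := pselect (exists b0, A b0); last first.
  exists 0, (fun _ _ => 0), (fun=> 0); split=> [[]//|].
  apply/funext => z; rewrite /lcomb big_ord0 big1 // => i _.
  by have [->//|Af] := h i; case: no; exists (f i).
exists n, (fun i => if `[< A (f i) >] then f i else b0), (fun i => `[< A (f i) >]%:R).
split=> [i|]; first by case: asboolP.
apply/funext => z; apply: eq_bigr => i _; case: asboolP => [|nA]; first by rewrite mul1r.
by have [->|//] := h i; rewrite mul0r.
Qed.

End Span.

Section RootsOfUnity.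
Variables (R : realType).
Local Notation C := R[i].

Lemma complex_prim_root n : (0 < n)%N -> exists w : C, n.-primitive_root w.
Proof.
move=> n0; pose p : {poly C} := 'X^n - 1; have [r Dp] := closed_field_poly_normal p.
have sz_p : size p = n.+1 by rewrite size_XnsubC.
rewrite (monicP _) ?scale1r ?monicXnsubC // in Dp.
have rn1 : all n.-unity_root r by apply/allP => z; rewrite -root_prod_XsubC -Dp.
have sz_r : (n < (size r).+1)%N by rewrite -(size_prod_XsubC r id) -Dp sz_p.
have [|z] := hasP (has_prim_root n0 rn1 _ sz_r); last by exists z.
by rewrite -separable_prod_XsubC -Dp separable_Xn_sub_1 // pnatr_eq0 -lt0n.
Qed.

Lemma prim_root_neq0 n (w : C) : n.-primitive_root w -> w != 0.
Proof.
move=> pw; apply/eqP => e; have := prim_expr_order pw; rewrite e expr0n.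
by rewrite (negPf (lt0n_neq0 (prim_order_gt0 pw))) => /eqP; rewrite eq_sym oner_eq0.
Qed.

Lemma prim_root_sum n (w : C) k : n.-primitive_root w -> (0 < k < n)%N ->
  \sum_(i < n) (w ^+ k)^-1 ^+ i = 0.
Proof.
move=> pw /andP[k0 kn]; have w0 := prim_root_neq0 pw.
have : (w ^+ k)^-1 - 1 != 0.
  rewrite subr_eq0 invr_eq1 -(expr0 w) (eq_prim_root_expr pw) mod0n modn_small //.
  by rewrite -lt0n.
apply: contraNeq => s0; rewrite -(mulIr_eq0 _ (mulIf s0)) -subrX1.
by rewrite exprVn -exprM mulnC exprM (prim_expr_order pw) expr1n invr1 subrr.
Qed.

(** A finite set of nonzero numbers that is stable under the products of its
    members is a group: multiplication by a member permutes it. *)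
Lemma mul_closed_expr (es : seq C) (a : C) : uniq es -> (forall b, b \in es -> b != 0) ->
  (forall b c, b \in es -> c \in es -> b * c \in es) -> a \in es ->
  a ^+ size es = 1.
Proof.
move=> ues nz mc ae; have a0 := nz a ae.
have um : uniq [seq a * b | b <- es] by rewrite map_inj_uniq //; exact: mulfI.
have sub : {subset [seq a * b | b <- es] <= es}.
  by move=> _ /mapP[b be ->]; exact: mc.
have [_ e] := uniq_min_size um sub (eq_leq (esym (size_map _ _))).
have E1 : \prod_(b <- [seq a * b | b <- es]) b = \prod_(b <- es) b.
  by apply: perm_big; exact: uniq_perm.
rewrite big_map big_split /= in E1.
have p0 : \prod_(b <- es) b != 0.
  by rewrite prodf_seq_neq0; apply/allP => b be; exact: nz.
move: E1; rewrite big_const_seq count_predT iter_mulr_1 => E1.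
by apply: (mulIf p0); rewrite mul1r.
Qed.

(** Evaluating a polynomial that vanishes at all the [w j] but one isolates the
    corresponding coefficient. *)
Lemma power_sums_eq0 n (w c : 'I_n -> C) : injective w ->
  (forall k, \sum_i c i * w i ^+ k = 0) -> forall i, c i = 0.
Proof.
move=> winj h i.
have hp (p : {poly C}) : \sum_j c j * p.[w j] = 0.
  under eq_bigr do rewrite horner_coef mulr_sumr.
  rewrite exchange_big /= big1 // => k _.
  transitivity (p`_k * \sum_j c j * w j ^+ k); last by rewrite h mulr0.
  by rewrite mulr_sumr; apply: eq_bigr => j _; rewrite mulrCA.
pose q : {poly C} := \prod_(j | j != i) ('X - (w j)%:P).
have := hp q; rewrite (bigD1 i) //= big1 ?addr0 => [/eqP|j ji]; last first.
  by rewrite /q horner_prod (bigD1 j) //= hornerXsubC subrr mul0r mulr0.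
rewrite mulf_eq0 => /orP[/eqP//|]; rewrite /q horner_prod => /prodf_eq0[j ji].
by rewrite hornerXsubC subr_eq0 => /eqP/winj e; rewrite e eqxx in ji.
Qed.

End RootsOfUnity.

(** * Random Henon maps and their action on complex functions *)

Section Instance.
Variables (R : realType) (tau : probability (borelXplus R) R).
Hypothesis tau_compact : compact (meas_support tau).

Definition henon : system R :=
  @System R (Y R) (Xplus R) (@ydist R) (@xext R) (meas_support tau) (mean tau)
    (@ydist_ge0 R) (@ydistxx R) (@ydist_eq0 R) (@ydistC R) (@ydist_triangle R)
    (@ydist_le2 R) (@near_ydist R) (fun g x e => @near_xext R g x e)
    (fun K cK => xext_lip tau_compact cK)
    (mean_cst tau) (fun a f f' h h' => mean_lin tau_compact a h h')
    (mean_ge0 (tau := tau))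
    (fun f g h f0 sg fg => mean_gt0 tau_compact h f0 sg fg).

Local Notation Z := henon.

Lemma semigroup_orbit z : [set h z | h in semigroup tau] = @orbit R Z z.
Proof.
apply/seteqP; split=> [_ [h [s [s0 ws ->]] <-]|_ [s [ws s0 ->]]].
  by exists s.
by exists (compose s) => //; exists s.
Qed.

Lemma minimal_setsE : minimal_sets tau = @minimal R Z.
Proof.
apply/seteqP; split=> L [L0 cL h]; split=> // z Lz; rewrite (h z Lz);
  by rewrite semigroup_orbit.
Qed.

Lemma mean_stable_contracting : mean_stable tau -> inhabited (contracting Z).
Proof.
move=> [n [m [U [Q [c [[n0 m0] hU [cQ _ QU] c01 [hs hz]]]]]]].
have UQ (s : seq (maps Z)) : word (Z := Z) s -> size s = n ->
    forall z, (\bigcup_j U j) z -> Q (@run R Z s z).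
  move=> ws ss z Uz; move/eqP in ss.
  by have [sub _] := hs (Tuple ss) ws; apply: sub; exists z.
have Uc (s : seq (maps Z)) : word (Z := Z) s -> size s = n ->
    forall j x y, U j x -> U j y ->
      @dist R Z (run (Z := Z) s x) (run (Z := Z) s y) <= c * @dist R Z x y.
  move=> ws ss j x y Ux Uy; move/eqP in ss.
  by have [_ h] := hs (Tuple ss) ws; exact: (h j).
constructor; apply: (@Contracting R Z n 'I_m U Q c n0 _ cQ QU c01 UQ Uc).
  by move=> j; have [] := hU j.
move=> z; have [h [s [s0 ws ->]] Uh] := hz z.
by exists s.
Qed.

Lemma forward_inv (K : set (Y R)) : forward_invariant tau K ->
  forall (g : maps Z) (x : space Z), supp g -> K x -> K (act g x).
Proof.
move=> h g x sg Kx; apply: (h (compose [:: g])); last by exists x.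
by exists [:: g]; split=> // g'; rewrite inE => /eqP ->.
Qed.

End Instance.

Section Complex.
Variables (R : realType) (tau : probability (borelXplus R) R).
Hypothesis tau_compact : compact (meas_support tau).
Local Notation C := R[i].
Local Notation Z := (henon tau_compact).
Local Notation T := (@averaging R Z).
Variable K : set (Y R).
Hypothesis cK : compact K.
Hypothesis iK : forall (g : maps Z) (x : space Z), supp g -> K x -> K (act g x).
Implicit Types (phi psi : Y R -> C).

Definition rpart phi : Y R -> R := fun z => complex.Re (phi z).
Definition ipart phi : Y R -> R := fun z => complex.Im (phi z).

Lemma cmod_re (a : C) : `|complex.Re a| <= cmod a.
Proof.
by case: a => x y /=; rewrite -sqrtr_sqr ler_wsqrtr // lerDl sqr_ge0.
Qed.

Lemma cmod_im (a : C) : `|complex.Im a| <= cmod a.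
Proof.
by case: a => x y /=; rewrite -sqrtr_sqr ler_wsqrtr // lerDr sqr_ge0.
Qed.

Lemma cmod_le_parts (a : C) : cmod a <= `|complex.Re a| + `|complex.Im a|.
Proof.
case: a => x y /=; rewrite -[leRHS]ger0_norm ?addr_ge0 // -sqrtr_sqr ler_wsqrtr //.
rewrite -(real_normK (num_real x)) -(real_normK (num_real y)).
by have := normr_ge0 x; have := normr_ge0 y; nra.
Qed.

(** On a compact set continuity is uniform and can be tested on real and
    imaginary parts. *)
Lemma cfunP phi : cfun K phi <->
  [/\ @uc R Z K (rpart phi), @uc R Z K (ipart phi) & forall z, ~ K z -> phi z = 0].
Proof.
split=> [[/subspace_continuousP cphi z0]|[ur ui z0]].
  have ucC (e : R) : 0 < e -> exists2 r : R, 0 < r & forall x y, K x -> K y ->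
      ydist x y < r -> cmod (phi x - phi y) < e.
    move=> e0; have e2 : 0 < e / 2 by rewrite divr_gt0.
    have [x Kx|r r0 hr] := @compact_uniform R Z K (fun r x => forall y, K y ->
      ydist x y < r -> cmod (phi x - phi y) < e) cK; last by exists r => // x y Kx; exact: hr.
    have : nbhs x [set y | K y -> cmod (phi y - phi x) < e / 2].
      exact: (cphi x Kx _ (near_cmod (phi x) e2)).
    rewrite nbhsE => -[V [oV Vx] VP].
    have [r r0 hr] := @open_ball_sub R Z K V x cK oV Vx.
    have near y : K y -> ydist x y < r -> cmod (phi y - phi x) < e / 2.
      by move=> Ky xy; apply: VP => //; exact: hr.
    have r2 : 0 < r / 2 by rewrite divr_gt0.
    exists (r / 2) => // y r' Ky xy r'0 r'r w Kw yw.
    have xw : ydist x w < r.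
      apply: le_lt_trans (ydist_triangle x y w) _; rewrite (splitr r) ltrD //.
      exact: lt_trans r'r.
    have xy' : ydist x y < r by apply: lt_trans xy _; lra.
    have := near y Ky xy'; have := near w Kw xw.
    have := le_normcD (phi y - phi x) (- (phi w - phi x)).
    rewrite normcN opprB addrA subrK; lra.
  split=> // e e0; have [r r0 hr] := ucC e e0; exists r => // x y Kx Ky xy.
    by apply: le_lt_trans (hr x y Kx Ky xy); rewrite /rpart -raddfB; exact: cmod_re.
  by apply: le_lt_trans (hr x y Kx Ky xy); rewrite /ipart -raddfB; exact: cmod_im.
split=> //; apply/subspace_continuousP => x Kx; apply/cvgrPdist_lt => e e0.
have e0R : 0 < complex.Re e by move: e0; rewrite ltcE /= => /andP[].
have eE : e = (complex.Re e)%:C%C.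
  by case: e e0 {e0R} => u v; rewrite ltcE /= => /andP[/eqP ->].
have e2 : 0 < complex.Re e / 2 by rewrite divr_gt0.
have [r1 r10 h1] := ur _ e2; have [r2 r20 h2] := ui _ e2.
have r0 : 0 < Num.min r1 r2 by rewrite lt_min r10.
rewrite /within /=; apply: filterS (near_ydist x r0) => y.
rewrite lt_min => /andP[xy1 xy2] Ky.
have -> : `|phi x - phi y| = (cmod (phi x - phi y))%:C%C.
  by rewrite normc_def; case: (phi x - phi y).
rewrite eE ltcR; apply: le_lt_trans (cmod_le_parts _) _.
rewrite (splitr (complex.Re e)) ltrD // raddfB; [exact: h1|exact: h2].
Qed.

Lemma trans_opE phi z : K z ->
  trans_op tau K phi z = Complex (T (rpart phi) z) (T (ipart phi) z).
Proof. by move=> Kz; rewrite /trans_op mem_set. Qed.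

Lemma trans_op0 phi z : ~ K z -> trans_op tau K phi z = 0.
Proof. by move=> nKz; rewrite /trans_op memNset. Qed.

Lemma complex_ext (a b : C) :
  complex.Re a = complex.Re b -> complex.Im a = complex.Im b -> a = b.
Proof. by case: a => x y; case: b => u v /= -> ->. Qed.

Lemma uc_ext (f h : space Z -> R) : (forall z, K z -> f z = h z) ->
  @uc R Z K f -> @uc R Z K h.
Proof.
move=> e uf r r0; have [d d0 hd] := uf r r0; exists d => // x y Kx Ky xy.
by rewrite -!e //; exact: hd.
Qed.

Lemma trans_op_cfun phi : cfun K phi -> cfun K (trans_op tau K phi).
Proof.
move=> /cfunP[ur ui _]; apply/cfunP; split; last by move=> z; exact: trans_op0.
  by apply: uc_ext (@T_uc R Z K cK iK _ ur) => z Kz; rewrite /rpart trans_opE.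
by apply: uc_ext (@T_uc R Z K cK iK _ ui) => z Kz; rewrite /ipart trans_opE.
Qed.

Lemma iter_cfun n phi : cfun K phi -> cfun K (iter n (trans_op tau K) phi).
Proof. by move=> h; elim: n => //= n; exact: trans_op_cfun. Qed.

Lemma iter_parts n phi z : cfun K phi -> K z ->
  rpart (iter n (trans_op tau K) phi) z = iter n T (rpart phi) z /\
  ipart (iter n (trans_op tau K) phi) z = iter n T (ipart phi) z.
Proof.
move=> h; elim: n z => [//|n IH] z Kz.
have /cfunP[ur ui _] := iter_cfun n h; have /cfunP[ur0 ui0 _] := h.
rewrite !iterS; split.
  rewrite {1}/rpart trans_opE //=.
  apply: (@iter_T_ext R Z K cK iK 1 _ _ z ur _ Kz) => [|y Ky]; last exact: (IH y Ky).1.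
  exact: (@iter_T_uc R Z K cK iK).
rewrite {1}/ipart trans_opE //=.
apply: (@iter_T_ext R Z K cK iK 1 _ _ z ui _ Kz) => [|y Ky]; last exact: (IH y Ky).2.
exact: (@iter_T_uc R Z K cK iK).
Qed.

Lemma cfun_lin (c : C) phi psi : cfun K phi -> cfun K psi ->
  cfun K (fun z => c * phi z + psi z).
Proof.
move=> /cfunP[ur ui z0] /cfunP[vr vi w0]; apply/cfunP; split.
- apply: uc_ext (uc_lin (complex.Re c) ur (uc_lin (- complex.Im c) ui vr)) => z _.
  by rewrite /rpart /ipart; case: c (phi z) (psi z) => [? ?] [? ?] [? ?] /=; ring.
- apply: uc_ext (uc_lin (complex.Re c) ui (uc_lin (complex.Im c) ur vi)) => z _.
  by rewrite /rpart /ipart; case: c (phi z) (psi z) => [? ?] [? ?] [? ?] /=; ring.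
- by move=> z nK; rewrite z0 // w0 // mulr0 addr0.
Qed.

Lemma trans_op_lin (c : C) phi psi : cfun K phi -> cfun K psi ->
  trans_op tau K (fun z => c * phi z + psi z)
  = (fun z => c * trans_op tau K phi z + trans_op tau K psi z).
Proof.
move=> h1 h2; have /cfunP[ur ui z0] := h1; have /cfunP[vr vi w0] := h2.
apply/funext => z; have [Kz|nK] := pselect (K z); last by rewrite !trans_op0 // mulr0 addr0.
have /cfunP[wr wi _] := cfun_lin c h1 h2.
have lin2 (p q : R) (f1 f2 f3 h : space Z -> R) : @uc R Z K f1 -> @uc R Z K f2 ->
    @uc R Z K f3 -> @uc R Z K h ->
    (forall y, K y -> h y = p * f1 y + (q * f2 y + f3 y)) ->
    T h z = p * T f1 z + (q * T f2 z + T f3 z).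
  move=> u1 u2 u3 uh e; have u23 := uc_lin q u2 u3.
  rewrite -(T_lin iK q u2 u3 Kz) -(T_lin iK p u1 u23 Kz).
  exact: (@iter_T_ext R Z K cK iK 1 _ _ z uh (uc_lin p u1 u23) Kz e).
have e1 := lin2 (complex.Re c) (- complex.Im c) _ _ _ _ ur ui vr wr.
have e2 := lin2 (complex.Re c) (complex.Im c) _ _ _ _ ui ur vi wi.
rewrite !trans_opE // e1 ?e2 => [|y _|y _].
- by apply: complex_ext; case: (c) => ? ? /=; ring.
- by rewrite /rpart /ipart; case: (c) (phi y) (psi y) => [? ?] [? ?] [? ?] /=; ring.
- by rewrite /rpart /ipart; case: (c) (phi y) (psi y) => [? ?] [? ?] [? ?] /=; ring.
Qed.

End Complex.

(** * Hoelder norms and vanishing functions *)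

Section Norms.
Variables (R : realType) (tau : probability (borelXplus R) R).
Hypothesis tau_compact : compact (meas_support tau).
Local Notation C := R[i].
Local Notation Z := (henon tau_compact).
Local Notation T := (@averaging R Z).
Variable K : set (Y R).
Hypothesis cK : compact K.
Hypothesis iK : forall (g : maps Z) (x : space Z), supp g -> K x -> K (act g x).
Implicit Types (phi psi : Y R -> C).

Definition cbound (j : nat) (a b : R) phi : Prop :=
  (forall x, K x -> cmod (phi x) <= a) /\
  (forall x y, K x -> K y -> cmod (phi x - phi y) <= b * ydist x y `^ expo R j).

Lemma cbound_parts j a b phi : cbound j a b phi ->
  @hbound R Z K j a b (rpart phi) /\
  @hbound R Z K j a b (ipart phi).
Proof.
move=> [h1 h2]; split; split=> [x Kx|x y Kx Ky].
- exact: le_trans (cmod_re _) (h1 x Kx).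
- by apply: le_trans (h2 x y Kx Ky); rewrite /rpart -raddfB; exact: cmod_re.
- exact: le_trans (cmod_im _) (h1 x Kx).
- by apply: le_trans (h2 x y Kx Ky); rewrite /ipart -raddfB; exact: cmod_im.
Qed.

Lemma parts_cbound j a b a' b' phi :
  @hbound R Z K j a b (rpart phi) ->
  @hbound R Z K j a' b' (ipart phi) -> cbound j (a + a') (b + b') phi.
Proof.
move=> [h1 h2] [h3 h4]; split=> [x Kx|x y Kx Ky].
  by apply: le_trans (cmod_le_parts _) _; rewrite lerD // ?h1 ?h3.
apply: le_trans (cmod_le_parts _) _; rewrite mulrDl !raddfB lerD //.
  exact: h2.
exact: h4.
Qed.

Lemma esup0_le (A : set (\bar R)) (M : R) : 0 <= M ->
  (forall x, A x -> (x <= M%:E)%E) -> (esup0 A <= M%:E)%E.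
Proof.
move=> M0 h; apply: ge_ereal_sup => x [->|/h//].
by rewrite lee_fin.
Qed.

Lemma esup0_ge0 (A : set (\bar R)) : (0 <= esup0 A)%E.
Proof. by apply: ereal_sup_ubound; left. Qed.

Lemma esup0_ub (A : set (\bar R)) x : A x -> (x <= esup0 A)%E.
Proof. by move=> Ax; apply: ereal_sup_ubound; right. Qed.

Lemma holder_norm_le j a b phi : 0 <= a -> 0 <= b -> cbound j a b phi ->
  (holder_norm (expo R j) K phi <= (a + b)%:E)%E.
Proof.
move=> a0 b0 [h1 h2]; rewrite EFinD; apply: leeD; apply: esup0_le => //.
  by move=> _ [z Kz <-]; rewrite lee_fin h1.
move=> _ [x [y [Kx Ky xy ->]]]; rewrite lee_fin ler_pdivrMr ?h2 //.
by rewrite powR_gt0 // lt_def ydist_ge0 andbT; apply/eqP => /ydist_eq0.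
Qed.

Lemma holder_norm_fin j phi : (holder_norm (expo R j) K phi < +oo)%E ->
  exists a b : R, [/\ 0 <= a, 0 <= b, cbound j a b phi &
    holder_norm (expo R j) K phi = (a + b)%:E].
Proof.
rewrite /holder_norm; set A := supnorm K phi; set B := esup0 _ => lt.
have A0 : (0 <= A)%E by exact: esup0_ge0.
have B0 : (0 <= B)%E by exact: esup0_ge0.
have fA : A \is a fin_num.
  by rewrite ge0_fin_numE //; apply: le_lt_trans lt; rewrite leeDl.
have fB : B \is a fin_num.
  by rewrite ge0_fin_numE //; apply: le_lt_trans lt; rewrite leeDr.
exists (fine A), (fine B); split; rewrite ?fine_ge0 //; last first.
  by rewrite EFinD !fineK.
split=> [x Kx|x y Kx Ky].
  by rewrite -lee_fin fineK //; apply: esup0_ub; exists x.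
have [->|xy] := pselect (x = y).
  by rewrite subrr Normc.normc0 mulr_ge0 ?powR_ge0 ?fine_ge0.
rewrite -ler_pdivrMr; last first.
  by rewrite powR_gt0 // lt_def ydist_ge0 andbT; apply/eqP => /ydist_eq0.
by rewrite -lee_fin fineK //; apply: esup0_ub; exists x, y.
Qed.

Lemma supnorm_le phi (M : R) : 0 <= M -> (forall z, K z -> cmod (phi z) <= M) ->
  (supnorm K phi <= M%:E)%E.
Proof. by move=> M0 h; apply: esup0_le => // _ [z Kz <-]; rewrite lee_fin h. Qed.

Lemma vanishingP phi : vanishing tau K phi <->
  [/\ cfun K phi, @null R Z K (rpart phi) &
      @null R Z K (ipart phi)].
Proof.
split=> [[cphi lim]|[cphi nr ni]].
  have key (eta : R) : 0 < eta -> exists k0, forall k z, (k0 <= k)%N -> K z ->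
      cmod (iter k (trans_op tau K) phi z) <= eta.
    move=> eta0.
    have n0 : nbhs (0%E : \bar R) [set x | (x <= eta%:E)%E].
      have : \forall r \near (0 : R), r <= eta.
        have bb : nbhs (0 : R) (ball (0 : R) eta) by exact: nbhsx_ballx.
        apply: filterS bb => r; rewrite /ball /= sub0r normrN.
        by move=> /ltW; apply: le_trans; exact: ler_norm.
      by [].
    have [k0 _ hk] := lim _ n0; exists k0 => k z kk Kz; rewrite -lee_fin.
    apply: le_trans (hk k kk); apply: esup0_ub; by exists z.
  split=> // eta /key[k0 hk]; exists k0 => k z kk Kz.
    have [<- _] := iter_parts cK iK k cphi Kz.
    exact: le_trans (cmod_re _) (hk k z kk Kz).
  have [_ <-] := iter_parts cK iK k cphi Kz.
  exact: le_trans (cmod_im _) (hk k z kk Kz).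
split=> //; have cvg0 : (fun n => supnorm K (iter n (trans_op tau K) phi)) @ \oo --> 0%:E.
  apply/fine_cvgP.
  have key (eta : R) : 0 < eta -> exists k0, forall k, (k0 <= k)%N ->
      (supnorm K (iter k (trans_op tau K) phi) <= eta%:E)%E.
    move=> eta0; have e2 : 0 < eta / 2 by rewrite divr_gt0.
    have [k1 h1] := nr _ e2; have [k2 h2] := ni _ e2.
    exists (maxn k1 k2) => k; rewrite geq_max => /andP[kk1 kk2].
    apply: supnorm_le; first exact: ltW.
    move=> z Kz; apply: le_trans (cmod_le_parts _) _; rewrite (splitr eta) lerD //.
      by have [e _] := iter_parts cK iK k cphi Kz; rewrite [X in `|X|]e h1.
    by have [_ e] := iter_parts cK iK k cphi Kz; rewrite [X in `|X|]e h2.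
  have fin k (eta : R) : (supnorm K (iter k (trans_op tau K) phi) <= eta%:E)%E ->
      supnorm K (iter k (trans_op tau K) phi) \is a fin_num.
    move=> le; rewrite ge0_fin_numE ?esup0_ge0 //.
    by apply: le_lt_trans le _; rewrite ltry.
  split.
    by have [k0 h] := key 1 ltr01; exists k0 => // k kk; apply: fin (h k kk).
  apply/cvgrPdist_lt => e e0; have e2 : 0 < e / 2 by rewrite divr_gt0.
  have [k0 h] := key _ e2; exists k0 => // k kk; rewrite /= sub0r normrN.
  have fk := fin k _ (h k kk).
  rewrite ger0_norm ?fine_ge0 ?esup0_ge0 // -lte_fin fineK //.
  by apply: le_lt_trans (h k kk) _; rewrite lte_fin ltr_pdivrMr // ltr_pMr // ltr1n.
exact: cvg0.
Qed.

End Norms.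

(** * Unitary eigenfunctions and the maximum principle *)

Section Eigen.
Variables (R : realType) (tau : probability (borelXplus R) R).
Hypothesis tau_compact : compact (meas_support tau).
Local Notation C := R[i].
Local Notation Z := (henon tau_compact).
Local Notation T := (@averaging R Z).
Local Notation run := (@run R Z).
Implicit Types (phi psi : Y R -> C) (K L : set (Y R)) (a : C).

Definition eigen K a phi : Prop :=
  [/\ cfun K phi, phi <> (fun=> 0), cmod a = 1 &
      trans_op tau K phi = (fun z => a * phi z)].

Lemma unitary_eigenP K phi : unitary_eigen tau K phi <-> exists a, eigen K a phi.
Proof.
split=> [[c n0 [a [a1 e]]]|[a [c n0 a1 e]]]; first by exists a.
by split=> //; exists a.
Qed.

Lemma eigen_support K a phi z : eigen K a phi -> phi z != 0 -> K z.
Proof.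
by move=> [[_ h] _ _ _] /eqP n0; apply: contrapT => nK; apply: n0; exact: h.
Qed.

Lemma trans_op_const K phi z (c : C) :
  (forall g, meas_support tau g -> phi (xext g z) = c) -> K z ->
  trans_op tau K phi z = c.
Proof.
move=> h Kz.
have TE (f : space Z -> R) (u : R) :
    (forall g, meas_support tau g -> f (xext g z) = u) -> T f z = u.
  move=> hf; rewrite /averaging /= /mean (@eq_Rintegral _ _ _ _ _ (fun=> u)).
    exact: (mean_cst tau).
  by move=> g /set_mem sg; exact: hf.
rewrite (trans_opE tau_compact phi Kz) (TE _ (complex.Re c)); last first.
  by move=> g sg; rewrite /rpart h.
rewrite (TE _ (complex.Im c)); first by case: (c).
by move=> g sg; rewrite /ipart h.
Qed.

Section Invariant.
Variable K : set (Y R).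
Hypothesis cK : compact K.
Hypothesis iK : forall (g : maps Z) (x : space Z), supp g -> K x -> K (act g x).

Lemma cmod_dist (u v : C) : `|cmod u - cmod v| <= cmod (u - v).
Proof.
rewrite ler_norml; apply/andP; split.
  by have := le_normcD (v - u) u; rewrite subrK -(normcN (v - u)) opprB; lra.
by have := le_normcD (u - v) v; rewrite subrK; lra.
Qed.

Lemma cfun_close phi : cfun K phi -> forall e : R, 0 < e ->
  exists2 r : R, 0 < r & forall x y, K x -> K y -> ydist x y < r -> cmod (phi x - phi y) < e.
Proof.
move=> /(cfunP tau_compact cK)[ur ui _] e e0; have e2 : 0 < e / 2 by rewrite divr_gt0.
have [r1 r10 h1] := ur _ e2; have [r2 r20 h2] := ui _ e2.
exists (Num.min r1 r2); first by rewrite lt_min r10.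
move=> x y Kx Ky; rewrite lt_min => /andP[xy1 xy2].
apply: le_lt_trans (cmod_le_parts _) _.
by rewrite (splitr e) ltrD // raddfB; [exact: h1|exact: h2].
Qed.

Lemma cmod_uc phi : cfun K phi -> @uc R Z K (fun z => cmod (phi z)).
Proof.
move=> /cfun_close h e /h[r r0 hr]; exists r => // x y Kx Ky /(hr x y Kx Ky).
exact: le_lt_trans (cmod_dist _ _).
Qed.

(** If the modulus did not attain its supremum, its distance to the supremum
    would be positive, hence bounded below by compactness. *)
Lemma eigen_max a phi : eigen K a phi -> exists z, [/\ K z, 0 < cmod (phi z) &
  forall w, K w -> cmod (phi w) <= cmod (phi z)].
Proof.
move=> ev; have [cphi n0 _ _] := ev; have [_ z0] := cphi.
have [w nw] : exists w, phi w != 0.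
  apply: contrapT => no; apply: n0; apply/funext => w.
  by apply/eqP; rewrite -[_ == _]negbK; apply/negP => nw; apply: no; exists w.
have Kw := eigen_support ev nw; have uphi := cmod_uc cphi.
have [B B0 hB] := @uc_bounded R Z K _ cK uphi.
pose S := [set cmod (phi z) | z in K].
have hS : has_sup S.
  split; first by exists (cmod (phi w)), w.
  by exists B => _ [z Kz <-]; rewrite (le_trans (ler_norm _)) // hB.
have ub z : K z -> cmod (phi z) <= sup S.
  by move=> Kz; apply: ub_le_sup; [exact: hS.2|exists z].
have [[z [Kz e]]|no] := pselect (exists z, K z /\ cmod (phi z) = sup S).
  exists z; split=> // [|v Kv]; last by rewrite e ub.
  by rewrite e (lt_le_trans _ (ub w Kw)) // cmod_gt0.
have [||e e0 he] := @uc_gt0 R Z K K (fun z => -1 * cmod (phi z) + sup S) cK (@subset_refl _ K).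
- by apply: uc_lin => //; exact: uc_cst.
- move=> z Kz; rewrite mulN1r addrC subr_gt0 lt_def ub // andbT.
  by apply/eqP => e; apply: no; exists z.
have [_ [z Kz <-]] := sup_adherent e0 hS.
by have := he z Kz; rewrite mulN1r; lra.
Qed.

(** The maximum principle: where the modulus of an eigenfunction is maximal, the
    mean can only have that modulus if the function takes one and the same value
    at all images. *)
Lemma eigen_step a phi z : eigen K a phi -> K z ->
  (forall w, K w -> cmod (phi w) <= cmod (phi z)) ->
  forall g, meas_support tau g -> phi (xext g z) = a * phi z.
Proof.
move=> [cphi n0 a1 e] Kz mz g sg.
have /(cfunP tau_compact cK)[ur ui _] := cphi.
pose u := a * phi z; have uM : cmod u = cmod (phi z) by rewrite Normc.normcM a1 mul1r.
(* the real part of [phi w] times the conjugate of [u]: at most [cmod u ^+ 2],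
   with equality only if [phi w] is [u] *)
pose h (w : space Z) : R := complex.Re u * rpart phi w + (complex.Im u * ipart phi w + 0).
have uh : @uc R Z K h by do 2 apply: uc_lin => //; exact: uc_cst.
have sqr (c : C) : cmod c ^+ 2 = complex.Re c ^+ 2 + complex.Im c ^+ 2.
  by case: c => x y /=; rewrite sqr_sqrtr // addr_ge0 ?sqr_ge0.
have gap w : K w -> (complex.Re (phi w) - complex.Re u) ^+ 2
    + (complex.Im (phi w) - complex.Im u) ^+ 2 <= 2 * (cmod u ^+ 2 - h w).
  move=> Kw; have : cmod (phi w) ^+ 2 <= cmod u ^+ 2.
    by rewrite ler_pXn2r ?nnegrE ?cmod_ge0 // uM mz.
  rewrite !sqr /h /rpart /ipart; lra.
have h0 w : K w -> 0 <= -1 * h w + cmod u ^+ 2.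
  by move=> /gap; have := sqr_ge0 (complex.Re (phi w) - complex.Re u);
     have := sqr_ge0 (complex.Im (phi w) - complex.Im u); lra.
have Th : T h z = cmod u ^+ 2.
  have u2 : @uc R Z K (fun w => complex.Im u * ipart phi w + 0).
    by apply: uc_lin => //; exact: uc_cst.
  have T0 : T (fun=> 0) z = 0 by exact: (@iter_T_cst R Z 1).
  rewrite /h (@T_lin R Z K iK _ _ _ _ ur u2 Kz).
  rewrite (@T_lin R Z K iK _ _ _ _ ui (@uc_cst R Z K 0) Kz) T0 addr0.
  have := congr1 (@^~ z) e; rewrite (trans_opE tau_compact phi Kz) -/u => ez.
  by rewrite sqr -ez /= !expr2.
have [gt|le] := ltP 0 (-1 * h (xext g z) + cmod u ^+ 2).
  have := @iter_T_gt0 R Z K cK iK 1 (fun w => -1 * h w + cmod u ^+ 2) z [:: g].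
  move=> /(_ _ Kz _ _ erefl gt).
  have ws : word (Z := Z) [:: g] by apply/word_cons.
  have uk : @uc R Z K (fun w => -1 * h w + cmod u ^+ 2).
    by apply: uc_lin => //; exact: uc_cst.
  move=> /(_ uk) H; have : 0 < T (fun w => -1 * h w + cmod u ^+ 2) z.
    by apply: H => // t wt _; apply: h0; exact: run_inv.
  have Tc : T (fun=> cmod u ^+ 2) z = cmod u ^+ 2 by exact: (@iter_T_cst R Z 1).
  by rewrite (@T_lin R Z K iK _ _ _ _ uh (@uc_cst R Z K _) Kz) Th Tc mulN1r addNr ltxx.
have := gap _ (iK sg Kz) => /= gp.
have r0 := sqr_ge0 (complex.Re (phi (xext g z)) - complex.Re u).
have i0 := sqr_ge0 (complex.Im (phi (xext g z)) - complex.Im u).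
have s0 : (complex.Re (phi (xext g z)) - complex.Re u) ^+ 2 = 0.
  by apply/eqP; rewrite eq_le r0 andbT; lra.
have t0 : (complex.Im (phi (xext g z)) - complex.Im u) ^+ 2 = 0.
  by apply/eqP; rewrite eq_le i0 andbT; lra.
move/eqP: s0; move/eqP: t0; rewrite !sqrf_eq0 !subr_eq0 => /eqP i1 /eqP r1.
exact: complex_ext.
Qed.

Lemma eigen_run a phi z s : eigen K a phi -> K z ->
  (forall w, K w -> cmod (phi w) <= cmod (phi z)) ->
  word (Z := Z) s -> phi (run s z) = a ^+ size s * phi z.
Proof.
move=> ev; elim: s z => [|g s IH] z Kz mz; first by rewrite mul1r.
move=> /word_cons[sg ws] /=; have e := eigen_step ev Kz mz sg.
have [_ _ a1 _] := ev; rewrite [LHS]IH //.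
- by rewrite [X in _ * X]e mulrA exprSr.
- exact: iK.
- by move=> w Kw; rewrite [X in _ <= cmod X]e Normc.normcM a1 mul1r mz.
Qed.

End Invariant.

Lemma minimal_compact_inv L : @minimal R Z L -> compact L /\
  forall (g : maps Z) (x : space Z), supp g -> L x -> L (act g x).
Proof. by move=> mL; split; [case: mL|exact: minimal_inv]. Qed.

(** Where the modulus is maximal at a point, it is so along the orbit of the
    point, which is dense. *)
Lemma eigen_minimal L a phi : @minimal R Z L -> eigen L a phi ->
  exists2 M : R, 0 < M & forall z, L z -> cmod (phi z) = M.
Proof.
move=> mL ev; have [cL iL] := minimal_compact_inv mL.
have [z0 [Lz0 M0 mz0]] := eigen_max cL ev; exists (cmod (phi z0)) => // z Lz.
have [cphi _ a1 _] := ev; have uphi := cmod_uc cL cphi.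
apply/eqP; rewrite eq_le mz0 //= leNgt -subr_gt0; apply/negP => d0.
have [r r0 hr] := uphi _ d0.
have [s [ws _ zs]] := minimal_dense 0 mL Lz0 Lz r0.
have := hr z (run s z0) Lz (minimal_run mL Lz0 ws) zs.
rewrite (eigen_run cL iL ev Lz0 mz0 ws) Normc.normcM cmodX a1 expr1n mul1r.
by rewrite ltr_norml => /andP[]; lra.
Qed.

Lemma eigen_minimal_run L a phi z s : @minimal R Z L -> eigen L a phi -> L z ->
  word (Z := Z) s -> phi (run s z) = a ^+ size s * phi z.
Proof.
move=> mL ev Lz ws; have [cL iL] := minimal_compact_inv mL.
have [M M0 hM] := eigen_minimal mL ev.
by apply: (eigen_run cL iL ev) => // w Lw; rewrite !hM.
Qed.

(** Along the orbit of a point of maximal modulus the modulus stays maximal and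
    the eigenfunction is multiplied by [a] at each step; the same holds on a
    minimal set in the closure of the orbit, to which the function can be
    restricted. *)
Lemma eigen_transport K a phi : compact K ->
  (forall (g : maps Z) (x : space Z), supp g -> K x -> K (act g x)) ->
  eigen K a phi -> exists L psi, [/\ @minimal R Z L, L `<=` K & eigen L a psi].
Proof.
move=> cK iK ev; have [z0 [Kz0 M0 mz0]] := eigen_max cK ev.
have [cphi _ a1 _] := ev; have uphi := cmod_uc cK cphi.
have [L [mL LK LO]] := @orbit_minimal R Z K z0 cK iK Kz0.
have [cL iL] := minimal_compact_inv mL.
have LM z : L z -> cmod (phi z) = cmod (phi z0).
  move=> Lz; apply/eqP; rewrite eq_le mz0 /= ?leNgt; last exact: LK.
  rewrite -subr_gt0; apply/negP => d0; have [r r0 hr] := uphi _ d0.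
  have [_ [s [ws _ ->]] zs] := closure_dist (LO z Lz) r0.
  have := hr z (run s z0) (LK z Lz) (run_inv iK ws Kz0) zs.
  rewrite (eigen_run cK iK ev Kz0 mz0 ws) Normc.normcM cmodX a1 expr1n mul1r.
  by rewrite ltr_norml => /andP[]; lra.
have step z g : L z -> meas_support tau g -> phi (xext g z) = a * phi z.
  move=> Lz sg; apply: (eigen_step cK iK ev) => //; first exact: LK.
  by move=> w Kw; rewrite (LM z Lz); exact: mz0.
pose psi z := if z \in L then phi z else 0.
have psiE z : L z -> psi z = phi z by move=> Lz; rewrite /psi mem_set.
have psi0 z : ~ L z -> psi z = 0 by move=> nL; rewrite /psi memNset.
exists L, psi; split=> //; split=> //.
- have /(cfunP tau_compact cK)[ur ui _] := cphi; apply/(cfunP tau_compact cL).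
  split=> // e e0.
    have [r r0 hr] := ur e e0; exists r => // x y Lx Ly xy.
    by rewrite /rpart !psiE //; apply: hr => //; exact: LK.
  have [r r0 hr] := ui e e0; exists r => // x y Lx Ly xy.
  by rewrite /ipart !psiE //; apply: hr => //; exact: LK.
- have [[z Lz] _ _] := mL => /(congr1 (@^~ z)); rewrite psiE // => e.
  by move: M0; rewrite -(LM z Lz) e Normc.normc0 ltxx.
apply/funext => z; have [Lz|nL] := pselect (L z); last by rewrite trans_op0 // psi0 // mulr0.
rewrite (trans_op_const (c := a * phi z) _ Lz) ?psiE // => g sg.
by rewrite psiE ?step //; exact: iL.
Qed.

End Eigen.

(** * The unitary spectrum of a minimal set and the period *)

Section Spectrum.
Variables (R : realType) (tau : probability (borelXplus R) R).
Hypothesis tau_compact : compact (meas_support tau).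
Local Notation C := R[i].
Local Notation Z := (henon tau_compact).
Variable st : contracting Z.
Local Notation run := (@run R Z).
Implicit Types (phi psi : Y R -> C) (K L : set (Y R)) (a : C).

Lemma small_cmod_eq0 (u : C) : (forall e : R, 0 < e -> cmod u <= e) -> u = 0.
Proof.
move=> h; apply/eqP; rewrite -cmod_eq0 eq_le cmod_ge0 andbT leNgt; apply/negP => u0.
have u2 : 0 < cmod u / 2 by rewrite divr_gt0.
by have := h _ u2; lra.
Qed.

(** Long words contract small distances near a minimal set, while they multiply
    all values of an eigenfunction there by one and the same number of modulus
    one: so eigenfunctions do not separate near points. *)
Lemma eigen_local L : @minimal R Z L -> exists2 e : R, 0 < e &
  forall a phi x y, eigen tau L a phi -> L x -> L y -> ydist x y < e -> phi x = phi y.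
Proof.
move=> mL; have [cL iL] := minimal_compact_inv mL.
have [e [B [M [e0 B1 M0 h]]]] := contraction_minimal st cL iL.
exists e => // a phi x y ev Lx Ly xy; apply/eqP; rewrite -subr_eq0; apply/eqP.
apply: small_cmod_eq0 => d d0; have [cphi _ a1 _] := ev; have [r r0 hr] := cfun_close tau_compact cL cphi d0.
have B0 : 0 < B by exact: lt_le_trans B1.
have [q hq] : exists q, B * 2^-1 ^+ q * 2 < r.
  have [q hq] := half_le (2 * B / r); exists q; move: hq.
  by rewrite mulrAC ler_pdivrMr // -[2 * B * _]mulrA [B * _ * 2]mulrC; move: (B * _) => p; lra.
have [s ws ss] := exists_word Z (q * M).
have := h L x x y mL (@subset_refl _ L) Lx Lx Ly; rewrite (@distxx R Z x) => /(_ e0 xy q s ws).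
rewrite ss leqnn => /(_ isT) le.
have := hr (run s x) (run s y) (minimal_run mL Lx ws) (minimal_run mL Ly ws).
rewrite !(eigen_minimal_run mL ev) // -mulrBr Normc.normcM cmodX.
rewrite a1 expr1n mul1r => H; apply: ltW; apply: H.
apply: le_lt_trans le _; apply: le_lt_trans hq; rewrite ler_wpM2l ?dist_le2 //.
by rewrite mulr_ge0 ?exprn_ge0 ?invr_ge0 // ltW.
Qed.

(** An orbit in a minimal set comes near itself, by the pigeonhole principle, and
    the number of steps this takes is a period for all eigenvalues. *)
Lemma eigen_torsion L : @minimal R Z L -> exists2 m, (0 < m)%N &
  forall a phi, eigen tau L a phi -> a ^+ m = 1.
Proof.
move=> mL; have [cL iL] := minimal_compact_inv mL; have [e e0 he] := eigen_local mL.
have e2 : 0 < e / 2 by rewrite divr_gt0.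
have [s hs] := @compact_net R Z L _ cL e2; have [[x Lx] _ _] := mL.
have [g sg] := supp_nonempty Z; pose p k := run (nseq k g) x.
have Lp k : L (p k) by apply: minimal_run => //; exact: word_nseq.
have /boolp.choice[f hf] : forall k : 'I_(size s).+1, exists i : 'I_(size s),
    ydist (nth x s i) (p k) < e / 2.
  move=> k; have [y ys yp] := hs _ (Lp k).
  by rewrite -index_mem in ys; exists (Ordinal ys); rewrite /= nth_index // -index_mem.
have /injectivePn[i [j ij fij]] : ~~ injectiveb f.
  apply/negP => /injectiveP /leq_card; by rewrite !card_ord ltnn.
have close : ydist (p i) (p j) < e.
  apply: le_lt_trans (ydist_triangle _ (nth x s (f i)) _) _.
  by rewrite (splitr e) ltrD // ?fij ?hf // ydistC -fij hf.
wlog lt : i j ij fij close / (i < j)%N.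
  move=> W; have [lt|gt|e'] := ltngtP i j; first exact: (W i j).
    by apply: (W j i) => //; rewrite 1?eq_sym // ydistC.
  by rewrite (val_inj e') eqxx in ij.
exists (j - i)%N; first by rewrite subn_gt0.
move=> a phi ev; have := he _ _ _ _ ev (Lp i) (Lp j) close.
have pE k : phi (p k) = a ^+ k * phi x.
  by rewrite /p (eigen_minimal_run mL ev Lx (word_nseq (n := k) sg)) size_nseq.
have [M M0 hM] := eigen_minimal mL ev; have [_ _ a1 _] := ev.
have x0 : phi x != 0 by rewrite -cmod_gt0 hM.
have a0 : a != 0 by rewrite -cmod_gt0 a1.
rewrite !pE => /(mulIf x0) E; apply: (mulfI (expf_neq0 i a0)).
by rewrite -exprD subnKC ?mulr1 // ltnW.
Qed.

Definition eigenvalue L a : Prop := exists phi, eigen tau L a phi.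

Lemma eigenvalue1 L : @minimal R Z L -> eigenvalue L 1.
Proof.
move=> mL; have [cL iL] := minimal_compact_inv mL.
pose phi z : C := if z \in L then 1 else 0.
have phi1 z : L z -> phi z = 1 by move=> Lz; rewrite /phi mem_set.
have phi0 z : ~ L z -> phi z = 0 by move=> nL; rewrite /phi memNset.
exists phi; split.
- apply/(cfunP tau_compact cL); split=> // e e0; exists 1 => // x y Lx Ly _.
    by rewrite /rpart !phi1 // subrr normr0.
  by rewrite /ipart !phi1 // subrr normr0.
- have [[z Lz] _ _] := mL => /(congr1 (@^~ z)); rewrite phi1 // => /eqP.
  by rewrite oner_eq0.
- exact: Normc.normc1.
apply/funext => z; rewrite mul1r; have [Lz|nL] := pselect (L z).
  apply: (trans_op_const tau_compact) => // g sg; rewrite !phi1 //; exact: iL.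
by rewrite trans_op0 ?phi0.
Qed.

(** Along words eigenfunctions are multiplied by powers of the eigenvalue, and
    so are their products. *)
Lemma eigenvalueM L a b : @minimal R Z L -> eigenvalue L a -> eigenvalue L b ->
  eigenvalue L (a * b).
Proof.
move=> mL [phi ep] [psi es]; have [cL iL] := minimal_compact_inv mL.
have [[cp p0] _ a1 _] := ep; have [[cs s0] _ b1 _] := es.
have step c chi z g : eigen tau L c chi -> L z -> meas_support tau g ->
    chi (xext g z) = c * chi z.
  move=> ev Lz sg; apply: (eigen_minimal_run (s := [:: g]) mL ev Lz).
  exact/word_cons.
exists (fun z => phi z * psi z); split.
- split=> [|z nL]; last by rewrite p0 // mul0r.
  by move=> x; apply: cvgM; [exact: cp|exact: cs].
- have [[z Lz] _ _] := mL => /(congr1 (@^~ z))/eqP.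
  have [M M0 hM] := eigen_minimal mL ep; have [N N0 hN] := eigen_minimal mL es.
  by apply/negP; rewrite mulf_neq0 // -cmod_gt0 ?hM ?hN.
- by rewrite Normc.normcM a1 b1 mulr1.
apply/funext => z; have [Lz|nL] := pselect (L z).
  apply: (trans_op_const tau_compact) => // g sg.
  by rewrite (step a) // (step b) // mulrACA.
by rewrite trans_op0 // p0 // mul0r mulr0.
Qed.

Lemma eigenvalues_finite L : @minimal R Z L ->
  exists2 es : seq C, uniq es & forall a, a \in es <-> eigenvalue L a.
Proof.
move=> mL; have [m m0 hm] := eigen_torsion mL.
have [r Dp] := closed_field_poly_normal ('X^m - 1 : {poly C}).
rewrite (monicP _) ?scale1r ?monicXnsubC // in Dp.
exists (undup [seq a <- r | `[< eigenvalue L a >]]); first exact: undup_uniq.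
move=> a; rewrite mem_undup mem_filter; split=> [/andP[/asboolP //]|ea].
apply/andP; split; first exact/asboolP.
have [phi /hm am] := ea.
by rewrite -root_prod_XsubC -Dp /root !hornerE am subrr.
Qed.

(** Two eigenfunctions for one eigenvalue keep their ratio along an orbit, and
    orbits are dense. *)
Lemma eigen_proportional L a phi psi : @minimal R Z L -> eigen tau L a phi ->
  eigen tau L a psi -> exists c, psi = (fun z => c * phi z).
Proof.
move=> mL ep es; have [cL iL] := minimal_compact_inv mL; have [[x Lx] _ _] := mL.
have [M M0 hM] := eigen_minimal mL ep; have x0 : phi x != 0 by rewrite -cmod_gt0 hM.
have [[cp p0] _ a1 _] := ep; have [[cs s0] _ _ _] := es.
exists (psi x / phi x); apply/funext => z.
have [Lz|nL] := pselect (L z); last by rewrite (p0 z nL) (s0 z nL) mulr0.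
apply/eqP; rewrite -subr_eq0; apply/eqP; apply: small_cmod_eq0 => e e0.
pose chi z := - (psi x / phi x) * phi z + psi z.
have cchi : cfun L chi by exact: (@cfun_lin R tau tau_compact L cL).
have [r r0 hr] := cmod_uc tau_compact cL cchi e0.
have [s [ws _ zs]] := minimal_dense 0 mL Lx Lz r0.
have := hr z (run s x) Lz (minimal_run mL Lx ws) zs.
have -> : chi (run s x) = 0.
  rewrite /chi (eigen_minimal_run mL ep) // (eigen_minimal_run mL es) //.
  by rewrite mulrCA mulNr divfK // mulrN addNr.
rewrite Normc.normc0 subr0 ger0_norm ?cmod_ge0 // /chi mulNr addrC.
exact: ltW.
Qed.

(** Eigenfunctions for distinct eigenvalues are independent because the powers
    of the eigenvalues along an orbit are. *)
Lemma minimal_cdim L (es : seq C) : @minimal R Z L -> uniq es ->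
  (forall a, a \in es <-> eigenvalue L a) ->
  has_cdim (cspan (unitary_eigen tau L)) (size es).
Proof.
move=> mL ues hes; have [cL iL] := minimal_compact_inv mL; have [[x Lx] _ _] := mL.
have /boolp.choice[b hb] : forall i : 'I_(size es), exists phi, eigen tau L es`_i phi.
  by move=> i; apply/hes; exact: mem_nth.
exists b; split.
- move=> i; exists 1, (fun=> b i), (fun=> 1); split=> [_|].
    by apply/unitary_eigenP; exists es`_i.
  by apply/funext => z; rewrite /lcomb big_ord1 mul1r.
- move=> a h i; have [g sg] := supp_nonempty Z.
  have [M M0 hM] := eigen_minimal mL (hb i).
  have x0 : b i x != 0 by rewrite -cmod_gt0 hM.
  suff /eqP : a i * b i x = 0 by rewrite mulf_eq0 (negPf x0) orbF => /eqP.
  apply: (@power_sums_eq0 R _ (fun i : 'I_(size es) => es`_i) (fun i => a i * b i x)).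
    by move=> j k /eqP; rewrite nth_uniq // => /eqP/val_inj.
  move=> k; transitivity (lcomb b a (run (nseq k g) x)); last by rewrite h.
  apply: eq_bigr => j _; rewrite -mulrA; congr (_ * _).
  by rewrite (eigen_minimal_run mL (hb j) Lx (word_nseq (n := k) sg)) size_nseq mulrC.
move=> psi [n [f [a [hf ->]]]].
have /boolp.choice[c hc] : forall i, exists c, f i = lcomb b c.
  move=> i; have [d ev] := (unitary_eigenP _ _ _).1 (hf i).
  have : d \in es by apply/hes; exists (f i).
  rewrite -index_mem => ds; pose k := Ordinal ds.
  have dE : es`_k = d by rewrite /= nth_index // -index_mem.
  have evk := hb k; rewrite dE in evk.
  have [c ->] := eigen_proportional mL evk ev.
  exists (fun j => if j == k then c else 0); apply/funext => z.
  rewrite /lcomb (bigD1 k) //= eqxx big1 ?addr0 // => j /negPf ->.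
  by rewrite mul0r.
exists (fun j => \sum_i a i * c i j); apply/funext => z; rewrite /lcomb.
under [RHS]eq_bigr do rewrite mulr_suml.
rewrite exchange_big /=; apply: eq_bigr => i _; rewrite hc /lcomb mulr_sumr.
by apply: eq_bigr => j _; rewrite mulrA.
Qed.

(** The eigenvalues form a finite group whose order is the dimension. *)
Lemma minimal_cdim_spec L : @minimal R Z L -> exists d,
  [/\ has_cdim (cspan (unitary_eigen tau L)) d, (0 < d)%N &
      forall a phi, eigen tau L a phi -> a ^+ d = 1].
Proof.
move=> mL; have [es ues hes] := eigenvalues_finite mL.
exists (size es); split; first exact: minimal_cdim.
  have := (hes 1).2 (eigenvalue1 mL); by case: es {ues hes}.
move=> a phi ev; apply: mul_closed_expr => //.
- by move=> b /hes[psi [_ _ b1 _]]; rewrite -cmod_gt0 b1.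
- by move=> b c /hes hb /hes hc; apply/hes; exact: eigenvalueM.
by apply/hes; exists phi.
Qed.

Lemma minimal_sets_finite : finite_set (minimal_sets tau).
Proof. by rewrite (minimal_setsE tau_compact); exact: (minimal_finite st). Qed.

Lemma period_gt0 : (0 < period tau)%N.
Proof.
rewrite /period (fsbig_finite _ _ minimal_sets_finite) /=.
rewrite big_seq; apply: (big_ind (fun n => 0 < n)%N) => // [m n m0 n0|L].
  by rewrite muln_gt0 m0.
rewrite (in_fset_set minimal_sets_finite) => /set_mem.
rewrite (minimal_setsE tau_compact) => /minimal_cdim_spec[d [hd d0 _]].
by rewrite (cdimE hd).
Qed.

(** The common period of the eigenvalues on an invariant compact set: each of
    them is an eigenvalue on some minimal set. *)
Lemma eigen_period K a phi : compact K ->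
  (forall (g : maps Z) (x : space Z), supp g -> K x -> K (act g x)) ->
  eigen tau K a phi -> a ^+ period tau = 1.
Proof.
move=> cK iK ev; have [L [psi [mL _ evL]]] := eigen_transport cK iK ev.
have [d [hd _ had]] := minimal_cdim_spec mL.
have tL : minimal_sets tau L by rewrite (minimal_setsE tau_compact).
rewrite /period (fsbigD1 L _ _ minimal_sets_finite tL) (cdimE hd) exprM.
by rewrite (had a psi evL) expr1n.
Qed.

End Spectrum.

(** * The complex spectral decomposition *)

Section Projection.
Variables (R : realType) (tau : probability (borelXplus R) R).
Hypothesis tau_compact : compact (meas_support tau).
Local Notation C := R[i].
Local Notation Z := (henon tau_compact).
Variable st : contracting Z.
Variable K : set (Y R).
Hypothesis cK : compact K.
Hypothesis iK : forall (g : maps Z) (x : space Z), supp g -> K x -> K (act g x).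
Local Notation T := (@averaging R Z).
Local Notation M := (trans_op tau K).
Implicit Types (phi psi : Y R -> C).

Lemma cfun0 : cfun K (fun=> 0 : C).
Proof.
by apply/(cfunP tau_compact cK); split=> //; exact: (@uc_cst R Z K 0).
Qed.

Lemma lcombS n (c : 'I_n.+1 -> C) (f : 'I_n.+1 -> Y R -> C) :
  lcomb f c = (fun z => c ord0 * f ord0 z +
                        lcomb (fun i => f (lift ord0 i)) (fun i => c (lift ord0 i)) z).
Proof. by apply/funext => z; rewrite /lcomb big_ord_recl. Qed.

Lemma lcomb0 (c : 'I_0 -> C) (f : 'I_0 -> Y R -> C) : lcomb f c = (fun=> 0).
Proof. by apply/funext => z; rewrite /lcomb big_ord0. Qed.

Lemma cfun_lcomb n (c : 'I_n -> C) (f : 'I_n -> Y R -> C) : (forall i, cfun K (f i)) ->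
  cfun K (lcomb f c).
Proof.
elim: n c f => [|n IH] c f hf; first by rewrite lcomb0; exact: cfun0.
by rewrite lcombS; apply: (cfun_lin tau_compact cK) => //; exact: IH.
Qed.

Lemma trans_op_lcomb n (c : 'I_n -> C) (f : 'I_n -> Y R -> C) :
  (forall i, cfun K (f i)) -> M (lcomb f c) = lcomb (fun i => M (f i)) c.
Proof.
elim: n c f => [|n IH] c f hf.
  rewrite !lcomb0; apply/funext => z; have [Kz|nK] := pselect (K z).
    exact: (trans_op_const tau_compact).
  by rewrite trans_op0.
have hS : cfun K (lcomb (fun i => f (lift ord0 i)) (fun i => c (lift ord0 i))).
  exact: cfun_lcomb.
by rewrite lcombS (trans_op_lin cK iK) // IH // lcombS.
Qed.

Lemma iter_trans_op_lin n (c : C) phi psi : cfun K phi -> cfun K psi ->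
  iter n M (fun z => c * phi z + psi z) = (fun z => c * iter n M phi z + iter n M psi z).
Proof.
move=> h1 h2; elim: n => [//|n IH]; rewrite !iterS IH.
by apply: (trans_op_lin cK iK); exact: (iter_cfun cK iK).
Qed.

Lemma cspan_periodic psi : cspan (unitary_eigen tau K) psi ->
  cfun K psi /\ forall n, iter (n * period tau) M psi = psi.
Proof.
move=> [m [b [c [hb ->]]]].
have /boolp.choice[a ha] : forall i, exists a, eigen tau K a (b i).
  by move=> i; exact/unitary_eigenP.
have cb i : cfun K (b i) by have [] := ha i.
split=> [|n]; first exact: cfun_lcomb.
have E k : iter k M (lcomb b c) = lcomb b (fun i => c i * a i ^+ k).
  elim: k => [|k IH].
    by apply/funext => z; apply: eq_bigr => i _; rewrite mulr1.
  rewrite iterS IH trans_op_lcomb //; apply/funext => z; apply: eq_bigr => i _.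
  by have [_ _ _ ->] := ha i; rewrite exprSr -!mulrA.
rewrite E; apply/funext => z; apply: eq_bigr => i _.
by rewrite mulnC exprM (eigen_period st cK iK (ha i)) expr1n mulr1.
Qed.

(** Fourier analysis of the cyclic group generated by [M] on the orbit of [psi]:
    the components are eigenfunctions whose eigenvalues are [N]-th roots of
    unity. *)
Lemma periodic_cspan N psi : (0 < N)%N -> cfun K psi -> iter N M psi = psi ->
  cspan (unitary_eigen tau K) psi.
Proof.
move=> N0 cpsi per; have [w pw] := complex_prim_root R N0.
have w0 : w != 0 by exact: prim_root_neq0 pw.
have nN0 : N%:R != 0 :> C by rewrite pnatr_eq0 -lt0n.
have cM k : cfun K (iter k M psi) by exact: (iter_cfun cK iK).
pose f (i : 'I_N) := lcomb (fun k : 'I_N => iter k M psi)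
  (fun k : 'I_N => N%:R^-1 * (w ^+ i)^-1 ^+ k).
have cf i : cfun K (f i) by exact: cfun_lcomb.
have -> : psi = (fun z => \sum_i f i z).
  apply/funext => z; rewrite /f /lcomb exchange_big /=.
  rewrite (bigD1 (Ordinal N0)) //= [X in _ + X]big1 ?addr0 => [|k k0]; last first.
    have s0 : \sum_(i < N) (w ^+ i)^-1 ^+ k = 0.
      have k0N : (0 < k < N)%N.
        by rewrite ltn_ord andbT lt0n; apply: contra k0 => /eqP e; apply/eqP/val_inj.
      transitivity (\sum_(i < N) (w ^+ k)^-1 ^+ i); last exact: prim_root_sum pw k0N.
      by apply: eq_bigr => i _; rewrite !exprVn -!exprM mulnC.
    by rewrite -mulr_suml -mulr_sumr s0 mulr0 mul0r.
  under eq_bigr do rewrite expr0 mulr1.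
  by rewrite sumr_const card_ord -mulrnAl -mulr_natr mulVf // mul1r.
apply: cspan_sum => i; have [f0|f0] := pselect (f i = (fun=> 0)); first by left.
right; apply/unitary_eigenP; exists (w ^+ i); split=> //.
  apply/eqP; rewrite -(@pexpr_eq1 _ _ N) ?cmod_ge0 // -cmodX -exprM mulnC exprM.
  by rewrite (prim_expr_order pw) expr1n Normc.normc1.
rewrite trans_op_lcomb //; apply/funext => z; rewrite /f /lcomb mulr_sumr.
pose F k := N%:R^-1 * (w ^+ i)^-1 ^+ k * iter k M psi z.
have FN : F N = F 0%N.
  by rewrite /F per exprVn -exprM mulnC exprM (prim_expr_order pw) expr1n invr1.
transitivity (\sum_(k < N) w ^+ i * F k.+1).
  apply: eq_bigr => k _; rewrite /F exprS iterS.
  have uV : w ^+ i * (w ^+ i)^-1 = 1 by rewrite mulfV // expf_neq0.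
  by rewrite -[LHS]mul1r -[X in X * _ = _]uV; ring.
rewrite -!mulr_sumr; congr (_ * _).
apply: (addrI (F 0%N)); rewrite -(big_ord_recl N (fun k : 'I_N.+1 => F k)).
by rewrite big_ord_recr /= FN addrC.
Qed.

Lemma vanishing_small phi : vanishing tau K phi -> forall eta : R, 0 < eta ->
  exists k0, forall k z, (k0 <= k)%N -> K z -> cmod (iter k M phi z) <= eta.
Proof.
move=> /(vanishingP cK iK)[cphi nr ni] eta eta0.
have e2 : 0 < eta / 2 by rewrite divr_gt0.
have [k1 h1] := nr _ e2; have [k2 h2] := ni _ e2; exists (maxn k1 k2) => k z.
rewrite geq_max => /andP[kk1 kk2] Kz; apply: le_trans (cmod_le_parts _) _.
have [er ei] := iter_parts cK iK k cphi Kz; rewrite (splitr eta) lerD //.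
  by rewrite [X in `|X|]er h1.
by rewrite [X in `|X|]ei h2.
Qed.

(** On the span, the power [period tau] of the operator is the identity; for
    the other summand the powers tend to 0. *)
Lemma proj_unique phi psi psi' : cfun K phi -> is_proj tau K phi psi ->
  is_proj tau K phi psi' -> psi = psi'.
Proof.
move=> cphi [sp vp] [sp' vp']; have [cp pp] := cspan_periodic sp.
have [cp' pp'] := cspan_periodic sp'; apply/funext => z.
have [Kz|nK] := pselect (K z); last by rewrite cp.2 // cp'.2.
apply/eqP; rewrite -subr_eq0; apply/eqP; apply: small_cmod_eq0 => e e0.
have e2 : 0 < e / 2 by rewrite divr_gt0.
have [k1 h1] := vanishing_small vp e2; have [k2 h2] := vanishing_small vp' e2.
pose n := maxn k1 k2; have np : (n <= n * period tau)%N.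
  by rewrite leq_pmulr // (period_gt0 st).
have key chi : cfun K chi -> iter (n * period tau) M chi = chi ->
    iter (n * period tau) M (phi \- chi) z = iter (n * period tau) M phi z - chi z.
  move=> cc pc; have -> : phi \- chi = (fun z => (-1) * chi z + phi z).
    by apply/funext => y; rewrite mulN1r addrC.
  by rewrite iter_trans_op_lin // pc mulN1r addrC.
have := h1 _ z (leq_trans (leq_maxl _ _) np) Kz; rewrite key //.
have := h2 _ z (leq_trans (leq_maxr _ _) np) Kz; rewrite key //.
set u := iter _ _ _ _ => l1 l2; have -> : psi z - psi' z = (u - psi' z) - (u - psi z) by ring.
apply: le_trans (le_normcD _ _) _; rewrite normcN; lra.
Qed.

(** The real decomposition is applied to the real and imaginary parts; the
    periodic component is in the span of the eigenfunctions by Fourier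
    analysis. *)
Lemma complex_spectral : exists (j : nat) (lam B : R),
  [/\ (0 < j)%N, 0 < lam < 1, 0 < B,
    forall phi, cfun K phi -> exists psi, is_proj tau K phi psi /\
      forall a b, 0 <= a -> 0 <= b -> cbound K j a b phi ->
        cbound K j (2 * a) (B * (a + b)) psi &
    forall n a b phi, 0 <= a -> 0 <= b -> cbound K j a b phi -> vanishing tau K phi ->
      (holder_norm (expo R j) K (iter n M phi) <= (B * lam ^+ n * (a + b))%:E)%E].
Proof.
have [N [j [lam [B [[N0 j0 lam01 B0] dec decay]]]]] := real_spectral st cK iK.
exists j, lam, (2 * B); split=> //; first by rewrite mulr_gt0.
  move=> phi cphi; have /(cfunP tau_compact cK)[ur ui p0] := cphi.
  have [f [uf pf nf hf]] := dec _ ur; have [h [uh ph nh hh]] := dec _ ui.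
  pose psi z : C := if z \in K then Complex (f z) (h z) else 0.
  have rE z : K z -> f z = rpart psi z by move=> Kz; rewrite /rpart /psi mem_set.
  have iE z : K z -> h z = ipart psi z by move=> Kz; rewrite /ipart /psi mem_set.
  have cpsi : cfun K psi.
    apply/(cfunP tau_compact cK); split; last by move=> z nK; rewrite /psi memNset.
      exact: (@uc_ext R tau tau_compact K _ _ rE uf).
    exact: (@uc_ext R tau tau_compact K _ _ iE uh).
  have [urp uip] : @uc R Z K (rpart psi) /\ @uc R Z K (ipart psi).
    by split; [exact: (@uc_ext R tau tau_compact K _ _ rE uf)|exact: (@uc_ext R tau tau_compact K _ _ iE uh)].
  exists psi; split; last first.
    move=> a b a0 b0 /(@cbound_parts R tau tau_compact K)[br bi].
    have -> : 2 * a = a + a by ring.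
    have -> : 2 * B * (a + b) = B * (a + b) + B * (a + b) by ring.
    apply: (@parts_cbound R tau tau_compact K).
      have [k1 k2] := hf a b a0 b0 br; split=> [x Kx|x y Kx Ky].
        by rewrite -rE // k1.
      by rewrite -!rE // k2.
    have [k1 k2] := hh a b a0 b0 bi; split=> [x Kx|x y Kx Ky].
      by rewrite -iE // k1.
    by rewrite -!iE // k2.
  have cd : cfun K (phi \- psi).
    rewrite (_ : phi \- psi = (fun z => (-1) * psi z + phi z)); last first.
      by apply/funext => y; rewrite mulN1r addrC.
    exact: (cfun_lin tau_compact cK).
  split.
    apply: (periodic_cspan N0 cpsi); apply/funext => z.
    have [Kz|nK] := pselect (K z); last by rewrite cpsi.2 // (iter_cfun cK iK N cpsi).2.
    have [er ei] := iter_parts cK iK N cpsi Kz.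
    apply: complex_ext.
      rewrite [LHS]er -[RHS]/(rpart psi z) -rE // -[RHS]pf //.
      by apply: (@iter_T_ext R Z K cK iK) => // y Ky; rewrite -rE.
    rewrite [LHS]ei -[RHS]/(ipart psi z) -iE // -[RHS]ph //.
    by apply: (@iter_T_ext R Z K cK iK) => // y Ky; rewrite -iE.
  have /(cfunP tau_compact cK)[urd uid _] := cd.
  apply/(vanishingP cK iK); split=> //.
    move=> eta /nf[k0 hk]; exists k0 => k z kk Kz; have := hk k z kk Kz.
    congr (`|_| <= _); apply: (@iter_T_ext R Z K cK iK) => //.
      exact: uc_lin.
    by move=> y Ky; rewrite rE // mulN1r addrC /rpart -raddfB.
  move=> eta /nh[k0 hk]; exists k0 => k z kk Kz; have := hk k z kk Kz.
  congr (`|_| <= _); apply: (@iter_T_ext R Z K cK iK) => //.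
    exact: uc_lin.
  by move=> y Ky; rewrite iE // mulN1r addrC /ipart -raddfB.
move=> n a b phi a0 b0 /(@cbound_parts R tau tau_compact K)[br bi] /(vanishingP cK iK)[cphi nr ni].
have [a1 [b1 [a10 b10 le1 h1]]] := decay n a b _ a0 b0 br nr.
have [a2 [b2 [a20 b20 le2 h2]]] := decay n a b _ a0 b0 bi ni.
have bd : cbound K j (a1 + a2) (b1 + b2) (iter n M phi).
  have E z : K z -> rpart (iter n M phi) z = iter n T (rpart phi) z /\
      ipart (iter n M phi) z = iter n T (ipart phi) z.
    exact: (iter_parts cK iK n cphi).
  apply: (@parts_cbound R tau tau_compact K).
    have [k1 k2] := h1; split=> [x Kx|x y Kx Ky]; first by rewrite (E x Kx).1 k1.
    by rewrite (E x Kx).1 (E y Ky).1 k2.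
  have [k1 k2] := h2; split=> [x Kx|x y Kx Ky]; first by rewrite (E x Kx).2 k1.
  by rewrite (E x Kx).2 (E y Ky).2 k2.
apply: le_trans (holder_norm_le _ _ bd) _; rewrite ?addr_ge0 // lee_fin.
by move: le1 le2; rewrite -!mulrA; set u := B * _; lra.
Qed.

End Projection.

(** * The spectral gap in Hoelder norm *)

Unset Implicit Arguments.
Set Strict Implicit.
Set Printing Implicit Defensive.

(* The first two conjuncts are the finiteness of r, and the one before the
   estimates is C(K) = LS(U_{f,tau}(K)) (+) B_{0,tau,K}; these make [period]
   and [unitary_proj] meaningful. *)
Theorem theorem3p61 (R : realType) (tau : probability (borelXplus R) R)
    (tau_compact : compact (meas_support tau)) (tau_stable : mean_stable tau) :
  [/\ finite_set (minimal_sets tau),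
      forall L, minimal_sets tau L ->
        exists d, has_cdim (cspan (unitary_eigen tau L)) d &
      forall K : set (Y R), compact K -> forward_invariant tau K ->
        \bigcup_(L in minimal_sets tau) L `<=` interior K ->
      (forall phi, cfun K phi -> exists! psi, is_proj tau K phi psi) /\
      exists alpha lambda C : R,
        [/\ 0 < alpha < 1, 0 < lambda < 1, 0 < C &
        forall phi, holder alpha K phi ->
        let M := trans_op tau K in
        let r := period tau in
        let pphi := unitary_proj tau K phi in
        let nrm := holder_norm alpha K in
        [/\ forall n : nat,
              (nrm (iter (n * r) M phi \- pphi)%R
                 <= (C * lambda ^+ n)%:E * nrm (phi \- pphi)%R)%E,
            forall n : nat,
              (nrm (iter n M (phi \- pphi)%R)
                 <= (C * lambda ^+ n)%:E * nrm (phi \- pphi)%R)%E,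
            forall n : nat,
              (nrm (iter n M (phi \- pphi)%R)
                 <= (C * lambda ^+ n)%:E * nrm phi)%E &
            (nrm pphi <= C%:E * nrm phi)%E]]].
Proof.
have [st] := mean_stable_contracting tau_compact tau_stable.
split; [exact: minimal_sets_finite st| |].
  move=> L; rewrite (minimal_setsE tau_compact) => /(minimal_cdim_spec st)[d [hd _ _]].
  by exists d.
move=> K cK fK _; have iK := @forward_inv R tau tau_compact K fK.
have [j [lam [B [j0 lam01 B0 dec decay]]]] := complex_spectral st cK iK.
have [lam0 lam1] := andP lam01.
split.
  move=> phi cphi; have [psi [p _]] := dec _ cphi; exists psi; split=> // psi' p'.
  exact: (proj_unique st cK iK cphi p p').
(* [2 + B] bounds the projection, [3 + B] its complement, and the decay on the
   latter costs another factor [B] *)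
have D0 : 0 < B * (3 + B) + 2 + B by rewrite !addr_gt0 // mulr_gt0 // addr_gt0.
exists (expo R j), lam, (B * (3 + B) + 2 + B); split=> //.
  rewrite expo_gt0 /= /expo invf_lt1 ?ltr0n // ltr1n; exact: j0.
move=> phi [cphi fin] M r pphi nrm.
have [psi [p hpsi]] := dec _ cphi.
have -> : pphi = psi.
  apply: (proj_unique st cK iK cphi _ p).
  by apply: (@xgetPex _ (fun=> 0) (is_proj tau K phi)); exists psi.
have [cpsi per] := cspan_periodic st cK iK p.1.
have [a [b [a0 b0 hb eN]]] := holder_norm_fin fin.
have bpsi := hpsi a b a0 b0 hb.
have ab0 : 0 <= a + b by rewrite addr_ge0.
have b2 : 0 <= B * (a + b) by rewrite mulr_ge0 // ltW.
have a2 : 0 <= 2 * a by rewrite mulr_ge0.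
have bchi : cbound K j (3 * a) (b + B * (a + b)) (phi \- psi).
  split=> [x Kx|x y Kx Ky] /=.
    apply: le_trans (le_normcD _ _) _; rewrite normcN.
    have := hb.1 x Kx; have := bpsi.1 x Kx; lra.
  have -> : phi x - psi x - (phi y - psi y) = (phi x - phi y) - (psi x - psi y) by ring.
  apply: le_trans (le_normcD _ _) _; rewrite normcN mulrDl lerD //.
    exact: hb.2.
  exact: bpsi.2.
have nchi : (nrm (phi \- psi)%R <= ((3 + B) * (a + b))%:E)%E.
  apply: le_trans (holder_norm_le _ _ bchi) _; rewrite ?mulr_ge0 ?addr_ge0 //.
  by rewrite lee_fin; lra.
have [a' [b' [a'0 b'0 hb' eN']]] :
    exists a' b', [/\ 0 <= a', 0 <= b', cbound K j a' b' (phi \- psi) &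
      nrm (phi \- psi)%R = (a' + b')%:E].
  by apply: holder_norm_fin; apply: le_lt_trans nchi _; rewrite ltry.
have step n : (nrm (iter n M (phi \- psi)%R) <= (B * lam ^+ n * (a' + b'))%:E)%E.
  exact: decay p.2.
have pw n : 0 < lam ^+ n by rewrite exprn_gt0.
have [n1 n2] : B <= B * (3 + B) + 2 + B /\ B * (3 + B) <= B * (3 + B) + 2 + B.
  have : 0 < B * (3 + B) by rewrite mulr_gt0 // addr_gt0.
  by split; lra.
have est2 n : (nrm (iter n M (phi \- psi)%R) <=
    ((B * (3 + B) + 2 + B) * lam ^+ n)%:E * nrm (phi \- psi)%R)%E.
  apply: le_trans (step n) _; rewrite eN' -EFinM lee_fin ler_wpM2r ?addr_ge0 //.
  by rewrite ler_wpM2r // ltW.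
split=> // [n|n|].
- have -> : iter (n * r) M phi \- psi = iter (n * r) M (phi \- psi).
    have -> : phi \- psi = (fun z => (-1) * psi z + phi z).
      by apply/funext => y; rewrite mulN1r addrC.
    rewrite (iter_trans_op_lin cK iK) // per; apply/funext => z.
    by rewrite mulN1r addrC.
  apply: le_trans (est2 (n * r)%N) _; rewrite eN' -!EFinM lee_fin.
  rewrite ler_wpM2r ?addr_ge0 // ler_wpM2l ?(ltW D0) //.
  by rewrite ler_wiXn2l ?(ltW lam0) ?(ltW lam1) // leq_pmulr // (period_gt0 st).
- apply: le_trans (step n) _; rewrite [nrm phi]eN -EFinM lee_fin.
  move: nchi; rewrite eN' lee_fin => le.
  apply: (@le_trans _ _ (B * lam ^+ n * ((3 + B) * (a + b)))).
    by rewrite ler_wpM2l // mulr_ge0 // ltW.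
  rewrite mulrA ler_wpM2r // mulrAC ler_wpM2r //; exact: ltW.
apply: le_trans (holder_norm_le _ _ bpsi) _; rewrite // [nrm phi]eN -EFinM lee_fin.
have : 0 <= B * (3 + B) * (a + b) by rewrite !mulr_ge0 // ltW // addr_gt0.
lra.
Qed.
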